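(* The functors $k_{\infty}[[-]]:\mathbf{SVQuiv}_\infty\to\mathbf{SPAlg}_1$ and $\mathrm{GQ}_{\infty}(-):\mathbf{SPAlg}_1\to\mathbf{SVQuiv}_\infty$ form an adjoint equivalence between the categories $\mathbf{SVQuiv}_\infty$ and $\mathbf{SPAlg}_1$.
   Context: Throughout, $k$ is a perfect field with the discrete topology. Algebras. A pseudocompact algebra is an associative, unital, Hausdorff topological $k$-algebra $A$ having a basis of neighbourhoods of $0$ consisting of open ideals $I$ of finite codimension that intersect in $0$ and such that $A\cong\varprojlim_I A/I$. Its Jacobson radical $J(A)$ is the intersection of its maximal open left ideals; $J^0(A)=A$, $J^1(A)=J(A)$, $J^n(A)=J(A)J^{n-1}(A)$ for $n>1$. $A$ is pointed if $A/J(A)$ is isomorphic to a product of copies of $k$. The category $\mathbf{PAlg}$ has as objects the pointed pseudocompact algebras $A$ with $A/J^2(A)$ finite dimensional, and as morphisms the continuous unital algebra homomorphisms $A\to B$ whose induced map $A/J(A)\to B/J(B)$ is surjective (any unital homomorphism between such algebras sends $J(A)$ into $J(B)$). $\mathbf{SPAlg}$ is the subcategory with the same objects and with morphisms the surjective ones. For $\alpha,\beta:A\to B$ in $\mathbf{PAlg}$, write $\alpha\sim_1\beta$ if $(\alpha-\beta)(A)\subseteq J(B)$ and $(\alpha-\beta)(J(A))\subseteq J^2(B)$. This is a congruence on $\mathbf{PAlg}$ and on $\mathbf{SPAlg}$; $\mathbf{PAlg}_1=\mathbf{PAlg}/\sim_1$ and $\mathbf{SPAlg}_1=\mathbf{SPAlg}/\sim_1$.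 Classes are denoted $[\alpha]$. Vquivers. A finite Vquiver $VQ=(VQ_0^*,VQ_{e,f})$ consists of a finite set $VQ_0^*=\{*\}\cup VQ_0$ of vertices ($*\notin VQ_0$) and, for each $e,f\in VQ_0^*$, a finite dimensional $k$-vector space $VQ_{e,f}$, with $VQ_{*,e}=VQ_{e,*}=0$ for every vertex $e$. A map of Vquivers $\rho:VR\to VQ$ consists of a map $\rho_0:VR_0^*\to VQ_0^*$ with $\rho_0( * )=*$ that restricts to a bijection from the elements of $VR_0$ not mapping to $*$ onto $VQ_0$, together with a linear map $\rho_{e,f}:VR_{e,f}\to VQ_{\rho_0(e),\rho_0(f)}$ for each $e,f\in VR_0^*$. It is surjective if every $\rho_{e,f}$ is surjective. Completed path algebra. For a finite Vquiver $VQ$ let $\Sigma_{VQ}=\prod_{e\in VQ_0}k$ and let $VQ_1=\bigoplus_{e,f\in VQ_0}VQ_{e,f}$ be the $\Sigma_{VQ}$-bimodule with $x\cdot(\lambda_g)=x\lambda_e$, $(\lambda_g)\cdot x=\lambda_f x$ for $x\in VQ_{e,f}$. Put $k[[VQ]]=\prod_{n\ge 0}VQ_1^{\otimes n}$ (tensor powers over $\Sigma_{VQ}$, with $VQ_1^{\otimes 0}=\Sigma_{VQ}$; product topology; multiplication induced by concatenation of tensors), an object of $\mathbf{PAlg}$. A map $\rho:VR\to VQ$ induces the unique continuous unital algebra homomorphism $k[[\rho]]:k[[VR]]\to k[[VQ]]$ that sends the basis idempotent $e\in VR_0$ of $\Sigma_{VR}$ to the basis idempotent $\rho_0(e)$ if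 $\rho_0(e)\ne *$ and to $0$ otherwise, and equals $\rho_{e,f}$ on $VR_{e,f}$. Vquivers with ideals. A relation ideal of $k[[VQ]]$ is a closed ideal $I\subseteq J^2(k[[VQ]])$. $[\mathrm{id}_{VQ}]_1$ denotes the set (a normal subgroup of $\mathrm{Aut}(k[[VQ]])$) of all morphisms $\delta:k[[VQ]]\to k[[VQ]]$ in $\mathbf{PAlg}$ with $\delta\sim_1\mathrm{id}$. For a relation ideal $I$ put $[I]=\{\delta(I)\mid\delta\in[\mathrm{id}_{VQ}]_1\}$. The category $\mathbf{SVQuiv}_\infty$ has objects the pairs $(VQ,[I])$ with $VQ$ a finite Vquiver and $I$ a relation ideal of $k[[VQ]]$; a morphism $\rho:(VQ,[I])\to(VR,[K])$ is a surjective map of Vquivers $\rho:VQ\to VR$ such that $k[[\rho]]$ takes $I'$ into $K'$ for some $I'\in[I]$ and some $K'\in[K]$. The functor $k_\infty[[-]]$. For $I,I'\in[I]$, let $\pi_I:k[[VQ]]\to k[[VQ]]/I$ denote the canonical projection and let $\gamma_{II'}:k[[VQ]]/I\to k[[VQ]]/I'$ be the unique isomorphism in $\mathbf{PAlg}_1$ with $\gamma_{II'}[\pi_I]=[\pi_{I'}]$. For each object $(VQ,[I])$ a representative $I\in[I]$ is chosen, and $k_\infty[[(VQ,[I])]]=k[[VQ]]/I$. For a morphism $\rho:(VQ,[I])\to(VR,[K])$ with $k[[\rho]](I')\subseteq K'$, $I'\in[I]$, $K'\in[K]$, one puts $k_\infty[[\rho]]=\gamma_{KK'}^{-1}\,\overline{\rho}\,\gamma_{II'}:k[[VQ]]/I\to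 k[[VR]]/K$, where $\overline{\rho}$ is the class of the homomorphism $k[[VQ]]/I'\to k[[VR]]/K'$ induced by $k[[\rho]]$; this does not depend on $I',K'$. Gabriel quiver. For $A\in\mathbf{PAlg}$ let $\mathcal{G}(A)$ be the group of automorphisms of $A$ of the form $x\mapsto (1+w)x(1+w)^{-1}$ with $w\in J(A)$, and write ${}^{\mathcal{G}}a$ for the $\mathcal{G}(A)$-orbit of $a$. Fix a complete set $E$ of (nonzero) primitive orthogonal idempotents of $A$. The Vquiver $\widetilde{\mathrm{GQ}}(A)$ has vertex set $\{*\}\cup\{{}^{\mathcal{G}}e\mid e\in E\}$ and spaces $\widetilde{\mathrm{GQ}}(A)_{{}^{\mathcal{G}}e,{}^{\mathcal{G}}f}=f\frac{J(A)}{J^2(A)}e$; it does not depend on $E$. For the class $[\alpha]$ of $\alpha:A\to B$, $\widetilde{\mathrm{GQ}}([\alpha])$ sends ${}^{\mathcal{G}(A)}e$ to ${}^{\mathcal{G}(B)}\alpha(e)$ if $\alpha(e)\neq0$ and to $*$ otherwise, and sends $f(j+J^2(A))e$ to $\alpha(f)(\alpha(j)+J^2(B))\alpha(e)$; this is well-defined. Counit. Given $A\in\mathbf{PAlg}$, choose an algebra splitting $s$ of $A\to A/J(A)$, put $\Sigma=s(A/J(A))$, and choose a $\Sigma$-bimodule splitting $t$ of $J(A)\to J(A)/J^2(A)$. The $\mathcal{G}(A)$-orbit of each primitive idempotent $e$ meets $\Sigma$ in exactly one element $e_\Sigma$. The continuous unital homomorphism $k[[\widetilde{\mathrm{GQ}}(A)]]\to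 A$ sending the idempotent of the vertex ${}^{\mathcal{G}}e$ to $e_\Sigma$ and $x\in f\frac{J(A)}{J^2(A)}e$ to $t(x)$ has a class $\varepsilon_A$ in $\mathbf{PAlg}_1$ independent of $s,t$; $\varepsilon_A$ is the counit of the adjunction between the completed path algebra functor (left adjoint, from finite Vquivers to $\mathbf{PAlg}_1$) and $\widetilde{\mathrm{GQ}}$. The functor $\mathrm{GQ}_\infty$. On objects $\mathrm{GQ}_\infty(A)=(\widetilde{\mathrm{GQ}}(A),[K_A])$, where $K_A$ is the kernel of any representative in $\mathbf{PAlg}$ of $\varepsilon_A$ (the class $[K_A]$ does not depend on the representative); on morphisms of $\mathbf{SPAlg}_1$, $\mathrm{GQ}_\infty([\alpha])=\widetilde{\mathrm{GQ}}([\alpha])$. *)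

(* Defs.v *)
From HB Require Import structures.
From mathcomp Require Import all_boot all_order all_algebra all_field.
From mathcomp Require Import all_classical topology function_spaces.
Set Implicit Arguments.
Unset Strict Implicit.
Unset Printing Implicit Defensive.
Import GRing.Theory.
Local Open Scope classical_set_scope.
Local Open Scope ring_scope.
Local Open Scope quotient_scope.

Definition perfect_field (k : fieldType) : Prop :=
  forall p : {poly k}, irreducible_poly p -> separable_poly p.

Definition some_such (T : Type) (x0 : T) (P : T -> Prop) : T :=
  if pselect (exists x, P x) is left h then projT1 (cid h) else x0.

(* An algebra is a ring with a central ring morphism [scal] from k.  MathComp's
   [algType] requires 1 != 0, but the zero algebra is needed here: it is the
   completed path algebra of the Vquiver whose only vertex is *. *)
HB.mixin Record isAlgebraOver (k : fieldType) A & GRing.PzRing A := {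
  scal : k -> A ;
  scal_zmod_morphism : zmod_morphism scal ;
  scal_monoid_morphism : monoid_morphism scal ;
  scal_central : forall (a : k) (x : A), scal a * x = x * scal a }.

#[short(type="pzAlgType")]
HB.structure Definition PzAlg (k : fieldType) :=
  {A of GRing.PzRing A & isAlgebraOver k A}.

(* No compatibility between algebra and topology is built in; it is part of
   [pseudocompact] below. *)
#[short(type="preTopAlgType")]
HB.structure Definition PreTopAlg (k : fieldType) :=
  {A of PzAlg k A & Topological A}.

Definition lmod_of (k : fieldType) (A : preTopAlgType k) : Type := A.

Section LmodOf.
Variables (k : fieldType) (A : preTopAlgType k).
HB.instance Definition _ := GRing.Zmodule.copy (lmod_of A) A.
Definition lmod_of_scale (a : k) (x : lmod_of A) : lmod_of A :=
  (scal a : A) * (x : A).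
Fact lmod_of_scaleA a b x :
  lmod_of_scale a (lmod_of_scale b x) = lmod_of_scale (a * b) x.
Proof. by rewrite /lmod_of_scale mulrA -(scal_monoid_morphism (s:=A)).2. Qed.
Fact lmod_of_scale1 : left_id 1 lmod_of_scale.
Proof. by move=> x; rewrite /lmod_of_scale (scal_monoid_morphism (s:=A)).1 mul1r. Qed.
Fact lmod_of_scaleDr : right_distributive lmod_of_scale +%R.
Proof. by move=> a x y; exact: mulrDr. Qed.
Fact lmod_of_scaleDl x : {morph (lmod_of_scale^~ x) : a b / a + b}.
Proof.
move=> a b; rewrite /lmod_of_scale -[a in LHS](opprK a) addrC.
have sB := scal_zmod_morphism (s:=A).
rewrite sB -[- a]sub0r sB -{1}(subrr 0) sB subrr sub0r opprK.
by rewrite mulrDl addrC.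
Qed.
HB.instance Definition _ := GRing.Zmodule_isLmodule.Build k (lmod_of A)
  lmod_of_scaleA lmod_of_scale1 lmod_of_scaleDr lmod_of_scaleDl.
End LmodOf.

Record submod (k : fieldType) (V : lmodType k) := Submod {
  sm_set : set V ;
  sm_closed : GRing.submod_closed [pred x | `[< sm_set x >]] }.

Definition sm_pred (k : fieldType) (V : lmodType k) (S : submod V) : {pred V} :=
  [pred x | `[< sm_set S x >]].

HB.instance Definition _ (k : fieldType) (V : lmodType k) (S : submod V) :=
  GRing.isSubmodClosed.Build k V (sm_pred S) (sm_closed S).

Definition lquot (k : fieldType) (V : lmodType k) (S : submod V) : Type :=
  Quotient.quot (sm_pred S).
Definition lsub (k : fieldType) (V : lmodType k) (S : submod V) : Type :=
  {x : V | x \in sm_pred S}.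

Section LQuot.
Variables (k : fieldType) (V : lmodType k) (S : submod V).
HB.instance Definition _ := GRing.Zmodule.on (lquot S).
HB.instance Definition _ := EqQuotient.on (lquot S).
HB.instance Definition _ := ZmodQuotient.on (lquot S).
HB.instance Definition _ := SubType.on (lsub S).
HB.instance Definition _ := [Choice of (lsub S) by <:].
HB.instance Definition _ := [SubChoice_isSubLmodule of (lsub S) by <:].

Definition lquot_scale (a : k) : lquot S -> lquot S := lift_op1 (lquot S) ( *:%R a).
Fact pi_scale a : {morph \pi_(lquot S) : x / a *: x >-> lquot_scale a x}.
Proof.
move=> x; unlock lquot_scale; apply/eqP; rewrite -Quotient.idealrBE -scalerBr.
by apply: rpredZ; rewrite Quotient.idealrBE reprK.
Qed.
Canonical pi_scale_morph a := PiMorph1 (pi_scale a).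
Fact lquot_scaleA a b x : lquot_scale a (lquot_scale b x) = lquot_scale (a * b) x.
Proof. by rewrite -[x]reprK !piE scalerA. Qed.
Fact lquot_scale1 : left_id 1 lquot_scale.
Proof. by move=> x; rewrite -[x]reprK !piE scale1r. Qed.
Fact lquot_scaleDr : right_distributive lquot_scale +%R.
Proof. by move=> a x y; rewrite -[x]reprK -[y]reprK !piE scalerDr. Qed.
Fact lquot_scaleDl x : {morph (lquot_scale^~ x) : a b / a + b}.
Proof. by move=> a b; rewrite -[x]reprK !piE scalerDl. Qed.
HB.instance Definition _ := GRing.Zmodule_isLmodule.Build k (lquot S)
  lquot_scaleA lquot_scale1 lquot_scaleDr lquot_scaleDl.
End LQuot.

Definition ideal_closed (R : pzRingType) (I : set R) : Prop :=
  [/\ I 0, forall x y, I x -> I y -> I (x - y),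
      forall a x, I x -> I (a * x) & forall x a, I x -> I (x * a)].

Record ideal (R : pzRingType) := Ideal {
  ideal_set : set R ;
  idealP : ideal_closed ideal_set }.

Definition ideal_pred (R : pzRingType) (I : ideal R) : {pred R} :=
  [pred x | `[< ideal_set I x >]].

Fact ideal_zmod_closed (R : pzRingType) (I : ideal R) :
  zmod_closed (ideal_pred I).
Proof.
case: (idealP I) => I0 IB _ _; split; first exact/asboolP.
by move=> x y /asboolP Ix /asboolP Iy; apply/asboolP/IB.
Qed.
HB.instance Definition _ (R : pzRingType) (I : ideal R) :=
  GRing.isZmodClosed.Build R (ideal_pred I) (ideal_zmod_closed I).

(* A/I, with the quotient topology *)
Definition aquot (k : fieldType) (A : preTopAlgType k) (I : ideal A) : Type :=
  Quotient.quot (ideal_pred I).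

Section AQuot.
Variables (k : fieldType) (A : preTopAlgType k) (I : ideal A).
HB.instance Definition _ := GRing.Zmodule.on (aquot I).
HB.instance Definition _ := EqQuotient.on (aquot I).
HB.instance Definition _ := ZmodQuotient.on (aquot I).
Definition aquot_one : aquot I := lift_cst (aquot I) 1.
Definition aquot_mul : aquot I -> aquot I -> aquot I := lift_op2 (aquot I) *%R.
Canonical pi_aquot_one_morph := PiConst aquot_one.
Fact pi_aquot_mul : {morph \pi_(aquot I) : x y / x * y >-> aquot_mul x y}.
Proof.
move=> x y; unlock aquot_mul; apply/eqP; rewrite -Quotient.idealrBE.
set x' := repr _; set y' := repr _.
have [_ _ Il Ir] := idealP I.
have hx : x - x' \in ideal_pred I by rewrite Quotient.idealrBE reprK.
have hy : y - y' \in ideal_pred I by rewrite Quotient.idealrBE reprK.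
rewrite -(subrKA (x' * y)) -mulrBl -mulrBr rpredD //; apply/asboolP.
  by apply: Ir; move/asboolP: hx.
by apply: Il; move/asboolP: hy.
Qed.
Canonical pi_aquot_mul_morph := PiMorph2 pi_aquot_mul.
Fact aquot_mulA : associative aquot_mul.
Proof. by move=> x y z; rewrite -[x]reprK -[y]reprK -[z]reprK !piE mulrA. Qed.
Fact aquot_mul1 : left_id aquot_one aquot_mul.
Proof. by move=> x; rewrite -[x]reprK !piE mul1r. Qed.
Fact aquot_1mul : right_id aquot_one aquot_mul.
Proof. by move=> x; rewrite -[x]reprK !piE mulr1. Qed.
Fact aquot_mulDl : left_distributive aquot_mul +%R.
Proof. by move=> x y z; rewrite -[x]reprK -[y]reprK -[z]reprK !piE mulrDl. Qed.
Fact aquot_mulDr : right_distributive aquot_mul +%R.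
Proof. by move=> x y z; rewrite -[x]reprK -[y]reprK -[z]reprK !piE mulrDr. Qed.
HB.instance Definition _ := GRing.Zmodule_isPzRing.Build (aquot I)
  aquot_mulA aquot_mul1 aquot_1mul aquot_mulDl aquot_mulDr.

Definition aquot_scal (a : k) : aquot I := \pi_(aquot I) (scal a : A).
Fact aquot_scal_zmod_morphism : zmod_morphism aquot_scal.
Proof. by move=> a b; rewrite /aquot_scal (scal_zmod_morphism (s := A)) !piE. Qed.
Fact aquot_scal_monoid_morphism : monoid_morphism aquot_scal.
Proof.
split; first by rewrite /aquot_scal (scal_monoid_morphism (s:=A)).1 !piE.
move=> a b.
by rewrite /aquot_scal (scal_monoid_morphism (s:=A)).2 -[RHS]/(aquot_mul _ _) !piE.
Qed.
Fact aquot_scal_central a x : aquot_scal a * x = x * aquot_scal a.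
Proof.
by rewrite -[x]reprK /aquot_scal -[LHS]/(aquot_mul _ _) -[RHS]/(aquot_mul _ _) !piE scal_central.
Qed.
HB.instance Definition _ := isAlgebraOver.Build k (aquot I)
  aquot_scal_zmod_morphism aquot_scal_monoid_morphism aquot_scal_central.

Definition aquot_open (U : set (aquot I)) : Prop :=
  open (\pi_(aquot I) @^-1` U : set A).
Fact aquot_openT : aquot_open setT.
Proof. by rewrite /aquot_open preimage_setT; exact: openT. Qed.
Fact aquot_openI : setI_closed aquot_open.
Proof. by move=> U W; exact: openI. Qed.
Fact aquot_open_bigU : forall (J : Type) (f : J -> set (aquot I)),
  (forall i, aquot_open (f i)) -> aquot_open (\bigcup_i f i).
Proof. by move=> J f fo; apply: bigcup_open => i _; exact: fo. Qed.
HB.instance Definition _ := isOpenTopological.Build (aquot I)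
  aquot_openT aquot_openI aquot_open_bigU.
End AQuot.

Section Pseudocompact.
Variables (k : fieldType) (A : preTopAlgType k).
Implicit Types I M S : set A.

Definition finite_codim S : Prop :=
  exists n (f : lmod_of A -> 'rV[k]_n),
    [/\ linear f, forall v, exists x, f x = v & forall x, S x <-> f x = 0].

(* For a basis B of neighbourhoods of 0 as below, A -> lim_I A/I is injective
   and a homeomorphism onto its image; the last clause is its surjectivity. *)
Definition pseudocompact : Prop :=
  [/\ continuous (fun z : A * A => z.1 + z.2),
      continuous (fun z : A * A => z.1 * z.2),
      continuous (fun z : discrete_topology k * A => (scal z.1 : A) * z.2),
      hausdorff_space A &
      exists B : set (set A),
        [/\ forall I, B I -> [/\ ideal_closed I, open I & finite_codim I],
            forall U : set A, nbhs (0 : A) U -> exists2 I, B I & I `<=` U,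
            \bigcap_(I in B) I = [set 0] &
            forall x : set A -> A,
              (forall I I', B I -> B I' -> I `<=` I' -> I' (x I - x I')) ->
              exists a, forall I, B I -> I (a - x I)]].

Definition left_ideal S : Prop :=
  [/\ S 0, forall x y, S x -> S y -> S (x - y) & forall a x, S x -> S (a * x)].

Definition maximal_open_left_ideal M : Prop :=
  [/\ left_ideal M, open M, M <> setT &
      forall M', left_ideal M' -> M `<=` M' -> M' <> setT -> M' = M].

Definition jacobson : set A := \bigcap_(M in maximal_open_left_ideal) M.

Definition mul_set S S' : set A :=
  [set x | exists2 s : seq (A * A),
     {in s, forall p, S p.1 /\ S' p.2} & x = \sum_(p <- s) p.1 * p.2].

Fixpoint jpow (n : nat) : set A :=
  match n with
  | 0 => setT
  | 1 => jacobson
  | n'.+1 => mul_set jacobson (jpow n')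
  end.

(* A/J(A) isomorphic to the algebra of all functions X -> k, the isomorphism
   being induced by p. *)
Definition pointed_algebra : Prop :=
  exists (X : Type) (p : A -> X -> k),
    [/\ forall x, zmod_morphism (p^~ x) /\ monoid_morphism (p^~ x),
        forall a x, p (scal a) x = a,
        forall y : X -> k, exists a, p a = y &
        forall a, jacobson a <-> forall x, p a x = 0].

Definition PAlg_ob : Prop :=
  [/\ pseudocompact, pointed_algebra & finite_codim (jpow 2)].

Fact jacobson_left_ideal : left_ideal jacobson.
Proof.
split=> [M [[]]//|x y Jx Jy M hM|a x Jx M hM]; case: (hM) => -[_ MB Ml] _ _ _.
  by apply: MB; [exact: Jx|exact: Jy].
by apply: Ml; exact: Jx.
Qed.

Fact jacobson_submod_closed :
  GRing.submod_closed [pred x : lmod_of A | `[< jacobson x >]].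
Proof.
have [J0 JB Jl] := jacobson_left_ideal.
split=> [|a x y /asboolP Jx /asboolP Jy]; apply/asboolP => //.
rewrite -[y]opprK; apply: (JB); first exact: Jl.
by rewrite -[- y]sub0r; exact: JB.
Qed.
Definition jac_submod : submod (lmod_of A) := Submod jacobson_submod_closed.

Fact jac2_submod_closed :
  GRing.submod_closed [pred x : lmod_of A | `[< jpow 2 x >]].
Proof.
have [_ _ Jl] := jacobson_left_ideal.
split=> [|a x y /asboolP[s Js ->] /asboolP[t Jt ->]]; apply/asboolP.
  by exists [::] => //; rewrite big_nil.
exists ([seq (scal a * p.1, p.2) | p <- s] ++ t).
  move=> p; rewrite mem_cat => /orP[/mapP[q qs ->]|/Jt//].
  by have [J1 J2] := Js _ qs; split => //; exact: Jl.
rewrite big_cat big_map; congr (_ + _).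
rewrite -[LHS]/((scal a : A) * _) mulr_sumr.
by apply: eq_bigr => p _; rewrite mulrA.
Qed.
Definition jac2_submod : submod (lmod_of A) := Submod jac2_submod_closed.

(* A/J^2(A) *)
Definition modJ2 : lmodType k := lquot jac2_submod.

End Pseudocompact.

Section PAlgMorphisms.
Variables (k : fieldType) (A B : preTopAlgType k).
Implicit Types f g : A -> B.

Definition alg_mor f : Prop :=
  [/\ zmod_morphism f, monoid_morphism f, forall a, f (scal a) = scal a &
      continuous f].

Definition PAlg_mor f : Prop :=
  alg_mor f /\ forall b, exists a, jacobson (b - f a).

Definition SPAlg_mor f : Prop := PAlg_mor f /\ forall b, exists a, f a = b.

Definition sim1 f g : Prop :=
  (forall a, jacobson (f a - g a)) /\
  (forall a, jacobson a -> jpow 2 (f a - g a)).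

End PAlgMorphisms.

(* f represents an isomorphism of PAlg_1, with inverse represented by g. *)
Definition PAlg1_iso (k : fieldType) (A B : preTopAlgType k)
    (f : A -> B) (g : B -> A) : Prop :=
  [/\ PAlg_mor f, PAlg_mor g, sim1 (g \o f) id & sim1 (f \o g) id].

(* [option (vtx Q)] is VQ_0^*, with [None] in the role of the vertex *. *)
Record vquiver (k : fieldType) := VQuiver {
  vtx : finType ;
  arr : option vtx -> option vtx -> lmodType k }.

Definition fin_dim (k : fieldType) (V : lmodType k) : Prop :=
  exists n (c : V -> 'rV[k]_n), linear c /\ bijective c.

Definition is_vquiver (k : fieldType) (Q : vquiver k) : Prop :=
  [/\ forall e f, fin_dim (arr (v := Q) e f),
      forall e (x : arr (v := Q) None e), x = 0 &
      forall e (x : arr (v := Q) e None), x = 0].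

(* If V is finite dimensional, [coordinates V] is an isomorphism of V with some
   k^n, fixed once and for all. *)
Section Coordinates.
Variables (k : fieldType) (V : lmodType k).

Definition coordinates : {n & V -> 'rV[k]_n} :=
  some_such (existT _ 0%N (fun=> 0))
    (fun c => linear (projT2 c) /\ bijective (projT2 c)).
Definition vdim : nat := projT1 coordinates.
Definition vcoord (x : V) (i : nat) : k :=
  oapp (projT2 coordinates x 0) 0 (insub i).
End Coordinates.

Section PathAlgebra.
Variables (k : fieldType) (Q : vquiver k).

(* Choosing a basis of each VQ_{e,f}, the summand of VQ_1^{\otimes n} along the
   vertices e_0, ..., e_n has as basis the tensors of basis vectors.  Such a
   tensor b_{n-1} \otimes ... \otimes b_0, with b_j the i_j-th basis vector of
   VQ_{e_j,e_{j+1}}, is coded by (e_0, [:: (e_1, i_0); ...; (e_n, i_{n-1})]).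
   Hence an element of prod_n VQ_1^{\otimes n} is a family of scalars indexed
   by these codes. *)
Fixpoint qvalid (e : vtx Q) (w : seq (vtx Q * nat)) : bool :=
  if w is (f, i) :: w' then
    (i < vdim (arr (Some e) (Some f)))%N && qvalid f w'
  else true.

Definition qpath : Type :=
  {p : vtx Q * seq (vtx Q * nat) | qvalid p.1 p.2}.

Definition qsize (p : qpath) : nat := size (val p).2.

Fact ptake_subproof (p : qpath) j : qvalid (val p).1 (take j (val p).2).
Proof.
case: p => -[e w] /=; elim: w e j => [|[f i] w IH] e [|j] //= /andP[-> /IH].
exact.
Qed.
Definition ptake (p : qpath) j : qpath :=
  exist _ ((val p).1, take j (val p).2) (ptake_subproof p j).

Fact pdrop_subproof (p : qpath) j :
  qvalid (last (val p).1 (unzip1 (take j (val p).2))) (drop j (val p).2).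
Proof.
case: p => -[e w] /=; elim: w e j => [|[f i] w IH] e [|j] //= /andP[_ /IH].
exact.
Qed.
Definition pdrop (p : qpath) j : qpath :=
  exist _ (last (val p).1 (unzip1 (take j (val p).2)), drop j (val p).2)
    (pdrop_subproof p j).

(* k[[VQ]]; in a product x y the factor y comes first along the path, so that an
   element of VQ_{e,f} is fixed by the idempotent of f on the left and by that
   of e on the right. *)
Definition cpath : Type := qpath -> k.

HB.instance Definition _ := Topological.copy cpath
  (prod_topology (fun _ : qpath => discrete_topology k)).

Definition cpath_add (x y : cpath) : cpath := fun p => x p + y p.
Definition cpath_opp (x : cpath) : cpath := fun p => - x p.
Definition cpath_one : cpath := fun p => (nilp (val p).2)%:R.
Definition cpath_mul (x y : cpath) : cpath :=
  fun p => \sum_(j < (qsize p).+1) x (pdrop p j) * y (ptake p j).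

Fact cpath_addA : associative cpath_add.
Proof. by move=> x y z; apply/funext => p; exact: addrA. Qed.
Fact cpath_addC : commutative cpath_add.
Proof. by move=> x y; apply/funext => p; exact: addrC. Qed.
Fact cpath_add0 : left_id (fun=> 0 : k) cpath_add.
Proof. by move=> x; apply/funext => p; exact: add0r. Qed.
Fact cpath_addN : left_inverse (fun=> 0 : k) cpath_opp cpath_add.
Proof. by move=> x; apply/funext => p; exact: addNr. Qed.
HB.instance Definition _ := GRing.isZmodule.Build cpath
  cpath_addA cpath_addC cpath_add0 cpath_addN.

Fact ptake_size p : ptake p (qsize p) = p.
Proof. by apply: val_inj; case: p => -[e w] v /=; rewrite take_size. Qed.
Fact pdrop0 p : pdrop p 0 = p.
Proof. by apply: val_inj; case: p => -[e w] v /=; rewrite take0 drop0. Qed.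
Fact qsize_take p j : (j <= qsize p)%N -> qsize (ptake p j) = j.
Proof. exact: size_takel. Qed.
Fact qsize_drop p j : qsize (pdrop p j) = (qsize p - j)%N.
Proof. exact: size_drop. Qed.
Fact ptake_take p i j : ptake (ptake p (i + j)) i = ptake p i.
Proof. by apply: val_inj; rewrite /= take_takel ?leq_addr. Qed.
Fact pdrop_drop p i j : pdrop (pdrop p i) j = pdrop p (i + j).
Proof.
apply: val_inj; rewrite /= drop_drop addnC; congr pair.
by rewrite takeD /unzip1 map_cat last_cat.
Qed.
Fact pdrop_take p i j : pdrop (ptake p (i + j)) i = ptake (pdrop p i) j.
Proof.
by apply: val_inj; rewrite /= take_takel ?leq_addr // take_drop addnC.
Qed.

Fact cpath_mulA : associative cpath_mul.
Proof.
move=> x y z; apply/funext => p; rewrite /cpath_mul; set n := qsize p.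
pose T i j := x (pdrop p (i + j)) * y (ptake (pdrop p i) j) * z (ptake p i).
transitivity (\sum_(m < n.+1) \sum_(i < n.+1 | (i <= m)%N) T i (m - i)%N).
  apply: eq_bigr => m _; rewrite mulr_sumr qsize_take -1?ltnS //.
  rewrite (big_ord_widen_cond n.+1 xpredT
    (fun i => x (pdrop p m) * (y (pdrop (ptake p m) i) * z (ptake (ptake p m) i)))) //.
  apply: eq_bigr => i /=; rewrite ltnS => im; rewrite /T subnKC // mulrA.
  have := pdrop_take p i (m - i); have := ptake_take p i (m - i).
  by rewrite subnKC // => -> ->.
rewrite (exchange_big_dep xpredT) //=; apply: eq_bigr => i _.
rewrite mulr_suml qsize_drop.
rewrite -(big_mkord (fun m => (i <= m)%N) (fun m => T i (m - i)%N)).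
rewrite -(big_mkord xpredT (fun j => x (pdrop (pdrop p i) j) *
  y (ptake (pdrop p i) j) * z (ptake p i))).
have le_in : (i <= n)%N by rewrite -ltnS.
rewrite (big_cat_nat (n := i)) //=; last exact: leqW.
rewrite big_nat_cond big_pred0 ?add0r; last first.
  by move=> m; rewrite leq0n /= ltnNge; case: leqP.
rewrite -{1}[nat_of_ord i]add0n big_addn subSn //.
rewrite big_nat_cond [RHS]big_nat_cond.
apply: eq_big => [m|m _]; first by rewrite leq_addl andbT.
by rewrite addnK /T pdrop_drop.
Qed.
Fact cpath_mul1l : left_id cpath_one cpath_mul.
Proof.
move=> x; apply/funext => p; rewrite /cpath_mul big_ord_recr /= big1 => [|i _].
  by rewrite add0r {1}/cpath_one /= drop_size mul1r ptake_size.
rewrite /cpath_one /nilp /= size_drop subn_eq0 leqNgt.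
by rewrite [(_ < _)%N](ltn_ord i) mul0r.
Qed.
Fact cpath_mul1r : right_id cpath_one cpath_mul.
Proof.
move=> x; apply/funext => p; rewrite /cpath_mul big_ord_recl /= big1 => [|i _].
  by rewrite addr0 {1}/cpath_one /= take0 mulr1 pdrop0.
rewrite /cpath_one /nilp -[size _]/(qsize (ptake p i.+1)) qsize_take ?mulr0 //.
Qed.
Fact cpath_mulDl : left_distributive cpath_mul +%R.
Proof.
move=> x y z; apply/funext => p; rewrite -[RHS]/(cpath_mul x z p + _) -big_split.
by apply: eq_bigr => j _; exact: mulrDl.
Qed.
Fact cpath_mulDr : right_distributive cpath_mul +%R.
Proof.
move=> x y z; apply/funext => p; rewrite -[RHS]/(cpath_mul x y p + _) -big_split.
by apply: eq_bigr => j _; exact: mulrDr.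
Qed.
HB.instance Definition _ := GRing.Zmodule_isPzRing.Build cpath
  cpath_mulA cpath_mul1l cpath_mul1r cpath_mulDl cpath_mulDr.

Definition cpath_scal (a : k) : cpath := fun p => a *+ nilp (val p).2.
Fact cpath_scalE a (x : cpath) p : (cpath_scal a * x) p = a * x p.
Proof.
rewrite -[x in RHS]mul1r -[LHS]/(cpath_mul _ _ p) -[(1 * x) p]/(cpath_mul _ _ p).
rewrite mulr_sumr; apply: eq_bigr => j _.
by rewrite mulrA; congr (_ * _); exact/esym/mulr_natr.
Qed.
Fact cpath_scal_zmod_morphism : zmod_morphism cpath_scal.
Proof. by move=> a b; apply/funext => p; exact: mulrnBl. Qed.
Fact cpath_scal_monoid_morphism : monoid_morphism cpath_scal.
Proof.
split=> // a b; apply/funext => p.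
by rewrite cpath_scalE /cpath_scal mulrnAr.
Qed.
Fact cpath_scal_central a x : cpath_scal a * x = x * cpath_scal a.
Proof.
apply/funext => p; rewrite cpath_scalE -[x in LHS]mulr1.
rewrite -[(x * 1) p]/(cpath_mul _ _ p) -[RHS]/(cpath_mul _ _ p) mulr_sumr.
by apply: eq_bigr => j _; rewrite mulrCA; congr (_ * _); exact/mulr_natr.
Qed.
HB.instance Definition _ := isAlgebraOver.Build k cpath
  cpath_scal_zmod_morphism cpath_scal_monoid_morphism cpath_scal_central.

End PathAlgebra.

Section PathGenerators.
Variables (k : fieldType) (Q : vquiver k).

Definition videm (e : option (vtx Q)) : cpath Q :=
  fun p => if e is Some e' then (val p == (e', [::]))%:R else 0.

Definition varr (e f : option (vtx Q)) : arr e f -> cpath Q :=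
  match e, f with
  | Some e', Some f' => fun x p =>
      if val p is (e0, [:: (f0, i)]) then
        if (e0 == e') && (f0 == f') then vcoord x i else 0
      else 0
  | _, _ => fun _ _ => 0
  end.

End PathGenerators.

Section VMaps.
Variable k : fieldType.

Record vmap (R Q : vquiver k) := VMap {
  vmap0 : option (vtx R) -> option (vtx Q) ;
  vmap1 : forall e f, arr e f -> arr (vmap0 e) (vmap0 f) }.

Definition is_vmap (R Q : vquiver k) (r : vmap R Q) : Prop :=
  [/\ vmap0 r None = None,
      forall f : vtx Q, exists! e : vtx R, vmap0 r (Some e) = Some f &
      forall e f, linear (@vmap1 R Q r e f)].

Definition vmap_surj (R Q : vquiver k) (r : vmap R Q) : Prop :=
  forall e f y, exists x, @vmap1 R Q r e f x = y.

Definition vmap_id (Q : vquiver k) : vmap Q Q :=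
  @VMap Q Q id (fun _ _ => id).

Definition vmap_comp (P Q R : vquiver k) (s : vmap Q R) (r : vmap P Q) :
    vmap P R :=
  @VMap P R (vmap0 s \o vmap0 r)
    (fun e f x => @vmap1 _ _ s _ _ (@vmap1 _ _ r e f x)).

Definition induces (R Q : vquiver k) (r : vmap R Q)
    (h : cpath R -> cpath Q) : Prop :=
  [/\ alg_mor h,
      forall e, h (videm e) = videm (vmap0 r e) &
      forall e f (x : arr e f), h (varr x) = varr (vmap1 r x)].

(* k[[rho]]: by universal property there is exactly one h with [induces r h],
   for r a map of finite Vquivers. *)
Definition cpath_map (R Q : vquiver k) (r : vmap R Q) : cpath R -> cpath Q :=
  some_such (fun=> 0) (induces r).

End VMaps.

(* The objects of the category are the [X : ob] with [is_ob X]; its morphisms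
   [X -> Y] are the [f : mor X Y] with [is_mor f], identified along [mor_eq]. *)
Record cat_data := CatData {
  ob : Type ;
  is_ob : ob -> Prop ;
  mor : ob -> ob -> Type ;
  is_mor : forall X Y, mor X Y -> Prop ;
  mor_eq : forall X Y, mor X Y -> mor X Y -> Prop ;
  mor_id : forall X, mor X X ;
  mor_comp : forall X Y Z, mor Y Z -> mor X Y -> mor X Z }.
Arguments is_ob {c}.
Arguments is_mor {c X Y}.
Arguments mor_eq {c X Y}.
Arguments mor_id {c}.
Arguments mor_comp {c X Y Z}.

Record is_category (C : cat_data) : Prop := IsCategory {
  cat_refl : forall (X Y : ob C) (f : mor X Y), is_ob X -> is_ob Y ->
    is_mor f -> mor_eq f f ;
  cat_sym : forall (X Y : ob C) (f g : mor X Y), is_ob X -> is_ob Y ->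
    is_mor f -> is_mor g -> mor_eq f g -> mor_eq g f ;
  cat_trans : forall (X Y : ob C) (f g h : mor X Y), is_ob X -> is_ob Y ->
    is_mor f -> is_mor g -> is_mor h ->
    mor_eq f g -> mor_eq g h -> mor_eq f h ;
  cat_id_mor : forall X : ob C, is_ob X -> is_mor (mor_id X) ;
  cat_comp_mor : forall (X Y Z : ob C) (g : mor Y Z) (f : mor X Y),
    is_ob X -> is_ob Y -> is_ob Z -> is_mor g -> is_mor f ->
    is_mor (mor_comp g f) ;
  cat_comp_eq : forall (X Y Z : ob C) (g g' : mor Y Z) (f f' : mor X Y),
    is_ob X -> is_ob Y -> is_ob Z ->
    is_mor g -> is_mor g' -> is_mor f -> is_mor f' ->
    mor_eq g g' -> mor_eq f f' -> mor_eq (mor_comp g f) (mor_comp g' f') ;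
  cat_idl : forall (X Y : ob C) (f : mor X Y), is_ob X -> is_ob Y -> is_mor f ->
    mor_eq (mor_comp (mor_id Y) f) f ;
  cat_idr : forall (X Y : ob C) (f : mor X Y), is_ob X -> is_ob Y -> is_mor f ->
    mor_eq (mor_comp f (mor_id X)) f ;
  cat_assoc : forall (X Y Z W : ob C) (h : mor Z W) (g : mor Y Z) (f : mor X Y),
    is_ob X -> is_ob Y -> is_ob Z -> is_ob W ->
    is_mor h -> is_mor g -> is_mor f ->
    mor_eq (mor_comp h (mor_comp g f)) (mor_comp (mor_comp h g) f) }.
Arguments is_category : clear implicits.

Record functor_data (C D : cat_data) := FunctorData {
  fob :> ob C -> ob D ;
  fmor : forall X Y, mor X Y -> mor (fob X) (fob Y) }.
Arguments fmor {C D} f {X Y}.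

Record is_functor (C D : cat_data) (F : functor_data C D) : Prop := IsFunctor {
  functor_ob : forall X, is_ob X -> is_ob (F X) ;
  functor_mor : forall (X Y : ob C) (f : mor X Y), is_ob X -> is_ob Y ->
    is_mor f -> is_mor (fmor F f) ;
  functor_eq : forall (X Y : ob C) (f g : mor X Y), is_ob X -> is_ob Y ->
    is_mor f -> is_mor g -> mor_eq f g -> mor_eq (fmor F f) (fmor F g) ;
  functor_id : forall X, is_ob X ->
    mor_eq (fmor F (mor_id X)) (mor_id (F X)) ;
  functor_comp : forall (X Y Z : ob C) (g : mor Y Z) (f : mor X Y),
    is_ob X -> is_ob Y -> is_ob Z -> is_mor g -> is_mor f ->
    mor_eq (fmor F (mor_comp g f)) (mor_comp (fmor F g) (fmor F f)) }.

Definition is_iso (C : cat_data) (X Y : ob C) (f : mor X Y) : Prop :=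
  is_mor f /\ exists g : mor Y X,
    [/\ is_mor g, mor_eq (mor_comp g f) (mor_id X) &
        mor_eq (mor_comp f g) (mor_id Y)].

(* F is left adjoint to G, with invertible unit and counit. *)
Definition adjoint_equivalence (C D : cat_data)
    (F : functor_data C D) (G : functor_data D C) : Prop :=
  exists (eta : forall X : ob C, mor X (G (F X)))
         (eps : forall Y : ob D, mor (F (G Y)) Y),
    [/\ (forall X, is_ob X -> is_iso (eta X)) /\
        (forall Y, is_ob Y -> is_iso (eps Y)),
        forall (X X' : ob C) (f : mor X X'), is_ob X -> is_ob X' -> is_mor f ->
          mor_eq (mor_comp (eta X') f) (mor_comp (fmor G (fmor F f)) (eta X)),
        forall (Y Y' : ob D) (g : mor Y Y'), is_ob Y -> is_ob Y' -> is_mor g ->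
          mor_eq (mor_comp (eps Y') (fmor F (fmor G g))) (mor_comp g (eps Y)),
        forall X, is_ob X ->
          mor_eq (mor_comp (eps (F X)) (fmor F (eta X))) (mor_id (F X)) &
        forall Y, is_ob Y ->
          mor_eq (mor_comp (fmor G (eps Y)) (eta (G Y))) (mor_id (G Y))].

Definition SPAlg1 (k : fieldType) : cat_data :=
  @CatData (preTopAlgType k) (@PAlg_ob k) (fun A B => A -> B)
    (@SPAlg_mor k) (@sim1 k) (fun _ => id) (fun _ _ _ g f => g \o f).

Section SVQuiv.
Variable k : fieldType.

Definition relation_ideal (Q : vquiver k) (I : ideal (cpath Q)) : Prop :=
  closed (ideal_set I) /\ ideal_set I `<=` @jpow k (cpath Q) 2.

(* [I] *)
Definition ideal_class (Q : vquiver k) (I : ideal (cpath Q)) :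
    set (ideal (cpath Q)) :=
  [set I' | exists2 delta : cpath Q -> cpath Q,
     PAlg_mor delta /\ sim1 delta id & ideal_set I' = delta @` ideal_set I].

Record svquiver := SVQuiver {
  sv_quiver : vquiver k ;
  sv_class : set (ideal (cpath sv_quiver)) }.
Arguments sv_class : clear implicits.

Definition is_svquiver (X : svquiver) : Prop :=
  is_vquiver (sv_quiver X) /\
  exists2 I, relation_ideal I & sv_class X = ideal_class I.

Definition respects (X Y : svquiver) (r : vmap (sv_quiver X) (sv_quiver Y))
    (I' : ideal (cpath (sv_quiver X))) (K' : ideal (cpath (sv_quiver Y))) :=
  [/\ sv_class X I', sv_class Y K' &
      forall x, ideal_set I' x -> ideal_set K' (cpath_map r x)].

Definition is_svmap (X Y : svquiver) (r : vmap (sv_quiver X) (sv_quiver Y)) :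
    Prop :=
  [/\ is_vmap r, vmap_surj r & exists I' K', respects r I' K'].

Definition SVQuiv : cat_data :=
  @CatData svquiver is_svquiver (fun X Y => vmap (sv_quiver X) (sv_quiver Y))
    is_svmap (fun _ _ => eq) (fun X => vmap_id (sv_quiver X))
    (fun _ _ _ s r => vmap_comp s r).

End SVQuiv.
Arguments sv_class {k}.

Section KInfty.
Variables (k : fieldType).
Variable rep : forall X : svquiver k, ideal (cpath (sv_quiver X)).

(* [gamma] represents \gamma_{II'} and [gamma'] its inverse. *)
Definition is_gamma (Q : vquiver k) (I I' : ideal (cpath Q))
    (gamma : aquot I -> aquot I') (gamma' : aquot I' -> aquot I) : Prop :=
  PAlg1_iso gamma gamma' /\ sim1 (gamma \o \pi_(aquot I)) \pi_(aquot I').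

Definition kinf_ob (X : svquiver k) : preTopAlgType k := aquot (rep X).

Definition is_kinf_mor (X Y : svquiver k)
    (r : vmap (sv_quiver X) (sv_quiver Y)) (phi : kinf_ob X -> kinf_ob Y) :
    Prop :=
  exists (I' : ideal (cpath (sv_quiver X))) (K' : ideal (cpath (sv_quiver Y)))
    (gammaI : aquot (rep X) -> aquot I') (gammaI' : aquot I' -> aquot (rep X))
    (gammaK : aquot (rep Y) -> aquot K') (gammaK' : aquot K' -> aquot (rep Y))
    (rbar : aquot I' -> aquot K'),
    [/\ respects r I' K', is_gamma gammaI gammaI', is_gamma gammaK gammaK',
        forall x, rbar (\pi_(aquot I') x) = \pi_(aquot K') (cpath_map r x) &
        SPAlg_mor phi /\ sim1 phi (gammaK' \o rbar \o gammaI)].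

(* The value on a morphism is a representative of its class in SPAlg_1. *)
Definition kinf : functor_data (SVQuiv k) (SPAlg1 k) :=
  @FunctorData (SVQuiv k) (SPAlg1 k) kinf_ob
    (fun X Y r => some_such (fun=> 0) (@is_kinf_mor X Y r)).

End KInfty.

Section Gabriel.
Variables (k : fieldType) (A : preTopAlgType k).

(* The G(A)-orbit of e *)
Definition orbitG (e : A) : set A :=
  [set x | exists w u, [/\ jacobson w, (1 + w) * u = 1, u * (1 + w) = 1 &
                           x = (1 + w) * e * u]].

Definition idempotent_elt (e : A) : Prop := e * e = e.

Definition primitive_idempotent (e : A) : Prop :=
  [/\ idempotent_elt e, e <> 0 &
      forall f g, idempotent_elt f -> idempotent_elt g -> f * g = 0 ->
        g * f = 0 -> e = f + g -> f = 0 \/ g = 0].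

Definition complete_primitive (E : seq A) : Prop :=
  [/\ uniq E, forall e, e \in E -> primitive_idempotent e,
      forall e f, e \in E -> f \in E -> e <> f -> e * f = 0 &
      \sum_(e <- E) e = 1].

(* f (J(A)/J^2(A)) e, as a subspace of A/J^2(A) *)
Definition arrow_set (e f : A) : set (modJ2 A) :=
  [set x | exists2 j : A, jacobson j &
     x = \pi_(lquot (jac2_submod A)) (f * j * e : lmod_of A)].

Fact arrow_submod_closed e f :
  GRing.submod_closed [pred x | `[< arrow_set e f x >]].
Proof.
have [J0 JB Jl] := @jacobson_left_ideal k A.
split=> [|a x y /asboolP[i Ji ->] /asboolP[j Jj ->]]; apply/asboolP.
  by exists 0 => //; rewrite mulr0 mul0r; apply/esym; rewrite !piE.
exists (scal a * i + j).
  rewrite -[j]opprK; apply: (JB); first exact: Jl.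
  by rewrite -[- j]sub0r; exact: JB.
rewrite mulrDr mulrDl mulrA -scal_central -!mulrA.
rewrite -[(scal a : A) * _]/(a *: (f * (i * e) : lmod_of A)).
by rewrite -[LHS]/(lquot_scale _ _ + _) !piE.
Qed.
Definition arrow_submod (e f : A) : submod (modJ2 A) :=
  Submod (arrow_submod_closed e f).

Variable E : seq A.

Definition gq_vtx : finType := seq_sub [seq orbitG e | e <- E].

(* The member of E in the given orbit; 0 for the vertex *. *)
Definition gq_idem (v : option gq_vtx) : A :=
  if v is Some w then nth 0 E (index (val w) [seq orbitG e | e <- E]) else 0.

Definition GQ : vquiver k :=
  @VQuiver k gq_vtx (fun v w => lsub (arrow_submod (gq_idem v) (gq_idem w))).

Definition gq_val (v w : option gq_vtx) (x : arr (v := GQ) v w) : modJ2 A :=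
  val (x : lsub (arrow_submod (gq_idem v) (gq_idem w))).

End Gabriel.

Section GabrielMap.
Variables (k : fieldType) (A B : preTopAlgType k) (EA : seq A) (EB : seq B).
Variable alpha : A -> B.

Definition gq_map0 (v : option (gq_vtx EA)) : option (gq_vtx EB) :=
  if alpha (gq_idem v) == 0 then None else insub (orbitG (alpha (gq_idem v))).

(* x = f (a + J^2) e goes to alpha(f) (alpha(a) + J^2) alpha(e); that the latter
   lies in the prescribed subspace, as [insubd] requires, is part of the
   well-definedness of this functor. *)
Definition gq_map1 (v w : option (gq_vtx EA)) (x : arr (v := GQ EA) v w) :
    arr (v := GQ EB) (gq_map0 v) (gq_map0 w) :=
  insubd (0 : lsub (arrow_submod (gq_idem (gq_map0 v)) (gq_idem (gq_map0 w))))
    (\pi_(lquot (jac2_submod B))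
       (alpha (gq_idem w) * alpha (repr (gq_val x)) * alpha (gq_idem v))).

Definition GQ_map : vmap (GQ EA) (GQ EB) :=
  @VMap k (GQ EA) (GQ EB) gq_map0 gq_map1.

End GabrielMap.

Section Counit.
Variables (k : fieldType) (A : preTopAlgType k) (E : seq A).

Local Notation piJ := (\pi_(lquot (jac_submod A))).
Local Notation piJ2 := (\pi_(lquot (jac2_submod A))).

Definition algebra_splitting (s : lquot (jac_submod A) -> lmod_of A) : Prop :=
  [/\ linear s, s (piJ 1) = 1,
      forall x y : A, s (piJ (x * y)) = (s (piJ x) : A) * s (piJ y) &
      cancel s piJ].

(* t is only relevant on J(A)/J^2(A). *)
Definition bimodule_splitting (s : lquot (jac_submod A) -> lmod_of A)
    (t : modJ2 A -> A) : Prop :=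
  [/\ forall i j : A, jacobson i -> jacobson j ->
        t (piJ2 (i + j)) = t (piJ2 i) + t (piJ2 j),
      forall (a : k) (j : A), jacobson j ->
        t (piJ2 (scal a * j)) = scal a * t (piJ2 j),
      forall sigma tau j : A, range s sigma -> range s tau -> jacobson j ->
        t (piJ2 (sigma * j * tau)) = sigma * t (piJ2 j) * tau &
      forall j : A, jacobson j ->
        jacobson (t (piJ2 j)) /\ piJ2 (t (piJ2 j)) = piJ2 j].

(* The value of phi at the vertex v is the unique element of v lying in
   Sigma = range s. *)
Definition is_counit (phi : cpath (GQ E) -> A) : Prop :=
  exists (s : lquot (jac_submod A) -> lmod_of A) (t : modJ2 A -> A),
    [/\ algebra_splitting s, bimodule_splitting s t, alg_mor phi,
        forall v : gq_vtx E,
          val v (phi (videm (Some v : option (vtx (GQ E))))) /\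
          range s (phi (videm (Some v : option (vtx (GQ E))))) &
        forall (v w : gq_vtx E) (x : arr (v := GQ E) (Some v) (Some w)),
          phi (varr x) = t (gq_val x)].

(* K is the kernel of a representative phi of the counit's class. *)
Definition is_counit_kernel (K : ideal (cpath (GQ E))) : Prop :=
  exists phi0 phi : cpath (GQ E) -> A,
    [/\ is_counit phi0, PAlg_mor phi, sim1 phi phi0 &
        ideal_set K = [set x | phi x = 0]].

End Counit.

Section GQInfty.
Variables (k : fieldType) (E : forall A : preTopAlgType k, seq A).
Variable K : forall A : preTopAlgType k, ideal (cpath (GQ (E A))).

Definition GQinf : functor_data (SPAlg1 k) (SVQuiv k) :=
  @FunctorData (SPAlg1 k) (SVQuiv k)
    (fun A : preTopAlgType k => SVQuiver (ideal_class (K A)))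
    (fun (A B : preTopAlgType k) alpha => GQ_map (E A) (E B) alpha).

End GQInfty.

(* Main.v *)
Require Import Defs.
From HB Require Import structures.
From mathcomp Require Import all_boot all_order all_algebra.
From mathcomp Require Import all_classical topology function_spaces.
Set Implicit Arguments.
Unset Strict Implicit.
Unset Printing Implicit Defensive.
Import GRing.Theory.
Local Open Scope classical_set_scope.
Local Open Scope ring_scope.
Local Open Scope quotient_scope.

(** The functors compare an algebra with its presentations.  For an object [A] of
    [PAlg], the counit is a continuous surjection [phi] from the path algebra of
    the Gabriel quiver [GQ] onto [A], with kernel inside [J^2]; for a Vquiver
    with ideal [(Q, [I])], the projection of [k[[Q]]] onto [k[[Q]]/I] is another
    map of this kind.  Call such a map a presentation ([presentation]).

    The heart of the matter is that a presentation [phi : k[[Q]] -> A] sees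
    vertices modulo [J] and arrows modulo [J^2].  Hence for every surjection
    [alpha : k[[P]] -> A] there is a map of Vquivers [r : P -> Q] such that
    [phi \o k[[r]]] and [alpha] are congruent for [sim1] ([vmap_exists]), and it is
    unique ([vmap_faithful]).  The Gabriel quiver of a morphism [A -> B] is
    the [r] that belongs to its composite with the counit of [A] ([GQ_map_spec]); the
    unit at [(Q, [I])] is the [r] that compares the projection with the counit of
    [k[[Q]]/I], and its inverse compares them the other way round.  By uniqueness
    all equations between maps of Vquivers (functoriality, naturality, triangle
    identities) become congruences of algebra morphisms, which follow from
    the compatibility of every arrow with the presentations.

    That such an [r] respects the classes of ideals rests on the projectivity of
    path algebras ([cpath_lift]): congruent morphisms differ by an automorphism
    of [k[[P]]] congruent to the identity, and these automorphisms are exactly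
    what is divided out in the class [[I]] ([svmap_intro]).

    The topological input is twofold.  In an object of [PAlg] every open ideal
    contains a power of the radical ([jpow_open_ideal]), so series in
    the radical converge ([jadic_limit]): this gives inverses of [1 + w], lifts of
    idempotents and the universal property of [k[[Q]]] ([cpath_univ_ex]).
    And [k[[Q]]] is linearly compact ([linear_compactness]), so images of
    its closed ideals are closed: this gives surjectivity from surjectivity modulo
    [J^2] ([generated_surj]), completeness of the quotients [k[[Q]]/I], and openness of
    surjections ([image_cpath_ge_open]), hence continuity of inverses. *)

(** * Products of ideals and powers of the radical *)

HB.instance Definition _ (k : fieldType) (A : pzAlgType k) :=
  GRing.isZmodMorphism.Build k A (@scal k A) (@scal_zmod_morphism k A).
HB.instance Definition _ (k : fieldType) (A : pzAlgType k) :=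
  GRing.isMonoidMorphism.Build k A (@scal k A) (@scal_monoid_morphism k A).

Lemma subrBB (V : zmodType) (z x y : V) : x - z - (y - z) = x - y.
Proof. by rewrite opprB addrA subrK. Qed.

Lemma subrACA (V : zmodType) (x y z t : V) : x - y - (z - t) = x - z - (y - t).
Proof. by rewrite !opprB addrACA [RHS]addrACA [- y - z]addrC. Qed.

Section ZmodMorphism.
Variables (U V : zmodType) (f : U -> V).
Hypothesis fB : zmod_morphism f.

Lemma zm0 : f 0 = 0.
Proof. by rewrite -[0 in LHS](subrr 0) fB subrr. Qed.

Lemma zmN x : f (- x) = - f x.
Proof. by rewrite -[in LHS](sub0r x) fB zm0 sub0r. Qed.

Lemma zmD x y : f (x + y) = f x + f y.
Proof. by rewrite -[in LHS](opprK y) fB zmN opprK. Qed.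

Lemma zm_sum (I : Type) (r : seq I) (P : pred I) F :
  f (\sum_(i <- r | P i) F i) = \sum_(i <- r | P i) f (F i).
Proof. exact: (big_morph f zmD zm0). Qed.

End ZmodMorphism.

Section Ideals.
Variables (R : pzRingType) (I : set R).
Hypothesis hI : ideal_closed I.

Lemma idl0 : I 0. Proof. by case: hI. Qed.
Lemma idlB x y : I x -> I y -> I (x - y). Proof. by case: hI => _ h _ _; apply: h. Qed.
Lemma idlN x : I x -> I (- x). Proof. by move=> Ix; rewrite -sub0r; apply/idlB/Ix/idl0. Qed.
Lemma idlD x y : I x -> I y -> I (x + y).
Proof. by move=> Ix Iy; rewrite -(opprK y); apply/idlB/idlN. Qed.
Lemma idlMl a x : I x -> I (a * x). Proof. by case: hI => _ _ h _; apply: h. Qed.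
Lemma idlMr a x : I x -> I (x * a). Proof. by case: hI => _ _ _ h; apply: h. Qed.
Lemma idl_sum (T : Type) (r : seq T) (P : pred T) F :
  (forall i, P i -> I (F i)) -> I (\sum_(i <- r | P i) F i).
Proof. by move=> h; elim/big_ind: _ => //; [exact: idl0|exact: idlD]. Qed.
Lemma idl_trans y x z : I (x - y) -> I (y - z) -> I (x - z).
Proof. by move=> h1 h2; rewrite -(subrKA y); apply: idlD. Qed.
Lemma idl_sym x y : I (x - y) -> I (y - x).
Proof. by move=> h; rewrite -opprB; apply: idlN. Qed.
Lemma idl_sub x y : I (x - y) -> I y -> I x.
Proof. by move=> h1 h2; rewrite -(subrK y x); apply: idlD. Qed.
Lemma idl_mulB x x' y y' : I (x - x') -> I (y - y') -> I (x * y - x' * y').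
Proof.
move=> h1 h2; rewrite -(subrKA (x' * y)) -mulrBl -mulrBr.
by apply: idlD; [exact: idlMr|exact: idlMl].
Qed.
Lemma idl_addB x x' y y' : I (x - x') -> I (y - y') -> I (x + y - (x' + y')).
Proof. by move=> h1 h2; rewrite opprD addrACA; apply: idlD. Qed.
End Ideals.

Section MulSet.
Variables (k : fieldType) (A : preTopAlgType k).
Implicit Types (S P : set A).

Lemma mul_setM S S' a b : S a -> S' b -> mul_set S S' (a * b).
Proof.
by move=> Sa Sb; exists [:: (a, b)]; rewrite ?big_seq1 // => p /[!inE] /eqP ->.
Qed.

Lemma mul_set0 S S' : mul_set S S' 0.
Proof. by exists [::]; rewrite ?big_nil. Qed.

Lemma mul_setD S S' x y : mul_set S S' x -> mul_set S S' y -> mul_set S S' (x + y).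
Proof.
move=> [s hs ->] [t ht ->]; exists (s ++ t); last by rewrite big_cat.
by move=> p; rewrite mem_cat => /orP[/hs|/ht].
Qed.

Lemma mul_set_ind S S' P :
  P 0 -> (forall x y, P x -> P y -> P (x + y)) ->
  (forall a b, S a -> S' b -> P (a * b)) -> mul_set S S' `<=` P.
Proof.
move=> P0 PD PM x [s hs ->]; elim: s hs => [|p s IH] hs; first by rewrite big_nil.
rewrite big_cons; apply: PD.
  by have [? ?] := hs p (mem_head _ _); apply: PM.
by apply: IH => q qs; apply: hs; rewrite inE qs orbT.
Qed.

Lemma mul_setS S S' T T' : S `<=` T -> S' `<=` T' -> mul_set S S' `<=` mul_set T T'.
Proof.
move=> h h'; apply: mul_set_ind; [exact: mul_set0|move=> x y; exact: mul_setD|].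
by move=> a b /h ? /h' ?; apply: mul_setM.
Qed.

Lemma mul_set_ideal S S' :
  (forall a x, S x -> S (a * x)) -> (forall x a, S' x -> S' (x * a)) ->
  ideal_closed (mul_set S S').
Proof.
move=> hl hr.
have Ml a : mul_set S S' `<=` [set x | mul_set S S' (a * x)].
  apply: mul_set_ind => [|x y /= ? ?|x y ? ?] /=; first by rewrite mulr0; exact: mul_set0.
    by rewrite mulrDr; exact: mul_setD.
  by rewrite mulrA; apply: mul_setM => //; exact: hl.
have Mr a : mul_set S S' `<=` [set x | mul_set S S' (x * a)].
  apply: mul_set_ind => [|x y /= ? ?|x y ? ?] /=; first by rewrite mul0r; exact: mul_set0.
    by rewrite mulrDl; exact: mul_setD.
  by rewrite -mulrA; apply: mul_setM => //; exact: hr.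
split; [exact: mul_set0|move=> x y Sx Sy|by move=> a x; exact: Ml|by move=> x a; exact: Mr].
by apply: mul_setD => //; rewrite -mulN1r; exact: Ml.
Qed.
End MulSet.

Section Pointed.
Variables (k : fieldType) (A : preTopAlgType k).
Hypothesis pA : pointed_algebra A.
Local Notation J := (@jacobson k A).
Local Notation jp := (@jpow k A).

Lemma jac_ideal : ideal_closed J.
Proof.
have [J0 JB Jl] := @jacobson_left_ideal k A.
split=> // x a; case: pA => X [p [pm _ _ pJ]] /pJ h; apply/pJ => i.
by rewrite (pm i).2.2 h mul0r.
Qed.

Lemma jpowS n : jp n.+1 = mul_set J (jp n).
Proof.
case: n => // ; apply/seteqP; split=> [x Jx|].
  by rewrite -[x]mulr1; apply: mul_setM.
apply: mul_set_ind => [|x y|a b Ja _]; first exact: idl0 jac_ideal.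
  exact: idlD jac_ideal x y.
exact: idlMr jac_ideal _ _ Ja.
Qed.

Lemma jpow_ideal n : ideal_closed (jp n).
Proof.
elim: n => [|n IH]; first by [].
rewrite jpowS; apply: mul_set_ideal; first exact: idlMl jac_ideal.
by move=> x a; exact: idlMr.
Qed.

Lemma jpow_leS n : jp n.+1 `<=` jp n.
Proof.
rewrite jpowS; apply: mul_set_ind; first exact: idl0 (jpow_ideal n).
  exact: idlD (jpow_ideal n).
by move=> a b _; exact: idlMl (jpow_ideal n) a b.
Qed.

Lemma jpow_le m n : (m <= n)%N -> jp n `<=` jp m.
Proof.
move=> /subnK <-; elim: (n - m)%N => // d IH.
by apply: subset_trans IH; rewrite addSn; exact: jpow_leS.
Qed.

Lemma jpow_mul m n x y : jp m x -> jp n y -> jp (m + n) (x * y).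
Proof.
elim: m x => [|m IH] x hx hy; first exact: idlMl (jpow_ideal n) _ _ hy.
move: x hx; rewrite jpowS; apply: mul_set_ind.
- by rewrite mul0r; exact: idl0 (jpow_ideal _).
- by move=> a b ha hb; rewrite mulrDl; exact: idlD (jpow_ideal _) _ _ ha hb.
- by move=> a b Ja hb; rewrite -mulrA addSn jpowS; apply: mul_setM => //; exact: IH.
Qed.

Lemma jac1_neq (x : A) : J x -> idempotent_elt x -> forall n, jp n x.
Proof.
move=> Jx xx; elim=> // n IH.
by rewrite -xx jpowS; apply: mul_setM.
Qed.
End Pointed.

Section AlgMor.
Variables (k : fieldType) (A B : preTopAlgType k) (f : A -> B).
Hypothesis hf : alg_mor f.

Lemma am_zm : zmod_morphism f. Proof. by case: hf. Qed.
Lemma amB x y : f (x - y) = f x - f y. Proof. exact: am_zm. Qed.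
Lemma amD x y : f (x + y) = f x + f y. Proof. exact: zmD am_zm x y. Qed.
Lemma amN x : f (- x) = - f x. Proof. exact: zmN am_zm x. Qed.
Lemma am0 : f 0 = 0. Proof. exact: zm0 am_zm. Qed.
Lemma am_sum (I : Type) (r : seq I) (P : pred I) F :
  f (\sum_(i <- r | P i) F i) = \sum_(i <- r | P i) f (F i).
Proof. exact: zm_sum am_zm _ _ _ _. Qed.
Lemma am1 : f 1 = 1. Proof. by case: hf => _ []. Qed.
Lemma amM x y : f (x * y) = f x * f y. Proof. by case: hf => _ []. Qed.
Lemma am_scal a : f (scal a) = scal a. Proof. by case: hf. Qed.
Lemma am_cont : continuous f. Proof. by case: hf. Qed.
Lemma am_scalM a x : f (scal a * x) = scal a * f x.
Proof. by rewrite amM am_scal. Qed.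
Lemma am_mul_set S S' : forall x, mul_set S S' x -> mul_set (f @` S) (f @` S') (f x).
Proof.
apply: mul_set_ind => [|x y ? ?|a b Sa Sb]; first by rewrite am0; exact: mul_set0.
  by rewrite amD; exact: mul_setD.
by rewrite amM; apply: mul_setM; [exists a|exists b].
Qed.
End AlgMor.

Lemma alg_mor_id (k : fieldType) (A : preTopAlgType k) : alg_mor (id : A -> A).
Proof. by split=> // x; exact: cvg_id. Qed.

Lemma alg_mor_comp (k : fieldType) (A B C : preTopAlgType k) (g : B -> C) (f : A -> B) :
  alg_mor g -> alg_mor f -> alg_mor (g \o f).
Proof.
move=> hg hf; split=> [x y|| a|x] /=.
- by rewrite (amB hf) (amB hg).
- by split=> [|x y] /=; rewrite ?(am1 hf) ?(am1 hg) // (amM hf) (amM hg).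
- by rewrite (am_scal hf) (am_scal hg).
- by apply: continuous_comp; [exact: am_cont|exact: am_cont].
Qed.

(** * Subspaces of finite codimension *)

Lemma subspace_mx (k : fieldType) n (W : set 'rV[k]_n) :
  W 0 -> (forall a u v, W u -> W v -> W (a *: u + v)) ->
  exists M : 'M[k]_n, forall v, W v <-> (v <= M)%MS.
Proof.
move=> W0 WD.
pose P r := `[< exists M : 'M[k]_n, (forall v : 'rV_n, (v <= M)%MS -> W v) /\ \rank M = r >].
have exP : exists r, P r.
  exists 0%N; apply/asboolP; exists 0; split; last by rewrite mxrank0.
  by move=> v; rewrite submx0 => /eqP ->.
have ubP r : P r -> (r <= n)%N by move=> /asboolP [M [_ <-]]; exact: rank_leq_row.
case: (ex_maxnP exP ubP) => r /asboolP [M [MW rM]] rmax; exists M => v.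
split=> [Wv|]; last exact: MW.
apply/negPn/negP => nvM; have /rank_ltmx lt : (M < M + v)%MS
  by rewrite ltmxE addsmxSl addsmx_sub submx_refl.
have /rmax : P (\rank (M + v)%MS).
  apply/asboolP; exists (M + v)%MS; split=> // w /sub_addsmxP [[u1 u2] ->] /=.
  rewrite addrC [u2]mx11_scalar mul_scalar_mx; apply: WD => //.
  by apply: MW; exact: submxMl.
by rewrite leqNgt -rM lt.
Qed.

Section FiniteCodim.
Variables (k : fieldType) (A : preTopAlgType k).
Implicit Types S I : set A.

Definition lin_subspace S : Prop :=
  [/\ S 0, forall x y, S x -> S y -> S (x - y) & forall a x, S x -> S (scal a * x)].

Lemma lin_subspaceD S x y : lin_subspace S -> S x -> S y -> S (x + y).
Proof. by case=> S0 SB _ Sx Sy; rewrite -(opprK y); apply: (SB) => //; rewrite -sub0r; apply: (SB). Qed.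

Variables (I : set A) (n : nat) (f : lmod_of A -> 'rV[k]_n).
Hypotheses (flin : linear f) (fsurj : forall v, exists x, f x = v).
Hypothesis fker : forall x, I x <-> f x = 0.

Let fB : zmod_morphism f.
Proof. by move=> x y; rewrite addrC -scaleN1r flin scaleN1r addrC. Qed.

Let fZ a x : f ((scal a : A) * x) = a *: f x.
Proof. by rewrite -[LHS]/(f (a *: (x : lmod_of A))) -[_ *: _]addr0 flin (zm0 fB) addr0. Qed.

Lemma image_mx S : lin_subspace S -> I `<=` S ->
  exists M : 'M[k]_n, forall x, S x <-> (f x <= M)%MS.
Proof.
move=> hS IS; have [S0 SB SZ] := hS.
have [||M hM] := @subspace_mx k n (f @` S).
- by exists 0 => //; exact: zm0 fB.
- move=> a u v [x Sx <-] [y Sy <-]; exists ((scal a : A) * x + y).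
    by apply: lin_subspaceD => //; exact: SZ.
  by rewrite (zmD fB) fZ.
exists M => x; rewrite -hM; split=> [Sx|[y Sy e]]; first by exists x.
rewrite -(subrK y x); apply: lin_subspaceD => //; apply/IS/fker.
by rewrite fB e subrr.
Qed.

Let dim_choice S := some_such (0 : 'M[k]_n) (fun M => forall x, S x <-> (f x <= M)%MS).
Let dim S := \rank (dim_choice S).

Let dimP S : lin_subspace S -> I `<=` S -> forall x, S x <-> (f x <= dim_choice S)%MS.
Proof.
move=> h1 h2; rewrite /dim_choice /some_such; case: pselect => [h|[]]; last exact: image_mx.
exact: projT2 (cid h).
Qed.

Let dim_le S T : lin_subspace S -> I `<=` S -> lin_subspace T -> I `<=` T -> S `<=` T ->
  (dim S <= dim T)%N /\ (dim S = dim T -> S = T).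
Proof.
move=> hS IS hT IT ST.
have sub : (dim_choice S <= dim_choice T)%MS.
  apply/row_subP => i; have [x fx] := fsurj (row i (dim_choice S)).
  by rewrite -fx -dimP //; apply/ST; rewrite dimP // fx row_sub.
split=> [|e]; first exact: mxrankS.
apply/seteqP; split=> // x; rewrite (dimP hT IT) (dimP hS IS) => h.
apply: submx_trans h _; have := (mxrank_leqif_sup sub).2.
by rewrite -/(dim S) -/(dim T) e eqxx => <-.
Qed.

Lemma fcodim_max_aux (Q : set (set A)) S0 : Q S0 ->
  (forall S, Q S -> lin_subspace S /\ I `<=` S) ->
  exists S, Q S /\ forall T, Q T -> S `<=` T -> T = S.
Proof.
move=> Q0 QS; pose P r := `[< exists S, Q S /\ dim S = r >].
have exP : exists r, P r by exists (dim S0); apply/asboolP; exists S0.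
have ubP r : P r -> (r <= n)%N by move=> /asboolP [S [_ <-]]; exact: rank_leq_row.
case: (ex_maxnP exP ubP) => r /asboolP [S [hS rS]] rmax; exists S; split=> // T hT ST.
have [s1 s2] := QS _ hS; have [t1 t2] := QS _ hT.
have [le eq] := dim_le s1 s2 t1 t2 ST; apply/esym/eq/eqP.
by rewrite eqn_leq le /= rS; apply: rmax; apply/asboolP; exists T.
Qed.

Lemma fcodim_min_aux (Q : set (set A)) S0 : Q S0 ->
  (forall S, Q S -> lin_subspace S /\ I `<=` S) ->
  exists S, Q S /\ forall T, Q T -> T `<=` S -> T = S.
Proof.
move=> Q0 QS; pose P r := `[< exists S, Q S /\ dim S = r >].
have exP : exists r, P r by exists (dim S0); apply/asboolP; exists S0.
case: (ex_minnP exP) => r /asboolP [S [hS rS]] rmin; exists S; split=> // T hT ST.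
have [s1 s2] := QS _ hS; have [t1 t2] := QS _ hT.
have [le eq] := dim_le t1 t2 s1 s2 ST; apply/eq/eqP.
by rewrite eqn_leq le /= rS; apply: rmin; apply/asboolP; exists T.
Qed.

Lemma fcodimS_aux S : lin_subspace S -> I `<=` S -> finite_codim S.
Proof.
move=> hS IS; have [M hM] := image_mx hS IS.
exists _, (fun x => f x *m col_base (cokermx M)); split.
- by move=> a x y; rewrite flin mulmxDl scalemxAl.
- move=> v; have [w hw] : exists w, v = w *m col_base (cokermx M).
    by apply/submxP; apply: submx_full; exact: col_base_full.
  by have [x fx] := fsurj w; exists x; rewrite fx.
- move=> x; rewrite hM submxE -{1}(mulmx_base (cokermx M)) mulmxA.
  split=> [/eqP h|->]; last by rewrite mul0mx.
  apply/eqP; rewrite -(mulmx_free_eq0 _ (row_base_free (cokermx M))); exact/eqP.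
Qed.

End FiniteCodim.

Section FiniteCodimChains.
Variables (k : fieldType) (A : preTopAlgType k) (I : set A).
Hypothesis fI : finite_codim I.

(** Chain conditions: the images in the quotient by [I] have bounded dimension. *)
Lemma fcodim_max (Q : set (set A)) S0 : Q S0 ->
  (forall S, Q S -> lin_subspace S /\ I `<=` S) ->
  exists S, Q S /\ forall T, Q T -> S `<=` T -> T = S.
Proof. by case: fI => n [f [h1 h2 h3]]; exact: (fcodim_max_aux h1 h2 h3). Qed.

Lemma fcodim_min (Q : set (set A)) S0 : Q S0 ->
  (forall S, Q S -> lin_subspace S /\ I `<=` S) ->
  exists S, Q S /\ forall T, Q T -> T `<=` S -> T = S.
Proof. by case: fI => n [f [h1 h2 h3]]; exact: (fcodim_min_aux h1 h2 h3). Qed.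

Lemma finite_codimS S : lin_subspace S -> I `<=` S -> finite_codim S.
Proof. by case: fI => n [f [h1 h2 h3]]; exact: (fcodimS_aux h1 h2 h3). Qed.

End FiniteCodimChains.

(** A space that embeds linearly in some [k^m] has finite dimension: the image
    is the row space of a matrix, and a row base of it gives coordinates. *)
Lemma fin_dim_embed (k : fieldType) (V : lmodType k) m (g : V -> 'rV[k]_m) :
  linear g -> injective g -> fin_dim V.
Proof.
move=> glin ginj.
have gB : zmod_morphism g by move=> x y; rewrite addrC -scaleN1r glin scaleN1r addrC.
have [||M hM] := @subspace_mx k m (range g).
- by exists 0 => //; exact: zm0 gB.
- by move=> a _ _ [x _ <-] [y _ <-]; exists (a *: x + y) => //; exact: glin.
pose c x : 'rV_(\rank M) := g x *m pinvmx (row_base M).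
have cK x : c x *m row_base M = g x.
  by apply: mulmxKpV; rewrite eq_row_base -hM; exists x.
exists _, c; split=> [a x y|]; first by rewrite /c glin mulmxDl scalemxAl.
have rng y : range g (y *m row_base M) by rewrite hM -(eq_row_base M) submxMl.
exists (fun y => some_such 0 (fun x => g x = y *m row_base M)).
  move=> x; rewrite /some_such; case: pselect => [h|[]]; last by exists x; rewrite cK.
  by apply: ginj; rewrite (projT2 (cid h)) cK.
move=> y; rewrite /some_such; case: pselect => [h|[]]; last by have [x _] := rng y; exists x.
apply: (row_free_inj (row_base_free M)); rewrite cK; exact: projT2 (cid h).
Qed.

(** * Pseudocompact pointed algebras *)

Section OpenIdeals.
Variables (k : fieldType) (A : preTopAlgType k).
Implicit Types (I U : set A).

Definition open_ideal I : Prop := ideal_closed I /\ open I.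

Lemma open_idealI I I' : open_ideal I -> open_ideal I' -> open_ideal (I `&` I').
Proof.
case=> hI oI [hI' oI']; split; last exact: openI.
split=> [|x y [? ?] [? ?]|a x [? ?]|x a [? ?]]; split.
all: by [exact: idl0|exact: idlB|exact: idlMl|exact: idlMr].
Qed.

Lemma open_idealT : open_ideal setT.
Proof. by split; [|exact: openT]. Qed.

Hypothesis psA : pseudocompact A.

Lemma continuous_addl (x : A) : continuous (fun y : A => x + y).
Proof.
move=> y; case: psA => /(_ (x, y)) addc _ _ _ _.
apply: (@continuous_comp _ _ _ (fun y => (x, y)) (fun z : A * A => z.1 + z.2)) => //.
exact: cvg_pair (cvg_cst x) cvg_id.
Qed.

Lemma open_ideal_nbhs I x U : open_ideal I -> (forall y, I (y - x) -> U y) -> nbhs x U.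
Proof.
move=> [hI oI] IU; have h0 : nbhs (- x + x) I by rewrite addNr; apply: open_nbhs_nbhs; split=> //; exact: idl0.
have h1 : nbhs x ((fun y => - x + y) @^-1` I) := continuous_addl h0.
by apply: filterS h1 => y /=; rewrite addrC; exact: IU.
Qed.

Lemma nbhs_open_ideal x U : nbhs x U ->
  exists I, [/\ open_ideal I, finite_codim I & forall y, I (y - x) -> U y].
Proof.
move=> nU; have nU0 : nbhs (x + 0) U by rewrite addr0.
have : nbhs (0 : A) ((fun y => x + y) @^-1` U) := continuous_addl nU0.
case: psA => _ _ _ _ [B [B1 B2 _ _]] /B2 [I BI IU].
have [h1 h2 h3] := B1 I BI; exists I; split=> // y /IU /=.
by rewrite addrC subrK.
Qed.

Lemma open_ideal_fcodim I : open_ideal I ->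
  exists I', [/\ open_ideal I', finite_codim I' & I' `<=` I].
Proof.
move=> [hI oI]; have : nbhs (0 : A) I by apply: open_nbhs_nbhs; split=> //; exact: idl0.
move=> /nbhs_open_ideal [I' [h1 h2 h3]]; exists I'; split=> // x; rewrite -{1}[x]subr0.
exact: h3.
Qed.

Lemma open_ideal0 (x : A) : (forall I, open_ideal I -> I x) -> x = 0.
Proof.
move=> h; case: psA => _ _ _ _ [B [B1 _ B3 _]].
have : (\bigcap_(I in B) I) x by move=> I BI; apply: h; have [] := B1 I BI.
by rewrite B3.
Qed.

Lemma open_ideal_eq (x y : A) : (forall I, open_ideal I -> I (x - y)) -> x = y.
Proof. by move=> /open_ideal0 /eqP; rewrite subr_eq0 => /eqP. Qed.

Lemma pseudocompact_complete (x : set A -> A) :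
  (forall I I', open_ideal I -> open_ideal I' -> I `<=` I' -> I' (x I - x I')) ->
  exists a, forall I, open_ideal I -> I (a - x I).
Proof.
move=> xc; case: (psA) => _ _ _ _ [B [B1 B2 _ B4]].
have Bo I : B I -> open_ideal I by move=> /B1 [].
have [|a ha] := B4 x; first by move=> I I' /Bo ? /Bo ?; exact: xc.
exists a => I oI; have : nbhs (0 : A) I.
  by case: oI => hI oI; apply: open_nbhs_nbhs; split=> //; exact: idl0.
move=> /B2 [I' BI' sI].
apply: (idl_trans oI.1 (y := x I')); first by apply: sI; exact: ha.
by apply: xc => //; exact: Bo.
Qed.

End OpenIdeals.

Lemma continuous_ideals (k : fieldType) (A B : preTopAlgType k) (f : A -> B) :
  pseudocompact A -> pseudocompact B -> zmod_morphism f ->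
  (forall I, open_ideal I -> exists2 I', open_ideal I' & forall x, I' x -> I (f x)) ->
  continuous f.
Proof.
move=> pA pB fB h x U /= /(nbhs_open_ideal pB) [I [oI _ IU]].
have [I' oI' hI'] := h I oI; apply: (open_ideal_nbhs pA oI') => y /hI' /=.
by rewrite fB => /IU.
Qed.

Section PAlg.
Variables (k : fieldType) (A : preTopAlgType k).
Hypothesis hA : PAlg_ob A.
Local Notation J := (@jacobson k A).
Local Notation jp := (@jpow k A).

Let psA : pseudocompact A. Proof. by case: hA. Qed.
Let ptA : pointed_algebra A. Proof. by case: hA. Qed.

(** Modulo an open ideal, [1 - j] is left invertible: a proper left ideal
    containing it would lie in a maximal open one, which contains [j]. *)
Lemma jac_linv_mod I j : open_ideal I -> finite_codim I -> J j ->
  exists u, I (u * (1 - j) - 1).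
Proof.
move=> [hI oI] fI Jj.
pose L0 := [set x | exists a, I (x - a * (1 - j))].
case: (pselect (L0 1)) => [[a h]|n1]; first by exists a; exact: idl_sym.
pose Q (M : set A) := [/\ left_ideal M, L0 `<=` M & ~ M 1].
have QS S : Q S -> lin_subspace S /\ I `<=` S.
  move=> [[S0 SB Sl] LS _]; split; first by split=> // a x; exact: Sl.
  by move=> x Ix; apply: LS; exists 0; rewrite mul0r subr0.
have QL0 : Q L0.
  split=> //; split.
  - by exists 0; rewrite mul0r subr0; exact: idl0.
  - move=> x y [a ha] [b hb]; exists (a - b).
    by rewrite mulrBl subrACA; apply: idlB.
  - by move=> c x [a ha]; exists (c * a); rewrite -mulrA -mulrBr; exact: idlMl.
have [M [[Ml LM M1] Mmax]] := fcodim_max fI QL0 QS.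
have oM : open M.
  rewrite openE => x Mx; apply: (open_ideal_nbhs psA (conj hI oI)) => y Iyx.
  case: Ml => M0 MB _; rewrite -(subKr x y); apply: MB => //.
  apply: LM; exists 0; rewrite mul0r subr0; exact: idl_sym Iyx.
have hM : maximal_open_left_ideal M.
  split=> // [e|M' hM' MM' nT]; first by apply: M1; rewrite e.
  apply: Mmax => //; split=> //; first exact: subset_trans LM MM'.
  move=> M'1; apply: nT; apply/seteqP; split=> // x _; rewrite -[x]mulr1.
  by case: hM' => _ _; apply.
case: (M1); rewrite -(subrK j 1); apply: lin_subspaceD; first by have [] := QS M (And3 Ml LM M1).
  by apply: LM; exists 1; rewrite mul1r subrr; exact: idl0.
exact: (Jj _ hM).
Qed.

Lemma jac_inv_mod I j : open_ideal I -> finite_codim I -> J j ->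
  exists u, I ((1 - j) * u - 1).
Proof.
move=> oI fI Jj; have hI := oI.1; have [u hu] := jac_linv_mod oI fI Jj.
have [|v hv] := @jac_linv_mod I (- (u * j)) oI fI.
  by apply: (idlN (jac_ideal ptA)); exact: (idlMl (jac_ideal ptA)).
rewrite opprK in hv.
have hu' : I (u - (1 + u * j)) by move: hu; rewrite mulrBr mulr1 opprD addrCA addrC -addrA -opprD [u * j + 1]addrC.
have vu : I (v * u - 1).
  apply: (idl_trans hI) hv; rewrite -mulrBr; exact: idlMl hu'.
exists u; have v1j : I (v - (1 - j)).
  rewrite -[v]mulr1; apply: (idl_trans hI (y := v * (u * (1 - j)))).
    by rewrite -mulrBr; apply: idlMl => //; exact: idl_sym.
  rewrite mulrA -{2}[1 - j]mul1r -mulrBl; exact: idlMr vu.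
apply: (idl_trans hI) vu; rewrite -mulrBl; apply: idlMr => //; exact: idl_sym.
Qed.

(** The largest right ideal [L] with [L * J^m] in [I] for some [m] is the whole
    algebra: a minimal right ideal [N] above [L] would satisfy [N * J <= L]. *)
Lemma jpow_open_ideal I : open_ideal I -> exists n, jp n `<=` I.
Proof.
move=> /(open_ideal_fcodim psA) [I' [oI' fI' sI]].
suff [n h] : exists n, jp n `<=` I' by exists n; exact: subset_trans h sI.
move: {I sI} I' oI' fI' => I oI fI; have hI := oI.1; have hJ := jac_ideal ptA.
pose right L := [/\ L 0, forall x y : A, L x -> L y -> L (x - y) & forall x a : A, L x -> L (x * a)].
pose Q (L : set A) := [/\ right L, I `<=` L & exists m, forall x y, L x -> jp m y -> I (x * y)].
have rS L : right L -> lin_subspace L.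
  by move=> [? ? h]; split=> // a x Lx; rewrite scal_central; apply: h.
have QI : Q I.
  split=> //; first by split; [exact: idl0|exact: idlB|move=> *; exact: idlMr].
  by exists 0%N => x y Ix _; exact: idlMr.
have [|L [[rL IL [m Lm]] Lmax]] := fcodim_max fI QI.
  by move=> S [h1 h2 _]; split=> //; exact: rS.
have [L0 LB Lr] := rL.
case: (pselect (L 1)) => [L1|nL1].
  by exists m => y hy; rewrite -[y]mul1r; exact: Lm.
pose Q' (N : set A) := [/\ right N, L `<=` N & N <> L].
have QT : Q' setT by split=> // e; apply: nL1; rewrite -e.
have [|N [[[N0 NB Nr] LN NL] Nmin]] := fcodim_min fI QT.
  by move=> S [h1 h2 _]; split; [exact: rS|exact: subset_trans h2].
have NJ x j : N x -> J j -> L (x * j).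
  move=> Nx Jj; case: (pselect (L x)) => [Lx|nLx]; first exact: Lr.
  pose N' := [set y | exists2 i, J i & L (y - x * i)].
  have N'N : N' `<=` N.
    move=> y [i Ji /LN h]; rewrite -(subrK (x * i) y).
    by apply: lin_subspaceD => //; [exact: rS|exact: Nr].
  case: (pselect (N' = L)) => [<-|nN'].
    by exists j => //; rewrite subrr.
  have : N' x.
    rewrite (Nmin N') //; split=> //.
      split; first by exists 0; rewrite ?mulr0 ?subr0 //; exact: (idl0 hJ).
        move=> y z [i Ji hi] [l Jl hl]; exists (i - l); first exact: (idlB hJ).
        by rewrite mulrBr subrACA; apply: LB.
      move=> y a [i Ji hi]; exists (i * a); first exact: (idlMr hJ).
      by rewrite mulrA -mulrBl; exact: Lr.
    by move=> y Ly; exists 0; rewrite ?mulr0 ?subr0 //; exact: idl0.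
  move=> [i Ji]; rewrite -{1}[x]mulr1 -mulrBr => h.
  case: nLx; have [u hu] := jac_inv_mod oI fI Ji.
  rewrite -[x]mulr1 -(subKr ((1 - i) * u) 1) mulrBr; apply: LB.
    by rewrite mulrA; exact: Lr.
  by apply: IL; apply: idlMl.
pose L' := [set x | forall j, J j -> L (x * j)].
have QL' : Q L'.
  split.
  - split=> [j _|x y hx hy j Jj|x a hx j Jj]; first by rewrite mul0r.
      by rewrite mulrBl; apply: LB; [exact: hx|exact: hy].
    by rewrite -mulrA; apply: hx; exact: (idlMl hJ).
  - by move=> x Ix j _; apply: Lr; exact: IL.
  - exists m.+1 => x y hx; rewrite jpowS //; move: y; apply: mul_set_ind.
    + by rewrite mulr0; exact: idl0.
    + by move=> y z; rewrite mulrDr; exact: idlD.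
    + by move=> a b Ja hb; rewrite mulrA; apply: Lm => //; exact: hx.
have LL' : L `<=` L' by move=> x Lx j _; exact: Lr.
case: NL; apply/seteqP; split=> // x Nx; rewrite -(Lmax _ QL' LL') => j.
exact: NJ.
Qed.

(** Cauchy sequences for the radical filtration converge, since the open ideals
    contain powers of the radical; the rate of convergence modulo [I] depends
    only on which power [I] contains. *)
Lemma jadic_limit (u : nat -> A) : (forall n, jp n (u n.+1 - u n)) ->
  exists a, forall I, open_ideal I -> forall n, jp n `<=` I -> I (a - u n).
Proof.
move=> hu; have {}hu n d : jp n (u (n + d)%N - u n).
  elim: d => [|d IH]; first by rewrite addn0 subrr; exact: idl0 (jpow_ideal ptA n).
  apply: (idl_trans (jpow_ideal ptA n)) IH; rewrite addnS.
  by apply: (jpow_le ptA _ (hu _)); rewrite leq_addr.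
have uc I n m : open_ideal I -> jp n `<=` I -> jp m `<=` I -> I (u n - u m).
  move=> [hI _] hn hm; case: (leqP m n) => [/subnKC <-|/ltnW /subnKC <-].
    by apply: hm; exact: hu.
  by apply: (idl_sym hI); apply: hn; exact: hu.
pose N I := some_such 0%N (fun n => jp n `<=` I).
have NP I : open_ideal I -> jp (N I) `<=` I.
  rewrite /N /some_such => /jpow_open_ideal h; case: pselect => // h'.
  exact: projT2 (cid h').
have [|a ha] := pseudocompact_complete psA (x := fun I => u (N I)).
  by move=> I I' oI oI' sI; apply: uc => //; [apply: subset_trans sI; exact: NP|exact: NP].
exists a => I oI n hn; apply: (idl_trans oI.1 (ha I oI)); apply: uc => //; exact: NP.
Qed.

Lemma jac_unit w : J w -> exists u, (1 - w) * u = 1 /\ u * (1 - w) = 1.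
Proof.
move=> Jw; have hw n : jp n (w ^+ n).
  by elim: n => [|n IH]; rewrite ?exprS ?jpowS //; apply: mul_setM.
have [|u hu] := @jadic_limit (fun n => \sum_(i < n) w ^+ i).
  by move=> n; rewrite big_ord_recr addrC addKr.
exists u.
have geo n : (1 - w) * \sum_(i < n) w ^+ i = 1 - w ^+ n.
  elim: n => [|n IH]; first by rewrite big_ord0 mulr0 subrr.
  by rewrite big_ord_recr mulrDr IH mulrBl mul1r -exprS addrA subrK.
have geo' n : (\sum_(i < n) w ^+ i) * (1 - w) = 1 - w ^+ n.
  elim: n => [|n IH]; first by rewrite big_ord0 mul0r subrr.
  by rewrite big_ord_recr mulrDl IH mulrBr mulr1 -exprSr addrA subrK.
split; apply: (open_ideal_eq psA) => I oI; have [n hn] := jpow_open_ideal oI.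
  apply: (idl_trans oI.1 (y := (1 - w) * \sum_(i < n) w ^+ i)).
    by rewrite -mulrBr; apply: idlMl oI.1 _ _ _; exact: hu.
  by rewrite geo addrC addKr; apply: idlN oI.1 _ _; exact: hn.
apply: (idl_trans oI.1 (y := (\sum_(i < n) w ^+ i) * (1 - w))).
  by rewrite -mulrBl; apply: idlMr oI.1 _ _ _; exact: hu.
by rewrite geo' addrC addKr; apply: idlN oI.1 _ _; exact: hn.
Qed.

Lemma jac_unit1 w : J w -> exists u, (1 + w) * u = 1 /\ u * (1 + w) = 1.
Proof. by move=> Jw; have := jac_unit (idlN (jac_ideal ptA) Jw); rewrite opprK. Qed.

Lemma jac_idem0 x : J x -> idempotent_elt x -> x = 0.
Proof.
move=> Jx xx; apply: (open_ideal0 psA) => I /jpow_open_ideal [n]; apply.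
exact: jac1_neq.
Qed.

End PAlg.

(** * Morphisms and the radical *)

Section MorJac.
Variables (k : fieldType) (A B : preTopAlgType k) (f : A -> B).
Hypotheses (hA : PAlg_ob A) (hB : PAlg_ob B) (hf : alg_mor f).

Let ptA : pointed_algebra A. Proof. by case: hA. Qed.
Let ptB : pointed_algebra B. Proof. by case: hB. Qed.

(** A character of [B] composed with [f] is a character of [A]; it kills the
    radical since it cannot kill a unit [1 - w]. *)
Lemma jac_mor a : jacobson a -> jacobson (f a).
Proof.
move=> Ja; case: (ptB) => X [p [pm ps _ pJ]]; apply/pJ => x; apply/eqP/negPn/negP => nz.
have [pz [p1 pM]] := pm x; pose c := p (f a) x.
have Jw : jacobson (scal c^-1 * a) by apply: (idlMl (jac_ideal ptA)).
have [u [hu _]] := jac_unit hA Jw.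
have : p (f ((1 - scal c^-1 * a) * u)) x = 1 by rewrite hu (am1 hf).
rewrite (amM hf) pM (amB hf) (am1 hf) (am_scalM hf) pz p1 pM ps mulVf // subrr mul0r.
by move/esym/eqP; rewrite oner_eq0.
Qed.

Lemma jac2_mor a : jpow 2 a -> jpow 2 (f a).
Proof.
move=> /(am_mul_set hf); apply: mul_setS => _ [x Jx <-]; exact: jac_mor.
Qed.

Hypothesis fsurj : forall b, exists a, f a = b.

(** [A/J(A)] is von Neumann regular, so an ideal of its image that consists of
    radical elements vanishes. *)
Lemma jac_lift b : jacobson b -> exists2 a, jacobson a & f a = b.
Proof.
move=> Jb; have [a0 fa0] := fsurj b; case: (ptA) => X [p [pm ps psurj pJ]].
have [c pc] := psurj (fun x => (p a0 x)^-1).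
pose d := a0 * c * a0 - a0.
have Jd : jacobson d.
  apply/pJ => x; have [pz [p1 pM]] := pm x; rewrite pz !pM pc.
  by have [->|nz] := eqVneq (p a0 x) 0; rewrite ?mulr0 ?subr0 // divff // mul1r subrr.
have Jbc : jacobson (b * f c) by exact: (idlMr (jac_ideal ptB)).
have [u [_ hu]] := jac_unit hB Jbc; have [u' fu'] := fsurj u.
exists (- (u' * d)).
  by apply: (idlN (jac_ideal ptA)); exact: (idlMl (jac_ideal ptA)).
rewrite (amN hf) (amM hf) fu' /d (amB hf) !(amM hf) fa0.
rewrite -mulrN opprB -{1}[b]mul1r -mulrBl mulrA hu mul1r //.
Qed.

Lemma jac2_lift b : jpow 2 b -> exists2 a, jpow 2 a & f a = b.
Proof.
apply: (mul_set_ind (P := [set b | exists2 a, jpow 2 a & f a = b])) => /=.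
- by exists 0; rewrite ?(am0 hf) //; exact: mul_set0.
- move=> x y [a ha <-] [a' ha' <-]; exists (a + a'); last by rewrite (amD hf).
  exact: mul_setD.
- move=> x y /jac_lift [a Ja <-] /jac_lift [a' Ja' <-].
  by exists (a * a'); [exact: mul_setM|rewrite (amM hf)].
Qed.
End MorJac.

Section Sim1.
Variable k : fieldType.
Implicit Types A B C : preTopAlgType k.

Lemma sim1_refl A B (f : A -> B) : PAlg_ob B -> sim1 f f.
Proof.
case=> _ pB _; split=> a; rewrite subrr; first exact: idl0 (jac_ideal pB).
by move=> _; exact: idl0 (jpow_ideal pB 2).
Qed.

Lemma sim1_sym A B (f g : A -> B) : PAlg_ob B -> sim1 f g -> sim1 g f.
Proof.
case=> _ pB _ [h1 h2]; split=> a; first exact: (idl_sym (jac_ideal pB)).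
by move=> /h2; exact: (idl_sym (jpow_ideal pB 2)).
Qed.

Lemma sim1_trans A B (g f h : A -> B) : PAlg_ob B -> sim1 f g -> sim1 g h -> sim1 f h.
Proof.
case=> _ pB _ [h1 h2] [h3 h4]; split=> a; first exact: (idl_trans (jac_ideal pB) (h1 a)).
by move=> Ja; exact: (idl_trans (jpow_ideal pB 2) (h2 a Ja) (h4 a Ja)).
Qed.

Lemma sim1_compl A B C (f f' : A -> B) (g : B -> C) :
  PAlg_ob B -> PAlg_ob C -> alg_mor g -> sim1 f f' -> sim1 (g \o f) (g \o f').
Proof.
move=> hB hC hg [h1 h2]; split=> a /=; first by rewrite -(amB hg); exact: (jac_mor hB hC).
by move=> /h2; rewrite -(amB hg); exact: (jac2_mor hB hC).
Qed.

Lemma sim1_compr A B C (f : A -> B) (g g' : B -> C) :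
  PAlg_ob A -> PAlg_ob B -> alg_mor f -> sim1 g g' -> sim1 (g \o f) (g' \o f).
Proof.
move=> hA hB hf [h1 h2]; split=> a /=; first exact: h1.
by move=> Ja; apply: h2; exact: (jac_mor hA hB).
Qed.

Lemma sim1_comp A B C (f f' : A -> B) (g g' : B -> C) :
  PAlg_ob A -> PAlg_ob B -> PAlg_ob C -> alg_mor f' -> alg_mor g ->
  sim1 f f' -> sim1 g g' -> sim1 (g \o f) (g' \o f').
Proof.
move=> hA hB hC hf hg h1 h2; apply: (@sim1_trans _ _ (g \o f')) => //.
  exact: sim1_compl.
exact: sim1_compr.
Qed.

(** Surjections are epimorphisms modulo [sim1], since they lift the radical. *)
Lemma sim1_cancel A B C (f : A -> B) (g g' : B -> C) :
  PAlg_ob A -> PAlg_ob B -> alg_mor f -> (forall b, exists a, f a = b) ->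
  sim1 (g \o f) (g' \o f) -> sim1 g g'.
Proof.
move=> hA hB hf fs [h1 h2]; split=> b; first by have [a <-] := fs b; exact: h1.
by move=> /(jac_lift hA hB hf fs) [a Ja <-]; exact: h2.
Qed.

Lemma sim1_PAlg_mor A B (f g : A -> B) : PAlg_ob B ->
  PAlg_mor f -> alg_mor g -> sim1 f g -> PAlg_mor g.
Proof.
move=> [_ pB _] [hf fs] hg [h _]; split=> // b; have [a ha] := fs b; exists a.
exact: (idl_trans (jac_ideal pB) ha).
Qed.

Lemma surj_SPAlg_mor A B (f : A -> B) : PAlg_ob B -> alg_mor f ->
  (forall b, exists a, f a = b) -> SPAlg_mor f.
Proof.
move=> [_ pB _] hf fs; split=> //; split=> // b; have [a <-] := fs b; exists a.
by rewrite subrr; exact: idl0 (jac_ideal pB).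
Qed.
End Sim1.

(** * Idempotents modulo the radical *)

Section Idempotents.
Variables (k : fieldType) (A : preTopAlgType k).
Hypothesis hA : PAlg_ob A.

Let psA : pseudocompact A. Proof. by case: hA. Qed.
Let ptA : pointed_algebra A. Proof. by case: hA. Qed.
Let hJ := jac_ideal ptA.

(** The Newton step for the equation [v^2 = v]; it squares the defect
    [v^2 - v] up to a factor and, having no constant term, preserves corners. *)
Definition idem_step (v : A) : A := v + (v * v - v) * (1 - (v + v)).

Lemma idem_step_defect v : let d := v * v - v in let s := 1 - (v + v) in
  idem_step v * idem_step v - idem_step v = d * d * (s * s) - d * (d + d + (d + d)).
Proof.
move=> d s; rewrite /idem_step -/d -/s.
have vd : v * d = d * v by rewrite /d mulrBr mulrBl mulrA.
have vd' : v * (1 - v) = - d by rewrite mulrBr mulr1 /d opprB.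
have vv : v * v = v + d by rewrite /d addrCA subrr addr0.
have sv : 1 - s = v + v by rewrite /s subKr.
have sv2 : 1 + s = (1 - v) + (1 - v) by rewrite /s opprD [RHS]addrACA [LHS]addrA.
have vs : v * s = s * v by rewrite /s mulrBr mulrBl mulr1 mul1r mulrDr mulrDl.
have s2 : s + v + v = 1 by rewrite /s -addrA subrK.
clearbody d.
have ds : s * d = d * s by rewrite /s mulrBl mulrBr mulr1 mul1r [(v + v) * d]mulrDl [d * (v + v)]mulrDr vd.
clearbody s.
have ss : 1 - s * s = - (d + d + (d + d)).
  have -> : 1 - s * s = (1 - s) * (1 + s).
    by rewrite mulrBl mul1r mulrDr mulr1 opprD addrA addrK.
  by rewrite sv sv2; move: (1 - v) vd' => c vd'; rewrite mulrDl !mulrDr vd' !opprD.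
have -> : d * (d + d + (d + d)) = d * (s * s) - d.
  by rewrite -[d + d + _]opprK -ss opprB mulrBr mulr1.
have -> : (v + d * s) * (v + d * s) = v * v + (d * s * v + d * s * v) + d * d * (s * s).
  rewrite mulrDl !mulrDr -!addrA; congr (_ + _); rewrite !addrA; congr (_ + _ + _).
    by rewrite mulrA vd -mulrA vs mulrA.
  by rewrite mulrA -[d * s * d]mulrA ds !mulrA.
have e : d * s = d * (s * s) + (d * s * v + d * s * v).
  by rewrite -[LHS]mulr1 -s2 !mulrDr -mulrA addrA.
rewrite vv; move: e; set x := d * s * v + _; clearbody x.
move: (d * s) (d * (s * s)) (d * d * _) => q y z ->.
apply/eqP; rewrite subr_eq opprB -!addrA; apply/eqP.
by rewrite (addrCA v y) addKr [RHS]addrC -!addrA [RHS]addrCA.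
Qed.

Lemma jac_closed (x : A) :
  (forall I, open_ideal I -> exists2 y, jacobson y & I (x - y)) -> jacobson x.
Proof.
move=> h M hM; have [[M0 MB Ml] oM _ _] := hM.
have : nbhs (0 : A) M by apply: open_nbhs_nbhs.
move=> /(nbhs_open_ideal psA) [I [oI _ IM]]; have [y Jy Iy] := h I oI.
rewrite -(subrK y x); apply: lin_subspaceD; [by split=> // a z; exact: Ml| |exact: Jy].
by apply: IM; rewrite subr0.
Qed.

(** Newton iteration converges, and all iterates stay in the corner of [e]. *)
Lemma idem_lift (e u : A) : e * u = u -> u * e = u -> jacobson (u * u - u) ->
  exists f, [/\ idempotent_elt f, jacobson (f - u), e * f = f & f * e = f].
Proof.
move=> eu ue Ju; pose v n := iter n idem_step u.
pose d n := v n * v n - v n.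
have hI n := jpow_ideal ptA n.
have dJ n : jpow n.+1 (d n).
  elim: n => [|n IH] //; rewrite /d -[v n.+1]/(idem_step (v n)) idem_step_defect -/(d n).
  have dd : jpow n.+2 (d n * d n).
    by apply: (jpow_le ptA _ (jpow_mul ptA IH IH)); rewrite addSn addnS ltnS leq_addr.
  apply: (idlB (hI _)); first exact: (idlMr (hI _)).
  by move: (d n) dd => c dd; rewrite !mulrDr; apply: (idlD (hI _)); apply: (idlD (hI _)).
have vS n : v n.+1 - v n = d n * (1 - (v n + v n)) by rewrite /= /idem_step addrC addKr.
have vJ n : jacobson (v n - u).
  elim: n => [|n IH]; first by rewrite subrr; exact: idl0.
  apply: (idl_trans hJ) IH; rewrite vS; apply: (idlMr hJ).
  exact: (jpow_le ptA (isT : 1 <= n.+1)%N).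
have [|f hf] := @jadic_limit _ _ hA v.
  by move=> n; rewrite vS; apply: (idlMr (hI _)); apply: (jpow_leS ptA).
have ev n : e * v n = v n.
  elim: n => [|n IH] //=; rewrite /idem_step mulrDr IH mulrA.
  have -> // : e * (v n * v n - v n) = v n * v n - v n by rewrite mulrBr mulrA IH.
have ve n : v n * e = v n.
  elim: n => [|n IH] //=; rewrite /idem_step mulrDl IH -mulrA.
  have de : (v n * v n - v n) * e = v n * v n - v n by rewrite mulrBl -mulrA IH.
  have -> : (1 - (v n + v n)) * e = e - (v n + v n) by rewrite mulrBl mul1r mulrDl IH.
  by rewrite mulrBr de mulrBr mulr1.
exists f; split.
- apply: (open_ideal_eq psA) => I oI; have [n hn] := jpow_open_ideal hA oI.
  have hIn := hf I oI n hn; apply: (idl_trans oI.1 (idl_mulB oI.1 hIn hIn)).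
  apply: (idl_trans oI.1 (y := v n)); last exact: (idl_sym oI.1).
  by apply: hn; exact: (jpow_leS ptA).
- apply: jac_closed => I oI; have [n hn] := jpow_open_ideal hA oI.
  by exists (v n - u) => //; rewrite opprB addrA subrK; exact: hf.
- apply: (open_ideal_eq psA) => I oI; have [n hn] := jpow_open_ideal hA oI.
  have hIn := hf I oI n hn; apply: (idl_trans oI.1 (y := v n)); last exact: (idl_sym oI.1).
  by rewrite -{1}(ev n) -mulrBr; exact: idlMl oI.1 _ _ hIn.
- apply: (open_ideal_eq psA) => I oI; have [n hn] := jpow_open_ideal hA oI.
  have hIn := hf I oI n hn; apply: (idl_trans oI.1 (y := v n)); last exact: (idl_sym oI.1).
  by rewrite -{1}(ve n) -mulrBl; exact: idlMr oI.1 _ _ hIn.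
Qed.

(** The difference is [(w * a - a * w) * u]. *)
Lemma conj_sim (w u a : A) : jacobson w -> (1 + w) * u = 1 ->
  jacobson ((1 + w) * a * u - a) /\ (jacobson a -> jpow 2 ((1 + w) * a * u - a)).
Proof.
move=> Jw hu; have -> : (1 + w) * a * u - a = (w * a - a * w) * u.
  have {2}-> : a = a * (1 + w) * u by rewrite -mulrA hu mulr1.
  rewrite -mulrBl; congr (_ * _).
  by rewrite mulrDl mulrDr mul1r mulr1 opprD addrACA subrr add0r.
split=> [|Ja].
  by apply: (idlMr hJ); apply: (idlB hJ); [exact: (idlMr hJ)|exact: (idlMl hJ)].
apply: (idlMr (jpow_ideal ptA 2)); apply: (idlB (jpow_ideal ptA 2)); exact: mul_setM.
Qed.

(** Idempotents congruent modulo the radical are conjugate by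
    [f * e + (1 - f) * (1 - e)]. *)
Lemma orbitGP (e x : A) : idempotent_elt e ->
  (orbitG e x <-> idempotent_elt x /\ jacobson (x - e)).
Proof.
move=> ee; split=> [[w [u [Jw h1 h2 ->]]]|[xx Jxe]].
  split; last exact: (conj_sim e Jw h1).1.
  by rewrite /idempotent_elt !mulrA -[_ * u * (1 + w)]mulrA h2 mulr1 -[_ * e * e]mulrA ee.
pose w := x * e + (1 - x) * (1 - e) - 1.
have wE : 1 + w = x * e + (1 - x) * (1 - e) by rewrite /w addrC subrK.
have Jw : jacobson w.
  have -> : w = x * (e - x) + (x - e) * e.
    rewrite mulrBr mulrBl xx ee /w mulrBl mul1r mulrBr mulr1 -!addrA; congr (_ + _).
    rewrite opprB [1 + _]addrC -!addrA addrC -!addrA addKr.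
    by rewrite addrCA.
  apply: (idlD hJ); first by apply: (idlMl hJ); exact: (idl_sym hJ).
  exact: (idlMr hJ).
have [u [hu1 hu2]] := jac_unit1 hA Jw; exists w, u; split=> //.
have -> : (1 + w) * e = x * (1 + w).
  have h1 : (1 - e) * e = 0 by rewrite mulrBl mul1r ee subrr.
  have h2 : x * (1 - x) = 0 by rewrite mulrBr mulr1 xx subrr.
  by rewrite wE mulrDl [RHS]mulrDr -!mulrA h1 ee [x * (_ * (1 - e))]mulrA h2 mulrA xx mulr0 mul0r.
by rewrite -mulrA hu1 mulr1.
Qed.

Lemma orbitG_refl (e : A) : idempotent_elt e -> orbitG e e.
Proof. by move=> ee; apply/orbitGP => //; split=> //; rewrite subrr; exact: idl0. Qed.

Lemma orbitG_eq (e f : A) : idempotent_elt e -> idempotent_elt f ->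
  (orbitG e = orbitG f <-> jacobson (e - f)).
Proof.
move=> ee ff; split=> [h|Jef].
  by have /orbitGP [//|] : orbitG f e by rewrite -h; exact: orbitG_refl.
apply/seteqP; split=> x /orbitGP [//|xx Jx]; apply/orbitGP => //; split=> //.
  exact: (idl_trans hJ Jx).
by apply: (idl_trans hJ Jx); exact: (idl_sym hJ).
Qed.
End Idempotents.

(** * The completed path algebra: expansion along the first arrow *)

Section Cpath.
Variables (k : fieldType) (Q : vquiver k).
Local Notation kQ := (cpath Q).
Implicit Types (x y z : kQ) (p : qpath Q).

Definition qarr : finType :=
  {b : vtx Q * vtx Q & 'I_(vdim (arr (Some b.1) (Some b.2)))}.
Definition mkarr (e f : vtx Q) (i : 'I_(vdim (arr (v := Q) (Some e) (Some f)))) : qarr :=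
  Tagged (fun b : vtx Q * vtx Q => 'I_(vdim (arr (Some b.1) (Some b.2)))) (i := (e, f)) i.
Definition src (b : qarr) : vtx Q := (tag b).1.
Definition tgt (b : qarr) : vtx Q := (tag b).2.
Definition aidx (b : qarr) : nat := tagged b.

Definition qtriv (v : vtx Q) : qpath Q := exist _ (v, [::]) isT.

(** Coefficients are read at codes rather than at paths, so that an arrow can be
    put in front without a proof that the result is a path. *)
Definition cval x (c : vtx Q * seq (vtx Q * nat)) : k := oapp x 0 (insub c).

Definition barr (b : qarr) : kQ := fun p => (val p == (src b, [:: (tgt b, aidx b)]))%:R.

(** The coefficients of the paths that begin with [b], read along their remainder:
    [x] is the sum of its constant part and of the [strip b x * barr b]. *)
Definition strip (b : qarr) x : kQ :=
  fun p => if (val p).1 == tgt b then cval x (src b, (tgt b, aidx b) :: (val p).2) else 0.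

(** The [n]-th power of the arrow ideal: these ideals form a base of
    neighbourhoods of [0], and for [n = 1, 2] they are [J] and [J^2]. *)
Definition cpath_ge (n : nat) : set kQ := [set x | forall p, (qsize p < n)%N -> x p = 0].

Lemma cpathE0 p : (0 : kQ) p = 0. Proof. by []. Qed.
Lemma cpathED x y p : (x + y) p = x p + y p. Proof. by []. Qed.
Lemma cpathEB x y p : (x - y) p = x p - y p. Proof. by []. Qed.
Lemma cpathE1 p : (1 : kQ) p = (nilp (val p).2)%:R. Proof. by []. Qed.
Lemma cpathEM x y p : (x * y) p = \sum_(j < (qsize p).+1) x (pdrop p j) * y (ptake p j).
Proof. by []. Qed.
Lemma cpathEZ a x p : ((scal a : kQ) * x) p = a * x p.
Proof. exact: cpath_scalE. Qed.
Lemma cpathE_sum (I : Type) (r : seq I) (P : pred I) (F : I -> kQ) p :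
  (\sum_(i <- r | P i) F i) p = \sum_(i <- r | P i) F i p.
Proof. exact: (big_morph (fun x : kQ => x p) (fun x y => cpathED x y p) (cpathE0 p)). Qed.

Lemma cval_val x p : cval x (val p) = x p.
Proof. by rewrite /cval valK. Qed.
Lemma cvalB x y c : cval (x - y) c = cval x c - cval y c.
Proof. by rewrite /cval; case: insub => [p|] //=; rewrite subrr. Qed.
Lemma cvalZ a x c : cval (scal a * x) c = a * cval x c.
Proof. by rewrite /cval; case: insub => [p|] /=; rewrite ?cpathEZ ?mulr0. Qed.

Lemma qarr_valid (b : qarr) w : qvalid (src b) ((tgt b, aidx b) :: w) = qvalid (tgt b) w.
Proof. by case: b => -[e f] i; rewrite /= ltn_ord. Qed.

Lemma qarr_eq (b b' : qarr) : src b = src b' -> tgt b = tgt b' -> aidx b = aidx b' -> b = b'.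
Proof.
case: b b' => -[e f] i [[e' f'] i']; rewrite /src /tgt /aidx /= => ee ff.
by case: _ / ee i' => i'; case: _ / ff i' => i' /val_inj ->.
Qed.

Lemma qarr_ex e f i : (i < vdim (arr (v := Q) (Some e) (Some f)))%N ->
  exists b, [/\ src b = e, tgt b = f & aidx b = i].
Proof. by move=> h; exists (mkarr (Ordinal h)). Qed.

Lemma stripB b x y : strip b (x - y) = strip b x - strip b y.
Proof. by apply/funext => p; rewrite cpathEB /strip; case: ifP; rewrite ?cvalB ?subrr. Qed.
Lemma stripZ b a x : strip b (scal a * x) = scal a * strip b x.
Proof. by apply/funext => p; rewrite cpathEZ /strip; case: ifP; rewrite ?cvalZ ?mulr0. Qed.

Lemma videm_mulr x v p : (x * videm (Some v)) p = if (val p).1 == v then x p else 0.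
Proof.
rewrite cpathEM big_ord_recl big1 => [|i _]; last first.
  rewrite /videm /= -pair_eqE /= andbC; case: p i => -[e [|c w]] hv i /=; first by case: i.
  by rewrite mulr0.
by rewrite pdrop0 /videm /= take0 addr0 xpair_eqE eqxx andbT; case: ifP; rewrite ?mulr1 ?mulr0.
Qed.

Lemma barr_mulr x b p : (x * barr b) p =
  if val p is (e, (f, i) :: w) then
    if [&& e == src b, f == tgt b & i == aidx b] then cval x (f, w) else 0
  else 0.
Proof.
rewrite cpathEM; case: p => -[e [|[f i] w]] hv.
  by rewrite big_ord_recl big_ord0 /barr /= xpair_eqE andbF mulr0 addr0.
rewrite big_ord_recl /barr /= xpair_eqE andbF mulr0 add0r big_ord_recl /= big1 => [|j _].
  rewrite addr0 take0 xpair_eqE eqseq_cons xpair_eqE eqxx andbT.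
  case: ifP => _; rewrite ?mulr0 // mulr1.
  by rewrite -cval_val /= take0 drop0.
rewrite xpair_eqE eqseq_cons; case: w hv j => [|c w] hv j; first by case: j.
by rewrite !andbF mulr0.
Qed.

Lemma cpath_expand x :
  x = \sum_v scal (x (qtriv v)) * videm (Some v) + \sum_b strip b x * barr b.
Proof.
apply/funext => p; rewrite cpathED !cpathE_sum.
case: p => -[e [|[f i] w]] hv.
  rewrite [X in _ + X]big1 => [|b _]; last by rewrite barr_mulr.
  rewrite addr0 (bigD1 e) //= cpathEZ /videm /= eqxx mulr1 big1 ?addr0 => [|v ne].
    by congr (x _); exact: val_inj.
  by rewrite cpathEZ /= xpair_eqE eq_sym (negPf ne) mulr0.
rewrite [X in X + _]big1 => [|v _]; last by rewrite cpathEZ /= xpair_eqE andbF mulr0.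
have [b [be bf bi]] : exists b, [/\ src b = e, tgt b = f & aidx b = i].
  by apply: qarr_ex; case/andP: hv.
rewrite add0r (bigD1 b) //= barr_mulr /= be bf bi !eqxx /= big1 ?addr0 => [|c ne].
  have hv' : qvalid f w by case/andP: hv.
  pose q : qpath Q := exist (fun c : vtx Q * seq (vtx Q * nat) => qvalid c.1 c.2) (f, w) hv'.
  rewrite -[(f, w)]/(val q) cval_val /strip /= bf eqxx be bi.
  by rewrite -[LHS]cval_val.
rewrite barr_mulr /=; case: ifP => // /and3P [/eqP h1 /eqP h2 /eqP h3].
by case/eqP: ne; apply: qarr_eq; congruence.
Qed.

(** The first arrow of a path in [x * y] belongs to [y], unless [y] contributes
    its constant term. *)
Lemma strip_mul b x y : strip b (x * y) = scal (y (qtriv (src b))) * strip b x + x * strip b y.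
Proof.
apply/funext => p; rewrite cpathED cpathEZ cpathEM /strip.
case: eqP => [hp|hp]; last first.
  by rewrite mulr0 add0r big1 // => j _; rewrite mulr0.
have hv : qvalid (src b) ((tgt b, aidx b) :: (val p).2) by rewrite qarr_valid -hp; exact: valP p.
pose bp : qpath Q := exist (fun c : vtx Q * seq (vtx Q * nat) => qvalid c.1 c.2) (src b, (tgt b, aidx b) :: (val p).2) hv.
rewrite -[(src b, _ :: _)]/(val bp) !cval_val cpathEM big_ord_recl; congr (_ + _).
  by rewrite pdrop0 mulrC; congr (y _ * _); apply: val_inj.
apply: eq_bigr => j _; congr (_ * _).
  by congr (x _); apply: val_inj; rewrite /= hp.
by rewrite -cval_val.
Qed.

Lemma varrE e f (u : arr (v := Q) (Some e) (Some f)) :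
  varr u = \sum_(i < vdim (arr (v := Q) (Some e) (Some f)))
     scal (vcoord u i) * barr (mkarr i).
Proof.
apply/funext => p; rewrite cpathE_sum; case: p => -[e0 [|[f0 i0] [|c w]]] hv.
- by rewrite big1 // => i _; rewrite cpathEZ /barr /= xpair_eqE andbF mulr0.
- rewrite /varr /=; case: ifP => [/andP[/eqP ee /eqP ff]|ne]; last first.
    rewrite big1 // => i _; rewrite cpathEZ /barr /= !xpair_eqE eqseq_cons xpair_eqE /src /tgt /= andbT.
    by move: ne; case: (e0 == e); case: (f0 == f) => //=; rewrite mulr0.
  subst e0 f0; have hi : (i0 < vdim (arr (v := Q) (Some e) (Some f)))%N by case/andP: hv.
  rewrite (bigD1 (Ordinal hi)) //= cpathEZ /barr /= !eqxx mulr1 big1 ?addr0 // => j ne.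
  rewrite cpathEZ /= xpair_eqE eqseq_cons xpair_eqE /src /tgt /aidx /= !eqxx /= andbT.
  case: eqP => h; rewrite ?mulr0 //; case/eqP: ne; exact/val_inj.
- by rewrite big1 // => i _; rewrite cpathEZ /barr /= xpair_eqE eqseq_cons !andbF mulr0.
Qed.

End Cpath.

(** * Linear topologies *)

Section LinearTopology.
Variables (k : fieldType) (A : preTopAlgType k) (B : set (set A)).
Hypothesis Bideal : forall I, B I -> ideal_closed I /\ finite_codim I.
Hypothesis Bnbhs : forall (x : A) U, nbhs x U <-> exists2 I, B I & forall y, I (y - x) -> U y.

Lemma basis_open I : B I -> open I.
Proof.
move=> BI; rewrite openE => x Ix; apply/Bnbhs; exists I => // y.
by move=> h; apply: (idl_sub (Bideal BI).1 h).
Qed.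

Hypothesis Bsep : \bigcap_(I in B) I = [set 0].
Hypothesis Bcomplete : forall x : set A -> A,
  (forall I I', B I -> B I' -> I `<=` I' -> I' (x I - x I')) ->
  exists a, forall I, B I -> I (a - x I).

Lemma basis_pseudocompact : pseudocompact A.
Proof.
have self (I : set A) x : B I -> nbhs x [set y | I (y - x)].
  by move=> BI; apply/Bnbhs; exists I.
have eq0 x y : (forall I, B I -> I (x - y)) -> x = y.
  move=> h; apply/eqP; rewrite -subr_eq0; apply/eqP.
  by suff : [set (0 : A)] (x - y) by []; rewrite -Bsep => I; exact: h.
split.
- move=> [x y] U /Bnbhs [I BI IU]; exists ([set z | I (z - x)], [set z | I (z - y)]).
    by split; exact: self.
  by move=> [x' y'] [/= h1 h2]; apply: IU; apply: idl_addB => //; exact: (Bideal BI).1.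
- move=> [x y] U /Bnbhs [I BI IU]; exists ([set z | I (z - x)], [set z | I (z - y)]).
    by split; exact: self.
  by move=> [x' y'] [/= h1 h2]; apply: IU; apply: idl_mulB => //; exact: (Bideal BI).1.
- move=> [a x] U /Bnbhs [I BI IU]; exists ([set a], [set z | I (z - x)]).
    by split; [exact: discrete_set1|exact: self].
  move=> [b x'] [/= -> h2]; apply: IU; rewrite -mulrBr.
  exact: idlMl (Bideal BI).1 _ _ h2.
- move=> x y h; apply: eq0 => I BI; have [hI _] := Bideal BI.
  have [z [/= h1 h2]] := h _ _ (self I x BI) (self I y BI).
  by apply: (idl_trans hI (y := z)) h2; exact: (idl_sym hI).
- exists B; split=> //.
    by move=> I BI; split; [exact: (Bideal BI).1|exact: basis_open|exact: (Bideal BI).2].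
  by move=> U /Bnbhs [I BI IU]; exists I => // x Ix; apply: IU; rewrite subr0.
Qed.
End LinearTopology.

(** Kernels of characters are maximal left ideals; conversely an element killed
    by all characters is quasi-regular, so no maximal left ideal can avoid it. *)
Lemma jacobson_chars (k : fieldType) (A : preTopAlgType k) (X : Type) (p : A -> X -> k) :
  (forall x, zmod_morphism (p^~ x) /\ monoid_morphism (p^~ x)) ->
  (forall a x, p (scal a) x = a) ->
  (forall x, open [set a | p a x = 0]) ->
  (forall w, (forall x, p w x = 0) -> exists u, u * (1 - w) = 1) ->
  forall a, jacobson a <-> forall x, p a x = 0.
Proof.
move=> pm ps po pq a; split=> [Ja x|pa M [[M0 MB Ml] oM nM Mmax]].
  have [pz [p1 pM]] := pm x; apply: (Ja [set a | p a x = 0]); split=> //.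
  - split=> [|u v /= hu hv|u v /= hv]; first exact: zm0 pz.
      by rewrite pz hu hv subrr.
    by rewrite pM hv mulr0.
  - move=> e; have : [set a | p a x = 0] 1 by rewrite e.
    by rewrite /= p1 => /eqP; rewrite oner_eq0.
  - move=> M' [M0' MB' Ml'] sM nM'; apply/seteqP; split=> // m Mm /=.
    apply/eqP/negPn/negP => nz; apply: nM'; apply/seteqP; split=> // y _.
    rewrite -[y]mulr1; apply: (Ml'); rewrite -(subKr (scal (p m x)^-1 * m) 1).
    apply: (MB'); first exact: (Ml').
    by apply: sM; rewrite /= pz p1 pM ps mulVf // subrr.
case: (pselect (M a)) => // nMa.
pose M' := [set y | exists2 m, M m & exists b, y = m + b * a].
have hM' : left_ideal M'.
  split.
  - by exists 0 => //; exists 0; rewrite mul0r addr0.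
  - move=> _ _ [m Mm [b ->]] [m' Mm' [b' ->]]; exists (m - m'); first exact: MB.
    by exists (b - b'); rewrite mulrBl opprD addrACA.
  - move=> c _ [m Mm [b ->]]; exists (c * m); first exact: Ml.
    by exists (c * b); rewrite mulrDr mulrA.
have MM' : M `<=` M' by move=> m Mm; exists m => //; exists 0; rewrite mul0r addr0.
case: (pselect (M' = setT)) => [T|/(Mmax _ hM' MM') e]; last first.
  by case: nMa; rewrite -e; exists 0 => //; exists 1; rewrite mul1r add0r.
have [m Mm [b e]] : M' 1 by rewrite T.
have [x|u hu] := pq (b * a); first by have [_ [_ ->]] := pm x; rewrite pa mulr0.
case: nM; apply/seteqP; split=> // y _; rewrite -[y]mulr1 -hu e addrK.
by apply: (Ml y); apply: Ml.
Qed.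

(** * The completed path algebra of a finite Vquiver *)

Section CpathFiltration.
Variables (k : fieldType) (Q : vquiver k).
Local Notation kQ := (cpath Q).
Implicit Types (x y z : kQ) (p : qpath Q).
Local Notation N := (@cpath_ge k Q).

Lemma cpath_geM m n x y : N m x -> N n y -> N (m + n) (x * y).
Proof.
move=> hx hy p hp; rewrite cpathEM big1 // => j _; have jp : (j <= qsize p)%N by rewrite -ltnS.
case: (ltnP (qsize (ptake p j)) n) => [/hy ->|]; first by rewrite mulr0.
rewrite qsize_take // => nj; rewrite hx ?mul0r // qsize_drop.
by rewrite ltn_subLR // addnC; apply: leq_trans hp _; rewrite leq_add2l.
Qed.

Lemma cpath_ge_ideal n : ideal_closed (N n).
Proof.
split=> // [x y hx hy p hp|a x hx|x a hx]; first by rewrite cpathEB hx // hy // subrr.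
  by rewrite -[n]add0n; apply: cpath_geM.
by rewrite -[n]addn0; apply: cpath_geM.
Qed.

Lemma cpath_ge_le m n : (m <= n)%N -> N n `<=` N m.
Proof. by move=> mn x hx p hp; apply: hx; exact: leq_trans hp mn. Qed.

Lemma cpath_ge_eq x y : (forall n, N n (x - y)) -> x = y.
Proof.
move=> h; apply/funext => p; apply/eqP; rewrite -subr_eq0; apply/eqP.
exact: (h (qsize p).+1 p).
Qed.

Lemma barr_ge b : N 1 (barr b : kQ).
Proof. by case=> -[e [|c w]] hv //= _; rewrite /barr /= xpair_eqE andbF. Qed.

Lemma varr_ge e f (u : arr (v := Q) e f) : N 1 (varr u).
Proof.
case: e f u => [e|] [f|] u p hp //.
by case: p hp => -[e0 [|[f0 i0] w]] hv //.
Qed.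

Lemma strip_ge n b x : N n.+1 x -> N n (strip b x).
Proof.
move=> hx p hp; rewrite /strip; case: ifP => // /eqP e; rewrite /cval.
by case: insubP => //= q _ hq; apply: hx; rewrite /qsize /= hq.
Qed.

Lemma videm_ge1 x : N 1 x <-> forall v, x (qtriv v) = 0.
Proof.
split=> [h v|h]; first exact: h.
by case=> -[e [|c w]] hv //= _; rewrite -(h e); congr (x _); exact: val_inj.
Qed.

Lemma cpath_expand1 x : N 1 x -> x = \sum_b strip b x * barr b.
Proof.
move=> hx; rewrite {1}[x]cpath_expand big1 ?add0r // => v _.
by rewrite hx // rmorph0 mul0r.
Qed.

Lemma qpath_finite n : exists s : seq (qpath Q), forall p, (qsize p < n)%N -> p \in s.
Proof.
suff [cs hcs] : exists cs : seq (vtx Q * seq (vtx Q * nat)),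
    forall e w, qvalid e w -> (size w < n)%N -> (e, w) \in cs.
  exists (pmap insub cs) => p hp; rewrite mem_pmap_sub [X in X \in _]surjective_pairing.
  apply: hcs => //.
  exact: valP p.
elim: n => [|n [cs hcs]]; first by exists [::].
exists ([seq (e, [::]) | e <- enum (vtx Q)] ++
        [seq (src b, (tgt b, aidx b) :: c.2) | b <- enum (qarr Q), c <- cs]).
move=> e [|[f i] w] /= h hs; rewrite mem_cat; apply/orP.
  by left; apply/mapP; exists e; rewrite ?mem_enum.
case/andP: h => hi hw; have [b [be bf bi]] := qarr_ex hi.
right; apply/allpairsP; exists (b, (f, w)); split; first by rewrite mem_enum.
  exact: hcs.
by rewrite /= be bf bi.
Qed.

Lemma cpath_nbhs x U : nbhs x U <-> exists n, forall y, N n (y - x) -> U y.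
Proof.
split=> [|[n hU]].
  pose F : set_system kQ := [set U | exists n, forall y, N n (y - x) -> U y].
  have FF : Filter F.
    split=> [|P P' [n hn] [m hm]|P P' sP [n hn]]; first by exists 0%N.
      exists (maxn n m) => y hy; split; [apply: hn|apply: hm].
        exact: cpath_ge_le (leq_maxl _ _) _ hy.
      exact: cpath_ge_le (leq_maxr _ _) _ hy.
    by exists n => y /hn; exact: sP.
  suff : F --> x by apply.
  apply/cvg_sup => p V; rewrite nbhs_simpl nbhsE => -[_ [[W _ <-] Wx] sV].
  exists (qsize p).+1 => y hy; apply: sV => /=.
  by have /eqP := hy p (ltnSn _); rewrite cpathEB subr_eq0 => /eqP ->.
have hp p : nbhs x [set y : kQ | y p = x p].
  exact: (@proj_continuous (qpath Q) (fun _ => discrete_topology k) p x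
    [set (x p : discrete_topology k)] (discrete_set1 _)).
have [s hs] := qpath_finite n.
have : nbhs x [set y : kQ | forall p, p \in s -> y p = x p].
  elim: s {hs} => [|p s IH]; first by apply: filterS filterT => y _ p.
  apply: filterS (filterI (hp p) IH) => y [/= h1 h2] q; rewrite inE => /orP [/eqP -> //|].
  exact: h2.
by apply: filterS => y h; apply: hU => p /hs /h; rewrite cpathEB => ->; rewrite subrr.
Qed.

Lemma cpath_closed (S : set kQ) : closed S <->
  forall x, (forall n, exists2 y, S y & N n (x - y)) -> S x.
Proof.
split=> [cS x h|h x cx].
  apply: cS => U /cpath_nbhs [n hU]; have [y Sy hy] := h n; exists y; split=> //.
  by apply: hU; exact: idl_sym (cpath_ge_ideal n) _ _ hy.
apply: h => n; have [|y [Sy hy]] := cx [set y | N n (y - x)]; first by apply/cpath_nbhs; exists n.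
by exists y => //; exact: idl_sym (cpath_ge_ideal n) _ _ hy.
Qed.

Lemma cpath_fcodim n : finite_codim (N n).
Proof.
have [s hs] := qpath_finite n.
pose t := [seq p <- undup s | (qsize p < n)%N].
have ht p : (p \in t) = (qsize p < n)%N.
  by rewrite mem_filter mem_undup; case: ltnP => // /hs ->.
have ut : uniq t by rewrite filter_uniq ?undup_uniq.
exists (size t), (fun x => \row_i (x : kQ) (tnth (in_tuple t) i)); split.
- move=> a x y; apply/rowP => i; rewrite !mxE.
  by rewrite -[(a *: x + y) _]/(((scal a : kQ) * x) _ + y _) cpathEZ.
- move=> v; exists (fun p => if insub (index p t) is Some i then v 0 i else 0).
  apply/rowP => i; rewrite mxE (tnth_nth (tnth (in_tuple t) i)) /= index_uniq //.
  by rewrite valK.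
- move=> x; split=> [hx|/rowP hx p hp].
    apply/rowP => i; rewrite !mxE hx // -ht; exact: mem_tnth.
  have pt : p \in t by rewrite ht.
  move: pt; rewrite -index_mem => lt; have := hx (Ordinal lt).
  by rewrite !mxE (tnth_nth p) /= nth_index // -index_mem.
Qed.
End CpathFiltration.

Section LinearCompactness.
Variables (k : fieldType) (Q : vquiver k).
Local Notation kQ := (cpath Q).
Local Notation N := (@cpath_ge k Q).

Definition affine (S : set kQ) : Prop :=
  forall x y z a, S x -> S y -> S z -> S (x + scal a * (y - z)).

Definition directed_affine (F : set (set kQ)) : Prop :=
  (forall S T, F S -> F T -> exists2 U, F U & U `<=` S `&` T) /\
  (forall S, F S -> affine S /\ exists x, S x).

(** Linear compactness.  In a maximal directed family of nonempty affine sets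
    some member has constant [p]-th coordinate, for every [p]: otherwise the
    family could be enlarged by intersecting its members with [x p = 0].  These
    constants are the coordinates of the point sought. *)
Lemma linear_compactness (F0 : set (set kQ)) : (exists S, F0 S) -> directed_affine F0 ->
  exists a, forall S, F0 S -> forall n, exists2 y, S y & N n (a - y).
Proof.
move=> [S0 F0S0] gF0.
have [|G [[Gd Ga] Gmax]] := @Zorn_bigcup _ [set G | directed_affine (F0 `|` G)].
  move=> C CP Ctot; split=> [S T|S].
    case=> [FS|[X CX XS]] [FT|[Y CY YT]].
    - by have [U FU sU] := gF0.1 _ _ FS FT; exists U => //; left.
    - have [U [FU|YU] sU] := (CP _ CY).1 _ _ (or_introl FS) (or_intror YT); exists U => //.
        by left.
      by right; exists Y.
    - have [U [FU|XU] sU] := (CP _ CX).1 _ _ (or_intror XS) (or_introl FT); exists U => //.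
        by left.
      by right; exists X.
    - have [XY|YX] := Ctot _ _ CX CY.
        have [U [FU|YU] sU] := (CP _ CY).1 _ _ (or_intror (XY _ XS)) (or_intror YT);
          exists U => //; first by left.
        by right; exists Y.
      have [U [FU|XU] sU] := (CP _ CX).1 _ _ (or_intror XS) (or_intror (YX _ YT));
        exists U => //; first by left.
      by right; exists X.
  by case=> [/gF0.2 //|[X CX XS]]; exact: (CP _ CX).2 (or_intror XS).
set F := F0 `|` G in Gd Ga; have FS0 : F S0 by left.
have cst p : exists c, exists2 S, F S & forall x, S x -> x p = c.
  apply: contrapT => nc.
  pose Z := [set x : kQ | x p = 0].
  have meet S : F S -> exists2 z, S z & Z z.
    move=> FS; have [aS [x Sx]] := Ga _ FS.
    have [y Sy nxy] : exists2 y, S y & y p <> x p.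
      apply: contrapT => h; apply: nc; exists (x p); exists S => // y Sy.
      by apply: contrapT => nxy; apply: h; exists y.
    exists (x + scal (- x p / (y p - x p)) * (y - x)); first exact: aS.
    rewrite /Z /= cpathED cpathEZ cpathEB divfK ?subrr //.
    by rewrite subr_eq0; apply/eqP.
  pose G' := G `|` [set S `&` Z | S in F].
  have in_G : G (S0 `&` Z).
    apply: contrapT => nG; apply: (Gmax G').
      split; first by move=> S GS; left.
      by move=> sub; apply/nG/sub; right; exists S0.
    have F'P S : (F0 `|` G') S -> F S \/ exists2 T, F T & S = T `&` Z.
      case=> [FS|[GS|[T FT <-]]]; [by left; left|by left; right|by right; exists T].
    have FF' S : F S -> (F0 `|` G') S by case=> h; [left|right; left].
    have ZF' S : F S -> (F0 `|` G') (S `&` Z) by move=> FS; right; right; exists S.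
    split=> [S T /F'P [FS|[S' FS ->]] /F'P [FT|[T' FT ->]]|S /F'P [/Ga //|[T FT ->]]].
    - by have [U FU sU] := Gd _ _ FS FT; exists U => //; exact: FF'.
    - have [U FU sU] := Gd _ _ FS FT; exists (U `&` Z); first exact: ZF'.
      by move=> x [/sU [? ?] ?].
    - have [U FU sU] := Gd _ _ FS FT; exists (U `&` Z); first exact: ZF'.
      by move=> x [/sU [? ?] ?].
    - have [U FU sU] := Gd _ _ FS FT; exists (U `&` Z); first exact: ZF'.
      by move=> x [/sU [? ?] ?].
    - split; last by have [z Tz Zz] := meet _ FT; exists z.
      move=> x y z a [Tx Zx] [Ty Zy] [Tz Zz]; split; first by apply: (Ga _ FT).1.
      by rewrite /Z /= cpathED cpathEZ cpathEB Zx Zy Zz subrr mulr0 addr0.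
  by apply: nc; exists 0; exists (S0 `&` Z); [right|move=> x []].
have [c hc] := choice cst.
exists (c : kQ) => S F0S n; have [s hs] := qpath_finite Q n.
have [S' [FS' sS' hS']] : exists S', [/\ F S', S' `<=` S &
    forall p, p \in s -> forall x, S' x -> x p = c p].
  elim: s {hs} => [|p s [S1 [FS1 sS1 h1]]]; first by exists S; split=> //; left.
  have [T FT hT] := hc p; have [U FU sU] := Gd _ _ FS1 FT.
  exists U; split=> // [x /sU [/sS1]//|q]; rewrite inE => /orP [/eqP ->|qs] x /sU [h h'].
    exact: hT.
  exact: h1.
have [_ [y S'y]] := Ga _ FS'; exists y; first exact: sS'.
by move=> p /hs /hS' h; rewrite cpathEB h // subrr.
Qed.
End LinearCompactness.

Section CpathPAlg.
Variables (k : fieldType) (Q : vquiver k).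
Local Notation kQ := (cpath Q).
Implicit Types (x y z : kQ) (p : qpath Q).
Local Notation N := (@cpath_ge k Q).

Lemma cpath_pseudocompact : pseudocompact kQ.
Proof.
apply: (@basis_pseudocompact _ _ (range N)).
- by move=> _ [n _ <-]; split; [exact: cpath_ge_ideal|exact: cpath_fcodim].
- move=> x U; rewrite cpath_nbhs; split=> [[n h]|[_ [n _ <-] h]]; last by exists n.
  by exists (N n) => //; exists n.
- apply/seteqP; split=> [x h|_ -> _ [n _ <-]] //; apply: cpath_ge_eq => n.
  by rewrite subr0; apply: h; exists n.
- move=> u uc; exists (fun p => u (N (qsize p).+1) p) => _ [n _ <-] p hp.
  have := uc (N n) (N (qsize p).+1) _ _ _ p (ltnSn _).
  rewrite !cpathEB => h; apply/eqP; rewrite subr_eq0 eq_sym -subr_eq0; apply/eqP/h.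
  + by exists n.
  + by exists (qsize p).+1.
  + exact: cpath_ge_le.
Qed.

Lemma cpath_ge_open n : open_ideal (N n).
Proof.
split; first exact: cpath_ge_ideal.
rewrite openE => x hx; apply/cpath_nbhs; exists n => y h.
by have := idl_sub (cpath_ge_ideal Q n) h hx.
Qed.

(** The geometric series of an element without constant term. *)
Lemma cpath_quasi_inv w : N 1 w -> exists u, u * (1 - w) = 1.
Proof.
move=> hw; have wn n : N n (w ^+ n).
  elim: n => [|n IH]; first by rewrite expr0.
  by rewrite exprSr -[n.+1]addn1; apply: cpath_geM.
pose u : kQ := fun p => (\sum_(i < (qsize p).+1) w ^+ i) p.
have hu n : N n (u - \sum_(i < n) w ^+ i).
  move=> p hp; rewrite cpathEB /u.
  have -> : n = ((qsize p).+1 + (n - (qsize p).+1))%N by rewrite subnKC.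
  rewrite [X in _ - X p]big_split_ord /= cpathED opprD addrA subrr sub0r cpathE_sum.
  rewrite big1 ?oppr0 // => i _; apply: wn; exact: leq_addr.
exists u; apply: cpath_ge_eq => n.
have geo : (\sum_(i < n) w ^+ i) * (1 - w) = 1 - w ^+ n.
  elim: n => [|n IH]; first by rewrite big_ord0 mul0r subrr.
  by rewrite big_ord_recr mulrDl IH mulrBr mulr1 -exprSr addrA subrK.
apply: (idl_trans (cpath_ge_ideal Q n) (y := (\sum_(i < n) w ^+ i) * (1 - w))).
  by rewrite -mulrBl; apply: idlMr (cpath_ge_ideal Q n) _ _ _.
by rewrite geo addrC addKr; apply: idlN (cpath_ge_ideal Q n) _ _.
Qed.

Lemma cpath_chars : let p (x : kQ) v := x (qtriv v) in
  [/\ forall v, zmod_morphism (p^~ v) /\ monoid_morphism (p^~ v),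
      forall a v, p (scal a) v = a & forall v, open [set x | p x v = 0]].
Proof.
move=> p; split=> [v|a v|v].
- split=> [x y //|]; split=> // x y; rewrite /p /= cpathEM big_ord_recl big_ord0 addr0.
  by congr (x _ * y _); exact: val_inj.
- exact: mulr1n.
- rewrite openE => x /= hx; apply/cpath_nbhs; exists 1%N => y h.
  by have := h (qtriv v) (ltnSn _); rewrite cpathEB /= => e; rewrite /p -hx; apply/eqP; rewrite -subr_eq0 e.
Qed.

Lemma cpath_jac x : jacobson x <-> N 1 x.
Proof.
rewrite videm_ge1; have [h1 h2 h3] := cpath_chars.
apply: (jacobson_chars h1 h2 h3) => w hw; apply: cpath_quasi_inv; exact/videm_ge1.
Qed.

Lemma cpath_pointed : pointed_algebra kQ.
Proof.
exists (vtx Q), (fun x v => x (qtriv v)); have [h1 h2 h3] := cpath_chars; split=> //.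
  by move=> y; exists (fun p => y (val p).1).
by move=> a; rewrite cpath_jac videm_ge1.
Qed.

Lemma cpath_jac2 x : jpow 2 x <-> N 2 x.
Proof.
split.
  move: x; apply: mul_set_ind => //; first exact: idlD (cpath_ge_ideal Q 2).
  by move=> a b /cpath_jac ha /cpath_jac hb; exact: (cpath_geM ha hb).
move=> hx; have h1 : N 1 x by apply: cpath_ge_le hx.
rewrite (cpath_expand1 h1); apply: (idl_sum (jpow_ideal cpath_pointed 2)) => b _.
by apply: mul_setM; apply/cpath_jac; [exact: strip_ge|exact: barr_ge].
Qed.

Lemma cpath_PAlg : PAlg_ob kQ.
Proof.
split; [exact: cpath_pseudocompact|exact: cpath_pointed|].
have [n [f [h1 h2 h3]]] := cpath_fcodim Q 2; exists n, f; split=> // x.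
by rewrite cpath_jac2.
Qed.
End CpathPAlg.

(** * Universal property of the completed path algebra *)

Section Universal.
Variables (k : fieldType) (Q : vquiver k) (A : preTopAlgType k).
Hypothesis hA : PAlg_ob A.
Local Notation kQ := (cpath Q).
Local Notation N := (@cpath_ge k Q).
Local Notation jp := (@jpow k A).
Implicit Types (x y : kQ).

Let psA : pseudocompact A. Proof. by case: hA. Qed.
Let ptA : pointed_algebra A. Proof. by case: hA. Qed.
Let hI n := jpow_ideal ptA n.

Lemma mulrB_split (a a' b b' : A) : a * b - a' * b' = (a - a') * b + a' * (b - b').
Proof. by rewrite mulrBl mulrBr addrA subrK. Qed.

Lemma jpow_mulJ n (a b : A) : jp n a -> jacobson b -> jp n.+1 (a * b).
Proof. by move=> ha hb; rewrite -addn1; apply: (jpow_mul ptA ha). Qed.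

Section Existence.
Variables (eps : vtx Q -> A) (m : qarr Q -> A).
Hypotheses (eps_orth : forall v w, eps v * eps w = if v == w then eps v else 0).
Hypotheses (eps1 : \sum_v eps v = 1) (mJ : forall b, jacobson (m b)).
Hypotheses (ml : forall b, eps (tgt b) * m b = m b).
Hypotheses (mr : forall b, m b * eps (src b) = m b).

(** The image of the paths of length less than [n], computed recursively by
    splitting off the first arrow; it is multiplicative modulo [J^n]. *)
Fixpoint univ_trunc (n : nat) (x : kQ) : A :=
  if n is n'.+1 then
    \sum_v scal (x (qtriv v)) * eps v + \sum_b univ_trunc n' (strip b x) * m b
  else 0.
Local Notation T := univ_trunc.

Lemma univ_truncS n x : T n.+1 x =
  \sum_v scal (x (qtriv v)) * eps v + \sum_b T n (strip b x) * m b.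
Proof. by []. Qed.

Lemma univ_truncB n x y : T n (x - y) = T n x - T n y.
Proof.
elim: n x y => [|n IH] x y; first by rewrite /= subrr.
rewrite !univ_truncS opprD addrACA -!sumrB; congr (_ + _); apply: eq_bigr => i _.
  by rewrite cpathEB rmorphB mulrBl.
by rewrite stripB IH mulrBl.
Qed.

Lemma univ_trunc0 n : T n 0 = 0.
Proof. exact: zm0 (univ_truncB n). Qed.

Lemma univ_truncZ n a x : T n (scal a * x) = scal a * T n x.
Proof.
elim: n x => [|n IH] x; first by rewrite /= mulr0.
rewrite !univ_truncS mulrDr !mulr_sumr; congr (_ + _); apply: eq_bigr => i _.
  by rewrite cpathEZ rmorphM mulrA.
by rewrite stripZ IH mulrA.
Qed.

Lemma univ_trunc_step n x : jp n (T n.+1 x - T n x).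
Proof.
elim: n x => [|n IH] x //; rewrite [T n.+2 x]univ_truncS [T n.+1 x]univ_truncS.
rewrite opprD addrACA subrr add0r -sumrB; apply: (idl_sum (hI _)) => b _.
by rewrite -mulrBl; apply: jpow_mulJ.
Qed.

Lemma univ_trunc_ge n x : N n x -> T n x = 0.
Proof.
elim: n x => [|n IH] x hx //; rewrite univ_truncS !big1 ?addr0 // => [b _|v _].
  by rewrite IH ?mul0r //; exact: strip_ge.
by rewrite hx // rmorph0 mul0r.
Qed.

Let eps_sum v (c : vtx Q -> k) : eps v * (\sum_w scal (c w) * eps w) = scal (c v) * eps v.
Proof.
rewrite mulr_sumr (bigD1 v) //= big1 ?addr0 => [|w ne].
  by rewrite mulrA -scal_central -mulrA eps_orth eqxx.
by rewrite mulrA -scal_central -mulrA eps_orth eq_sym (negPf ne) mulr0.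
Qed.

Let m_sum b (c : vtx Q -> k) : m b * (\sum_w scal (c w) * eps w) = scal (c (src b)) * m b.
Proof. by rewrite -{1}[m b]mr -mulrA eps_sum mulrA -scal_central -mulrA mr. Qed.

Lemma univ_trunc_mul n x y : jp n (T n (x * y) - T n x * T n y).
Proof.
elim: n x y => [|n IH] x y //.
have -> : T n.+1 (x * y) = T n.+1 x * (\sum_v scal (y (qtriv v)) * eps v)
      + \sum_b T n (x * strip b y) * m b.
  rewrite !univ_truncS mulrDl -addrA; congr (_ + _).
    rewrite mulr_suml; apply: eq_bigr => v _; rewrite -mulrA eps_sum mulrA -rmorphM.
    congr (scal _ * _); have [/(_ v) [_ [_ h]] _ _] := @cpath_chars k Q; exact: h.
  rewrite mulr_suml -big_split; apply: eq_bigr => b _ /=.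
  rewrite strip_mul -[X in T n (X + _)]opprK -[X in T n X]opprK opprD opprK.
  have -> : T n (- (- (scal (y (qtriv (src b))) * strip b x) - x * strip b y)) =
    scal (y (qtriv (src b))) * T n (strip b x) + T n (x * strip b y).
    by rewrite (zmN (univ_truncB n)) univ_truncB (zmN (univ_truncB n)) univ_truncZ opprB opprK addrC.
  rewrite mulrDl; congr (_ + _); rewrite -!mulrA m_sum.
  by rewrite mulrA scal_central -mulrA.
rewrite [T n.+1 y]univ_truncS mulrDr opprD addrACA subrr add0r mulr_sumr -sumrB.
apply: (idl_sum (hI _)) => b _; rewrite mulrA -mulrBl; apply: jpow_mulJ => //.
apply: (idl_trans (hI n) (IH x (strip b y))); rewrite -mulrBl.
by apply: (idlMr (hI n)); apply: (idl_sym (hI n)); exact: univ_trunc_step.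
Qed.

Lemma univ_trunc1 n : T n.+1 1 = 1.
Proof.
rewrite univ_truncS -eps1 [X in _ + X]big1 ?addr0 => [|b _].
  by apply: eq_bigr => v _; rewrite cpathE1 rmorph1 mul1r.
have -> : strip b (1 : kQ) = 0; last by rewrite univ_trunc0 mul0r.
apply/funext => p; rewrite /strip; case: ifP => // _; rewrite /cval.
by case: insubP => //= q _ hq; rewrite cpathE1 /= hq.
Qed.

Lemma univ_trunc_videm n v : T n.+1 (videm (Some v)) = eps v.
Proof.
rewrite univ_truncS [X in _ + X]big1 ?addr0 => [|b _].
  rewrite (bigD1 v) //= /videm /= eqxx rmorph1 mul1r big1 ?addr0 // => w ne.
  by rewrite xpair_eqE (negPf ne) rmorph0 mul0r.
have -> : strip b (videm (Some v) : kQ) = 0; last by rewrite univ_trunc0 mul0r.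
apply/funext => p; rewrite /strip; case: ifP => // _; rewrite /cval.
by case: insubP => //= q _ hq; rewrite /videm /= hq xpair_eqE andbF.
Qed.

Lemma univ_trunc_barr n b : T n.+2 (barr b) = m b.
Proof.
rewrite univ_truncS big1 ?add0r => [|v _]; last first.
  by rewrite barr_ge // rmorph0 mul0r.
rewrite (bigD1 b) // big1 ?addr0 => [|c ne].
  have -> : strip b (barr b : kQ) = videm (Some (tgt b)).
    apply/funext => p; rewrite /strip /videm; case: p => -[e w] hp /=.
    rewrite xpair_eqE; case: eqP => //= -> /= in hp *.
    rewrite /cval insubT ?qarr_valid // => hv /=.
    by rewrite /barr /= xpair_eqE eqxx eqseq_cons eqxx.
  by rewrite univ_trunc_videm ml [LHS]addr0.
have -> : strip c (barr b : kQ) = 0; last by rewrite univ_trunc0 mul0r.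
apply/funext => p; rewrite /strip; case: ifP => // _; rewrite /cval.
case: insubP => //= q _ hq; rewrite /barr /= hq; case: eqP => //= -[h1 h2 h3 _].
by case/eqP: ne; apply: qarr_eq.
Qed.

(** The truncations form a Cauchy sequence for the radical filtration; their
    limit is the morphism with the given values. *)
Lemma cpath_univ_ex : exists phi : kQ -> A,
  [/\ alg_mor phi, forall v, phi (videm (Some v)) = eps v & forall b, phi (barr b) = m b].
Proof.
have [phi hphi] := choice (fun x => jadic_limit hA (fun n => univ_trunc_step n x)).
have eqI a c : (forall I n, open_ideal I -> jp n `<=` I -> jp n.+1 `<=` I -> jp n.+2 `<=` I ->
    I (a - c)) -> a = c.
  move=> h; apply: (open_ideal_eq psA) => I oI; have [n hn] := jpow_open_ideal hA oI.
  have hn1 := subset_trans (jpow_leS ptA (n := n)) hn.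
  by apply: (h I n) => //; exact: subset_trans (jpow_leS ptA (n := n.+1)) hn1.
have phiB : zmod_morphism phi.
  move=> x y; apply: eqI => I n oI hn _ _; apply: (idl_trans oI.1 (hphi _ I oI n hn)).
  rewrite univ_truncB subrACA; apply: (idlB oI.1); apply: (idl_sym oI.1); exact: hphi.
have phi1 : phi 1 = 1.
  by apply: eqI => I n oI _ hn _; have := hphi 1 I oI _ hn; rewrite univ_trunc1.
have phiM x y : phi (x * y) = phi x * phi y.
  apply: eqI => I n oI hn _ _; apply: (idl_trans oI.1 (hphi _ I oI n hn)).
  apply: (idl_trans oI.1 (y := T n x * T n y)); first by apply: hn; exact: univ_trunc_mul.
  by apply: (idl_sym oI.1); apply: (idl_mulB oI.1); exact: hphi.
have phiv v : phi (videm (Some v)) = eps v.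
  by apply: eqI => I n oI _ hn _; have := hphi (videm (Some v)) I oI _ hn; rewrite univ_trunc_videm.
have phib b : phi (barr b) = m b.
  by apply: eqI => I n oI _ _ hn; have := hphi (barr b) I oI _ hn; rewrite univ_trunc_barr.
exists phi; split=> //; split=> //.
  move=> a; apply: eqI => I n oI _ hn _; apply: (idl_trans oI.1 (hphi _ I oI _ hn)).
  by rewrite -[X in T _ X]mulr1 univ_truncZ univ_trunc1 mulr1 subrr; exact: idl0 oI.1.
apply: continuous_ideals => //; first exact: cpath_pseudocompact.
move=> I oI; have [n hn] := jpow_open_ideal hA oI; exists (N n); first exact: cpath_ge_open.
by move=> x hx; have := hphi x I oI n hn; rewrite univ_trunc_ge // subr0.
Qed.
End Existence.

Section Morphisms.
Variables (phi psi : kQ -> A).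
Hypotheses (hphi : alg_mor phi) (hpsi : alg_mor psi).

Lemma alg_mor_expand x : phi x =
  \sum_v scal (x (qtriv v)) * phi (videm (Some v)) + \sum_b phi (strip b x) * phi (barr b).
Proof.
rewrite {1}[x]cpath_expand (amD hphi) !(am_sum hphi).
congr (_ + _); apply: eq_bigr => i _; first by rewrite (am_scalM hphi).
by rewrite (amM hphi).
Qed.

Lemma alg_mor_expand1 x : N 1 x -> phi x = \sum_b phi (strip b x) * phi (barr b).
Proof.
move=> hx; rewrite {1}(cpath_expand1 hx) (am_sum hphi).
by apply: eq_bigr => i _; rewrite (amM hphi).
Qed.

Lemma alg_mor_barrJ b : jacobson (phi (barr b)).
Proof. by apply: (jac_mor (cpath_PAlg Q) hA hphi); apply/cpath_jac/barr_ge. Qed.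
End Morphisms.

Lemma alg_mor_ge (phi : kQ -> A) n x : alg_mor phi -> N n x -> jp n (phi x).
Proof.
move=> hphi; elim: n x => [|n IH] x hx //.
rewrite (alg_mor_expand1 hphi); last exact: cpath_ge_le hx.
apply: (idl_sum (hI _)) => b _; apply: jpow_mulJ; last exact: alg_mor_barrJ.
by apply: IH; exact: strip_ge.
Qed.

(** Morphisms that agree on vertices and arrows agree: by the expansion along the
    first arrow their difference lies in every power of the radical. *)
Lemma alg_mor_eq (phi psi : kQ -> A) : alg_mor phi -> alg_mor psi ->
  (forall v, phi (videm (Some v)) = psi (videm (Some v))) ->
  (forall b, phi (barr b) = psi (barr b)) -> phi = psi.
Proof.
move=> hphi hpsi hv hb; apply/funext => x; apply: (open_ideal_eq psA) => I oI.
have [n] := jpow_open_ideal hA oI; apply; elim: n x => [|n IH] x //.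
rewrite (alg_mor_expand hphi) (alg_mor_expand hpsi) opprD addrACA -!sumrB big1 => [|v _].
  rewrite add0r; apply: (idl_sum (hI _)) => b _; rewrite hb -mulrBl.
  by apply: jpow_mulJ => //; exact: alg_mor_barrJ.
by rewrite hv subrr.
Qed.

(** By the expansion along the first arrow, as [phi] and [psi] send arrows to [J]. *)
Lemma sim1_generators (phi psi : kQ -> A) : alg_mor phi -> alg_mor psi ->
  (forall v, jacobson (phi (videm (Some v)) - psi (videm (Some v)))) ->
  (forall b, jpow 2 (phi (barr b) - psi (barr b))) -> sim1 phi psi.
Proof.
move=> hphi hpsi hv hb.
have h1 x : jacobson (phi x - psi x).
  rewrite (alg_mor_expand hphi) (alg_mor_expand hpsi).
  apply: (idl_addB (jac_ideal ptA)).
    rewrite -sumrB; apply: (idl_sum (jac_ideal ptA)) => v _; rewrite -mulrBr.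
    exact: (idlMl (jac_ideal ptA)).
  rewrite -sumrB; apply: (idl_sum (jac_ideal ptA)) => b _.
  by apply: (idlB (jac_ideal ptA)); apply: (idlMl (jac_ideal ptA)); exact: alg_mor_barrJ.
split=> // x /cpath_jac hx; rewrite (alg_mor_expand1 hphi hx) (alg_mor_expand1 hpsi hx).
rewrite -sumrB; apply: (idl_sum (hI 2)) => b _; rewrite mulrB_split.
apply: (idlD (hI 2)); last exact: (idlMl (hI 2)).
by apply: mul_setM => //; exact: alg_mor_barrJ.
Qed.
End Universal.

(** * Vertices and arrows inside the path algebra *)

Section Coordinates.
Variables (k : fieldType) (V : lmodType k).
Hypothesis fV : fin_dim V.

Let coordP : linear (projT2 (coordinates V)) /\ bijective (projT2 (coordinates V)).
Proof.
rewrite /coordinates /some_such; case: pselect => [h|[]]; first exact: projT2 (cid h).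
by case: fV => n [c [h1 h2]]; exists (existT _ n c).
Qed.

Lemma vcoordE (x : V) (i : 'I_(vdim V)) : vcoord x i = projT2 (coordinates V) x 0 i.
Proof. by rewrite /vcoord valK. Qed.

Lemma vcoord_lin a (x y : V) (i : 'I_(vdim V)) :
  vcoord (a *: x + y) i = a * vcoord x i + vcoord y i.
Proof. by rewrite !vcoordE coordP.1 !mxE. Qed.

Lemma vcoord0 (i : 'I_(vdim V)) : vcoord (0 : V) i = 0.
Proof. by have := vcoord_lin (-1) 0 0 i; rewrite scaler0 addr0 mulN1r addNr. Qed.

Lemma vcoord_inj (x y : V) : (forall i : 'I_(vdim V), vcoord x i = vcoord y i) -> x = y.
Proof.
move=> h; apply: (bij_inj coordP.2); apply/rowP => i; have := h i.
by rewrite !vcoordE.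
Qed.

Lemma vcoord_surj (c : 'I_(vdim V) -> k) : exists x : V, forall i : 'I_(vdim V), vcoord x i = c i.
Proof.
case: coordP => _ [g _ gK]; exists (g (\row_i c i)) => i.
by rewrite vcoordE gK mxE.
Qed.
End Coordinates.

Section Generators.
Variables (k : fieldType) (Q : vquiver k).
Local Notation kQ := (cpath Q).
Local Notation N := (@cpath_ge k Q).
Implicit Types (x y h : kQ) (p : qpath Q).

Lemma videm_mull v x p : (videm (Some v) * x) p =
  if last (val p).1 (unzip1 (val p).2) == v then x p else 0.
Proof.
rewrite cpathEM big_ord_recr /= big1 => [|i _].
  rewrite add0r ptake_size /videm /= /qsize take_size drop_size xpair_eqE eqxx andbT.
  by case: eqP; rewrite ?mul1r ?mul0r.
rewrite /videm /= xpair_eqE -size_eq0 size_drop subn_eq0 leqNgt.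
by rewrite [(_ < size _)%N](ltn_ord i) andbF mul0r.
Qed.

Lemma videm_orth v w : videm (Some v) * videm (Some w) = if v == w then videm (Some v) else 0 :> kQ.
Proof.
apply/funext => p; rewrite videm_mulr /videm.
case: (eqVneq v w) => [->|/eqP ne]; case: eqP => // e1.
  by case: eqP => // e2; case: e1; rewrite e2.
by case: eqP => // e2; case: ne; rewrite -e1 e2.
Qed.

Lemma videm_sum : \sum_v videm (Some v) = 1 :> kQ.
Proof.
apply/funext => p; rewrite cpathE_sum cpathE1 (bigD1 (val p).1) //= big1 ?addr0.
  by case: p => -[e [|c s]] hp /=; rewrite xpair_eqE eqxx.
move=> v ne; case: p ne => -[e s] hp /= ne.
by rewrite xpair_eqE eq_sym (negPf ne).
Qed.

Lemma videm_barr b : videm (Some (tgt b)) * barr b = barr b :> kQ.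
Proof.
apply/funext => p; rewrite videm_mull; case: ifP => // ne; rewrite /barr.
by case: (val p =P _) ne => [->|_ _] //=; rewrite eqxx.
Qed.

Lemma barr_videm b : barr b * videm (Some (src b)) = barr b :> kQ.
Proof.
apply/funext => p; rewrite videm_mulr; case: ifP => // ne; rewrite /barr.
by case: (val p =P _) ne => [->|_ _] //=; rewrite eqxx.
Qed.

Lemma varr_val (e f : vtx Q) (u : arr (v := Q) (Some e) (Some f)) p :
  varr u p = if val p is (e0, [:: (f0, i)]) then
               if (e0 == e) && (f0 == f) then vcoord u i else 0 else 0.
Proof. by []. Qed.

Hypothesis hQ : is_vquiver Q.

Lemma arr_None_l f (u : arr (v := Q) None f) : u = 0. Proof. by case: hQ. Qed.
Lemma arr_None_r e (u : arr (v := Q) e None) : u = 0. Proof. by case: hQ. Qed.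
Let fQ e f : fin_dim (arr (v := Q) e f). Proof. by case: hQ. Qed.

Lemma varr_lin e f a (u v : arr (v := Q) e f) :
  varr (a *: u + v) = scal a * varr u + varr v :> kQ.
Proof.
case: e f u v => [e|] [f|] u v; try by rewrite /= mulr0 addr0.
rewrite !varrE mulr_sumr -big_split; apply: eq_bigr => i _ /=.
by rewrite vcoord_lin // rmorphD rmorphM mulrDl mulrA.
Qed.

Lemma varr_zmod e f : zmod_morphism (@varr k Q e f).
Proof. by move=> u v; rewrite addrC -scaleN1r varr_lin rmorphN1 mulN1r addrC. Qed.

Lemma varrZ e f a (u : arr (v := Q) e f) : varr (a *: u) = scal a * varr u :> kQ.
Proof. by rewrite -[a *: u]addr0 varr_lin (zm0 (@varr_zmod e f)) addr0. Qed.

Lemma varr_ge2 e f (u : arr (v := Q) e f) : N 2 (varr u) -> u = 0.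
Proof.
case: e f u => [e|] [f|] u h; try by [exact: arr_None_l|exact: arr_None_r].
apply: vcoord_inj => // i; rewrite vcoord0 //.
have hv : qvalid e [:: (f, nat_of_ord i)] by rewrite /= ltn_ord.
pose p : qpath Q := exist (fun c : vtx Q * seq (vtx Q * nat) => qvalid c.1 c.2) (e, [:: (f, nat_of_ord i)]) hv.
by have := h p (ltnSn _); rewrite varr_val /= !eqxx.
Qed.

Lemma varr_inj e f : injective (@varr k Q e f).
Proof.
move=> u v h; apply/eqP; rewrite -subr_eq0; apply/eqP/varr_ge2.
by rewrite (varr_zmod u v) h subrr.
Qed.

Lemma barr_varr b : exists u : arr (v := Q) (Some (src b)) (Some (tgt b)), varr u = barr b.
Proof.
case: b => -[e f] i; have [u hu] := vcoord_surj (fQ (Some e) (Some f)) (fun j => (j == i)%:R).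
exists u; rewrite varrE (bigD1 i) //= hu eqxx rmorph1 mul1r big1 ?addr0 // => j ne.
by rewrite hu (negPf ne) rmorph0 mul0r.
Qed.

(** The basis of arrows dual to [vcoord]. *)
Lemma arr_basis : exists u : forall b, arr (v := Q) (Some (src b)) (Some (tgt b)),
  (forall b, varr (u b) = barr b) /\
  forall e f (x : arr (v := Q) (Some e) (Some f)),
    x = \sum_(i < vdim (arr (v := Q) (Some e) (Some f))) vcoord x i *:
      (u (mkarr i)
        : arr (v := Q) (Some e) (Some f)).
Proof.
have [u hu] : exists u : forall b, arr (v := Q) (Some (src b)) (Some (tgt b)),
    forall b, varr (u b) = barr b.
  exists (fun b => projT1 (cid (barr_varr b))) => b; exact: projT2 (cid (barr_varr b)).
exists u; split=> // e f x; apply: varr_inj.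
rewrite (zm_sum (@varr_zmod (Some e) (Some f))) [LHS]varrE; apply: eq_bigr => i _.
rewrite varrZ; congr (_ * _); exact: esym (hu _).
Qed.

Lemma varr_videm e f (u : arr (v := Q) e f) :
  videm f * varr u * videm e = varr u :> kQ.
Proof.
case: e f u => [e|] [f|] u; rewrite ?mulr0 ?mul0r //.
rewrite varrE mulr_sumr mulr_suml; apply: eq_bigr => i _.
set b := mkarr i; rewrite mulrA -scal_central -!mulrA; congr (_ * _).
exact: etrans (congr1 (fun x => videm (Some f) * x) (barr_videm b)) (videm_barr b).
Qed.

Lemma arrow_part e f h : N 1 h -> exists u : arr (v := Q) e f,
  N 2 (videm f * h * videm e - varr u).
Proof.
move=> hh; case: e f => [e|] [f|]; try by exists 0; rewrite (zm0 (@varr_zmod _ _)) ?mulr0 ?mul0r subrr.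
have [u hu] := vcoord_surj (fQ (Some e) (Some f)) (fun i => cval h (e, [:: (f, nat_of_ord i)])).
exists u => p hp; rewrite cpathEB videm_mulr videm_mull varr_val.
case: p hp => -[e0 [|[f0 i] [|c s]]] hv hp //=.
  by rewrite hh // !if_same subrr.
case: eqP => [e1|_] /=; last by rewrite subrr.
case: eqP => [e2|_]; last by rewrite subrr.
subst e0 f0; have hi : (i < vdim (arr (v := Q) (Some e) (Some f)))%N by have /andP [] := hv.
have := hu (Ordinal hi); rewrite /= => ->.
set q : qpath Q := exist _ _ _.
by rewrite -[X in _ - cval h X]/(val q) cval_val subrr.
Qed.

Lemma videm_decomp h : h = \sum_v \sum_w videm (Some w) * h * videm (Some v).
Proof.
rewrite -{1}[h]mulr1 -videm_sum mulr_sumr; apply: eq_bigr => v _.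
by rewrite -mulr_suml -mulr_suml videm_sum mul1r.
Qed.
End Generators.

(** * Surjections from path algebras *)

Section Surjections.
Variables (k : fieldType) (Q : vquiver k) (A : preTopAlgType k).
Hypothesis hA : PAlg_ob A.
Local Notation kQ := (cpath Q).
Local Notation N := (@cpath_ge k Q).
Local Notation jp := (@jpow k A).
Variable phi : kQ -> A.
Hypothesis hphi : alg_mor phi.

Let psA : pseudocompact A. Proof. by case: hA. Qed.
Let ptA : pointed_algebra A. Proof. by case: hA. Qed.
Let hI n := jpow_ideal ptA n.

Lemma alg_mor_open_ideal I : open_ideal I -> exists n, forall x, N n x -> I (phi x).
Proof.
move=> oI; have [n hn] := jpow_open_ideal hA oI; exists n => x hx.
by apply: hn; apply: alg_mor_ge.
Qed.

(** The image of [cpath_ge n] is closed: the solutions of [phi h = a] modulo the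
    open ideals form a directed family of affine sets. *)
Lemma image_cpath_ge_closed n a :
  (forall I, open_ideal I -> exists2 h, N n h & I (phi h - a)) ->
  exists2 h, N n h & phi h = a.
Proof.
move=> ha; pose S I := [set h | N n h /\ I (phi h - a)].
have [||h hh] := @linear_compactness k Q [set S I | I in @open_ideal k A].
- by exists (S setT); exists setT => //; exact: open_idealT.
- split=> [_ _ [I oI <-] [I' oI' <-]|_ [I oI <-]].
    exists (S (I `&` I')); first by exists (I `&` I') => //; exact: open_idealI.
    by move=> x [Nx [? ?]].
  split; last by have [h Nh Ih] := ha I oI; exists h.
  move=> x y z c [Nx Ix] [Ny Iy] [Nz Iz]; split.
    apply: (idlD (cpath_ge_ideal Q n)) => //; apply: (idlMl (cpath_ge_ideal Q n)).
    exact: (idlB (cpath_ge_ideal Q n)).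
  rewrite (amD hphi) (am_scalM hphi) (amB hphi) addrAC; apply: (idlD oI.1) => //.
  apply: (idlMl oI.1); rewrite -(subrBB a); exact: (idlB oI.1).
exists h.
  have [|y [Ny _] hy] := hh (S setT) _ n; first by exists setT => //; exact: open_idealT.
  by have := idl_sub (cpath_ge_ideal Q n) hy Ny.
apply: (open_ideal_eq psA) => I oI; have [m hm] := alg_mor_open_ideal oI.
have [|y [_ Iy] hy] := hh (S I) _ m; first by exists I.
by apply: (idl_trans oI.1 (y := phi y)) Iy; rewrite -(amB hphi); exact: hm.
Qed.

Hypothesis gen0 : forall a, exists h, jacobson (a - phi h).
Hypothesis gen1 : forall a, jacobson a -> exists2 h, N 1 h & jpow 2 (a - phi h).

Let gen_step n a : jp n a -> exists2 h, N n h & jp n.+1 (a - phi h).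
Proof.
elim: n a => [|n IH] a; first by move=> _; have [h] := gen0 a; exists h.
rewrite jpowS //; move: a; apply: mul_set_ind.
- by exists 0; rewrite ?(am0 hphi) ?subr0 //; exact: idl0 (hI _).
- move=> x y [h Nh hx] [h' Nh' hy]; exists (h + h'); first exact: (idlD (cpath_ge_ideal Q _)).
  by rewrite (amD hphi); apply: (idl_addB (hI _)).
- move=> a b /gen1 [h Nh hh] hb; have [l Nl hl] := IH b hb.
  exists (h * l); first by rewrite -add1n; exact: cpath_geM.
  rewrite (amM hphi) mulrB_split; apply: (idlD (hI _)).
    by rewrite -[n.+2]/(2 + n)%N; apply: (jpow_mul ptA).
  rewrite -[n.+2]/(1 + n.+1)%N; apply: (jpow_mul ptA) => //.
  exact: (alg_mor_ge hA hphi Nh).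
Qed.

(** Degree by degree approximation makes the image dense, and it is closed. *)
Lemma generated_surj n a : jp n a -> exists2 h, N n h & phi h = a.
Proof.
move=> ha; apply: image_cpath_ge_closed => I oI; have [m hm] := jpow_open_ideal hA oI.
suff [h Nh hh] : exists2 h, N n h & jp (n + m)%N (phi h - a).
  by exists h => //; apply: hm; apply: (jpow_le ptA _ hh); exact: leq_addl.
elim: m {hm} => [|m [h Nh hh]].
  exists 0; rewrite ?(am0 hphi) ?sub0r ?addn0 //; exact: idlN (hI _) _ ha.
have [l Nl hl] := gen_step hh; exists (h - l).
  apply: (idlB (cpath_ge_ideal Q n)) => //; apply: cpath_ge_le Nl; exact: leq_addr.
by rewrite (amB hphi) addnS addrAC.
Qed.

End Surjections.

Section SurjectiveOpen.
Variables (k : fieldType) (Q : vquiver k) (A : preTopAlgType k).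
Hypothesis hA : PAlg_ob A.
Local Notation kQ := (cpath Q).
Local Notation N := (@cpath_ge k Q).
Variable phi : kQ -> A.
Hypotheses (hphi : alg_mor phi) (phis : forall a, exists h, phi h = a).

(** The preimages of the open ideals meet in the kernel of [phi] plus
    [cpath_ge n], which has finite codimension; killing the finitely many
    coordinates below [n] one at a time, some preimage lies inside it. *)
Lemma image_cpath_ge_open n : exists2 I : set A, open_ideal I &
  forall a, I a -> exists2 h, N n h & phi h = a.
Proof.
pose C := [set x | exists2 h, N n h & phi h = phi x].
pose D (I : set A) := [set x | exists2 h, N n h & I (phi h - phi x)].
have DB (I : set A) c x y : open_ideal I -> D I x -> D I y -> D I (x + scal c * y).
  move=> oI [h Nh Ih] [l Nl Il]; exists (h + scal c * l).
    apply: (idlD (cpath_ge_ideal Q n)) => //; exact: (idlMl (cpath_ge_ideal Q n)).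
  rewrite !(amD hphi) !(am_scalM hphi); apply: (idl_addB oI.1) => //.
  by rewrite -mulrBr; apply: (idlMl oI.1).
have CD I x : open_ideal I -> C x -> D I x.
  by move=> oI [h Nh e]; exists h => //; rewrite e subrr; exact: idl0 oI.1.
have DS (I I' : set A) x : I `<=` I' -> D I x -> D I' x by move=> s [h Nh /s]; exists h.
have [s hs] := qpath_finite Q n.
suff [I oI hI] : exists2 I : set A, open_ideal I & forall x, D I x -> C x.
  exists I => // a Ia; have [x ax] := phis a; have [|h Nh e] := hI x.
    exists 0; first exact: idl0 (cpath_ge_ideal Q n).
    by rewrite (am0 hphi) sub0r ax; exact: idlN oI.1 _ Ia.
  by exists h; rewrite ?e.
suff [I oI hI] : exists2 I : set A, open_ideal I & forall x, D I x -> (forall p, p \in s -> x p = 0) -> C x.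
  elim: s I oI hI {hs} => [|p s IH] I oI hI; first by exists I => // x /hI; apply.
  case: (pselect (forall x, D I x -> (forall q, q \in s -> x q = 0) -> C x)) => [|nh].
    exact: IH.
  have [v [Dv vs nCv]] : exists v, [/\ D I v, forall q, q \in s -> v q = 0 & ~ C v].
    by apply: contrapT => h; apply: nh => x Dx xs; apply: contrapT => nC; apply: h; exists x.
  have [I1 oI1 nD1] : exists2 I1 : set A, open_ideal I1 & ~ D I1 v.
    apply: contrapT => h; apply: nCv; apply: (image_cpath_ge_closed hA hphi) => J oJ.
    by apply: contrapT => h'; apply: h; exists J.
  apply: (IH (I `&` I1)); first exact: open_idealI.
  move=> x Dx xs; have DIx : D I x by apply: DS Dx => y [].
  case: (eqVneq (x p) 0) => [xp0|xp0].
    by apply: hI => // q; rewrite inE => /orP [/eqP ->|/xs].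
  case: (eqVneq (v p) 0) => [vp0|vp0].
    by case: nCv; apply: hI => // q; rewrite inE => /orP [/eqP ->|/vs].
  have Cd : C (v + scal (- (v p / x p)) * x).
    apply: hI; first exact: DB.
    move=> q; rewrite inE cpathED cpathEZ => /orP [/eqP ->|qs].
      by rewrite mulNr divfK ?subrr.
    by rewrite (vs q) // (xs q) // mulr0 addr0.
  case: nD1; rewrite -[v](subrK (scal (v p / x p) * x)); apply: DB => //.
    by apply: (CD _ _ oI1); rewrite -mulNr -rmorphN.
  by apply: DS Dx => y [].
exists setT; first exact: open_idealT.
by move=> x _ xs; exists x => // p hp; apply: xs; exact: hs.
Qed.
End SurjectiveOpen.

Section Lifting.
Variables (k : fieldType) (Q : vquiver k) (A B : preTopAlgType k).
Hypotheses (hA : PAlg_ob A) (hB : PAlg_ob B).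
Local Notation kQ := (cpath Q).
Variables (pi : B -> A) (psi : kQ -> A) (beta : kQ -> B).
Hypotheses (hpi : alg_mor pi) (pis : forall a, exists b, pi b = a).
Hypotheses (hpsi : alg_mor psi) (hbeta : alg_mor beta) (hsim : sim1 (pi \o beta) psi).

Let ptA : pointed_algebra A. Proof. by case: hA. Qed.
Let ptB : pointed_algebra B. Proof. by case: hB. Qed.
Local Notation vv v := (videm (Some v) : kQ).

(** Path algebras are projective: after conjugating [beta] by a lift of the unit
    [u] that carries the idempotents [pi (beta v)] to [psi v], its values on the
    arrows can be corrected by elements of [J^2]. *)
Lemma cpath_lift : exists beta' : kQ -> B,
  [/\ alg_mor beta', sim1 beta' beta & pi \o beta' = psi].
Proof.
pose u := \sum_v psi (vv v) * pi (beta (vv v)).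
have mor_orth (C : preTopAlgType k) (f : kQ -> C) v w : alg_mor f ->
    f (vv v) * f (vv w) = if v == w then f (vv v) else 0.
  by move=> hf; rewrite -(amM hf) videm_orth; case: ifP => // _; rewrite (am0 hf).
have mor_sum (C : preTopAlgType k) (f : kQ -> C) : alg_mor f -> \sum_v f (vv v) = 1.
  by move=> hf; rewrite -(am_sum hf) videm_sum (am1 hf).
have Ju : jacobson (u - 1).
  rewrite -(mor_sum _ psi hpsi) -sumrB; apply: (idl_sum (jac_ideal ptA)) => v _.
  have e := mor_orth _ _ v v hpsi; rewrite eqxx in e; rewrite -{2}e -mulrBr.
  by apply: (idlMl (jac_ideal ptA)); exact: hsim.1.
have ul v : psi (vv v) * u = psi (vv v) * pi (beta (vv v)).
  rewrite mulr_sumr (bigD1 v) //= mulrA mor_orth // eqxx big1 ?addr0 // => w ne.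
  by rewrite mulrA mor_orth // eq_sym (negPf ne) mul0r.
have ur v : u * pi (beta (vv v)) = psi (vv v) * pi (beta (vv v)).
  have hpb := alg_mor_comp hpi hbeta.
  rewrite mulr_suml (bigD1 v) //= -mulrA.
  have e w := mor_orth _ _ w v hpb; rewrite /= in e.
  rewrite e eqxx big1 ?addr0 // => w ne.
  by rewrite -mulrA e (negPf ne) mulr0.
have [w Jw hw] := jac_lift hB hA hpi pis Ju.
have [t [wt tw]] := jac_unit1 hB Jw.
have piw : pi (1 + w) = u by rewrite (amD hpi) (am1 hpi) hw addrC subrK.
have ut : u * pi t = 1 by rewrite -piw -(amM hpi) wt (am1 hpi).
pose g x := (1 + w) * beta x * t.
have gM x y : g x * g y = g (x * y).
  by rewrite /g (amM hbeta) -!mulrA [t * _]mulrA tw mul1r.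
have gsum (I : finType) F : g (\sum_(i : I) F i) = \sum_i g (F i).
  by rewrite /g (am_sum hbeta) mulr_sumr mulr_suml.
have pig v : pi (g (vv v)) = psi (vv v).
  by rewrite /g !(amM hpi) piw ur -ul -mulrA ut mulr1.
have Jbarr b : jacobson (barr b : kQ) by apply/cpath_jac/barr_ge.
have Jbeta b : jacobson (beta (barr b)) by apply: (jac_mor (cpath_PAlg Q) hB hbeta).
have gJ2 b : jpow 2 (g (barr b) - beta (barr b)) by have [_] := conj_sim hB (beta (barr b)) Jw wt; apply.
have dJ2 b : jpow 2 (pi (g (barr b)) - psi (barr b)).
  apply: (idl_trans (jpow_ideal ptA 2) (y := pi (beta (barr b)))).
    by rewrite -(amB hpi); apply: (jac2_mor hB hA hpi).
  exact: hsim.2.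
have zex b : exists z, jpow 2 z /\ pi z = pi (g (barr b)) - psi (barr b).
  by have [z h1 h2] := jac2_lift hB hA hpi pis (dJ2 b); exists z.
have [z hz] := choice zex.
have hI2 := jpow_ideal ptB 2; have hJ := jac_ideal ptB.
pose eps v := g (vv v); pose m b := eps (tgt b) * (g (barr b) - z b) * eps (src b).
have eps_orth v w' : eps v * eps w' = if v == w' then eps v else 0.
  rewrite gM videm_orth; case: ifP => // _.
  by rewrite /g (am0 hbeta) mulr0 mul0r.
have [|||||b' [hb' bv bb]] := @cpath_univ_ex k Q B hB eps m.
- exact: eps_orth.
- by rewrite -gsum videm_sum /g (am1 hbeta) mulr1 wt.
- move=> b; apply: (idlMr hJ); apply: (idlMl hJ); apply: (idlB hJ).
    by apply: (idlMr hJ); apply: (idlMl hJ).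
  by apply: (jpow_leS ptB (n := 1)); have [] := hz b.
- by move=> b; rewrite /m [LHS]mulrA [X in X * _]mulrA eps_orth eqxx.
- by move=> b; rewrite /m -[LHS]mulrA eps_orth eqxx.
exists b'; split=> //.
  apply: sim1_generators => // [v|b].
    by rewrite bv; have [] := conj_sim hB (beta (vv v)) Jw wt.
  rewrite bb /m mulrBr mulrBl !gM videm_barr barr_videm addrAC; apply: (idlB hI2) => //.
  by apply: (idlMr hI2); apply: (idlMl hI2); have [] := hz b.
apply: (alg_mor_eq hA) => // [|v|b] /=; first exact: alg_mor_comp.
  by rewrite bv pig.
rewrite bb /m 2!(amM hpi) (amB hpi) /eps !pig; have [_ ->] := hz b.
by rewrite subKr -!(amM hpsi) videm_barr barr_videm.
Qed.
End Lifting.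

(** * Maps of Vquivers and path algebras *)

Section VMaps.
Variables (k : fieldType).
Implicit Types P Q R : vquiver k.

Lemma varr_None Q e f (u : arr (v := Q) e f) : e = None \/ f = None -> varr u = 0 :> cpath Q.
Proof. by case: e f u => [e|] [f|] u [] h. Qed.

Lemma alg_mor_eq_varr P (A : preTopAlgType k) (phi psi : cpath P -> A) :
  is_vquiver P -> PAlg_ob A -> alg_mor phi -> alg_mor psi ->
  (forall v, phi (videm (Some v)) = psi (videm (Some v))) ->
  (forall e f (u : arr (v := P) e f), phi (varr u) = psi (varr u)) -> phi = psi.
Proof.
move=> hP hA h1 h2 hv hu; apply: (alg_mor_eq hA) => // b.
by have [u <-] := barr_varr hP b.
Qed.

Lemma sim1_varr P (A : preTopAlgType k) (phi psi : cpath P -> A) :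
  is_vquiver P -> PAlg_ob A -> alg_mor phi -> alg_mor psi ->
  (forall v, jacobson (phi (videm (Some v)) - psi (videm (Some v)))) ->
  (forall e f (u : arr (v := P) (Some e) (Some f)), jpow 2 (phi (varr u) - psi (varr u))) ->
  sim1 phi psi.
Proof.
move=> hP hA h1 h2 hv hu; apply: (sim1_generators hA) => // b.
by have [u <-] := barr_varr hP b.
Qed.

Section OneMap.
Variables (P Q : vquiver k) (r : vmap P Q).
Hypotheses (hP : is_vquiver P) (hQ : is_vquiver Q) (hr : is_vmap r).

Let r_lin e f : linear (@vmap1 _ _ _ r e f). Proof. by case: hr. Qed.
Let r_None : vmap0 r None = None. Proof. by case: hr. Qed.
Let r_ex f : exists! v, vmap0 r (Some v) = Some f. Proof. by case: hr. Qed.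

Lemma vmap_orth v w :
  videm (vmap0 r (Some v)) * videm (vmap0 r (Some w)) =
  if v == w then videm (vmap0 r (Some v)) else 0 :> cpath Q.
Proof.
case: (eqVneq v w) => [->|ne].
  by case: (vmap0 r (Some w)) => [z|]; rewrite ?mulr0 // videm_orth eqxx.
case ev: (vmap0 r (Some v)) => [z|]; last by rewrite mul0r.
case ew: (vmap0 r (Some w)) => [z'|]; last by rewrite mulr0.
rewrite videm_orth; case: eqP => // e; case/eqP: ne.
by have [x [_ hx]] := r_ex z; rewrite -(hx v) // -(hx w) // ew e.
Qed.

Lemma vmap_sum : \sum_v videm (vmap0 r (Some v)) = 1 :> cpath Q.
Proof.
apply/funext => p; rewrite cpathE_sum cpathE1; have [v [ev hv]] := r_ex (val p).1.
rewrite (bigD1 v) //= ev big1 ?addr0 => [|w ne].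
  by case: p {ev hv} => -[e [|c s]] hp /=; rewrite xpair_eqE eqxx.
case ew: (vmap0 r (Some w)) => [z|] //=; case: eqP => // ep; case/eqP: ne.
by apply/esym/hv; rewrite ew -[z]/((z, [::] : seq (vtx Q * nat)).1) -ep.
Qed.

Lemma cpath_map_induces : induces r (cpath_map r).
Proof.
rewrite /cpath_map /some_such; case: pselect => [h|[]]; first exact: projT2 (cid h).
have [u [hu ubasis]] := arr_basis hP.
have [|||||h [hh hv hb]] := @cpath_univ_ex k P (cpath Q) (cpath_PAlg Q)
   (fun v => videm (vmap0 r (Some v))) (fun b => varr (vmap1 r (u b))).
- exact: vmap_orth.
- exact: vmap_sum.
- by move=> b; apply/cpath_jac/varr_ge.
- by move=> b; rewrite -[in LHS](varr_videm (vmap1 r (u b))) !mulrA vmap_orth eqxx varr_videm.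
- by move=> b; rewrite -[in LHS](varr_videm (vmap1 r (u b))) -!mulrA vmap_orth eqxx mulrA varr_videm.
exists h; split=> // [[v|]|e f x].
- exact: hv.
- by rewrite r_None; exact: am0 hh.
case: e f x => [e|] [f|] x; last first.
- by rewrite !varr_None ?(am0 hh) //; [left|left].
- by rewrite !varr_None ?(am0 hh) //; [left|left].
- by rewrite !varr_None ?(am0 hh) //; [right|right].
have hu' i : varr (u (mkarr i) : arr (v := P) (Some e) (Some f)) = barr (mkarr i) := hu (mkarr i).
have hb' i : h (barr (mkarr i)) = varr (vmap1 r (u (mkarr i) : arr (v := P) (Some e) (Some f)))
  := hb (mkarr i).
rewrite (ubasis e f x).
have rB : zmod_morphism (@vmap1 _ _ _ r (Some e) (Some f)).
  by move=> y z; rewrite addrC -scaleN1r r_lin scaleN1r addrC.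
have rZ a y : @vmap1 _ _ _ r (Some e) (Some f) (a *: y) = a *: vmap1 r y.
  by rewrite -[a *: y]addr0 r_lin (zm0 rB) addr0.
rewrite (zm_sum rB) !(zm_sum (@varr_zmod _ _ _ _ _)) // (am_sum hh); apply: eq_bigr => i _.
by rewrite rZ !varrZ // (am_scalM hh) hu' hb'.
Qed.

Lemma cpath_map_alg : alg_mor (cpath_map r).
Proof. by case: cpath_map_induces. Qed.
Lemma cpath_map_videm e : cpath_map r (videm e) = videm (vmap0 r e).
Proof. by case: cpath_map_induces. Qed.
Lemma cpath_map_varr e f (x : arr (v := P) e f) : cpath_map r (varr x) = varr (vmap1 r x).
Proof. by case: cpath_map_induces. Qed.

Lemma cpath_map_surj : vmap_surj r -> forall y, exists x, cpath_map r x = y.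
Proof.
move=> rs y.
have onto e f (u : arr (v := Q) e f) : exists2 x, cpath_ge 1 x & cpath_map r x = varr u.
  case: e f u => [e|] [f|] u; try by exists 0 => //; exact: am0 cpath_map_alg.
  have [v [ev _]] := r_ex e; have [w [ew _]] := r_ex f.
  move: u; rewrite -ev -ew => u; have [x hx] := rs _ _ u.
  by exists (varr x); [exact: varr_ge|rewrite cpath_map_varr hx].
have idem w : exists v, cpath_map r (videm (Some v)) = videm (Some w).
  by have [v [ev _]] := r_ex w; exists v; rewrite cpath_map_videm ev.
have [|||x _ <-] := @generated_surj k P (cpath Q) (cpath_PAlg Q) _ cpath_map_alg _ _ 0%N y.
- move=> a; have [v hv] := choice idem.
  exists (\sum_w scal (a (qtriv w)) * videm (Some (v w))).
  rewrite {1}[a]cpath_expand (am_sum cpath_map_alg).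
  rewrite [X in _ - X](eq_bigr (fun w => scal (a (qtriv w)) * videm (Some w))) => [|w _].
    rewrite addrC addKr; apply/cpath_jac/(idl_sum (cpath_ge_ideal _ _)) => b _.
    exact: idlMl (cpath_ge_ideal _ _) _ _ (barr_ge b).
  by rewrite (am_scalM cpath_map_alg) hv.
- move=> a /cpath_jac ha.
  have [u hu] : exists u : forall v w, arr (v := Q) (Some v) (Some w),
      forall v w, cpath_ge 2 (videm (Some w) * a * videm (Some v) - varr (u v w)).
    exists (fun v w => projT1 (cid (arrow_part hQ (Some v) (Some w) ha))) => v w.
    exact: projT2 (cid (arrow_part hQ (Some v) (Some w) ha)).
  have [x hx] : exists x : vtx Q -> vtx Q -> cpath P,
      forall v w, cpath_ge 1 (x v w) /\ cpath_map r (x v w) = varr (u v w).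
    exists (fun v w => projT1 (cid2 (onto _ _ (u v w)))) => v w.
    by case: cid2.
  exists (\sum_v \sum_w x v w).
    by apply: (idl_sum (cpath_ge_ideal _ _)) => v _; apply: (idl_sum (cpath_ge_ideal _ _)) => w _; case: (hx v w).
  apply/cpath_jac2; rewrite {1}[a]videm_decomp (am_sum cpath_map_alg) -sumrB.
  apply: (idl_sum (cpath_ge_ideal _ _)) => v _; rewrite (am_sum cpath_map_alg) -sumrB.
  by apply: (idl_sum (cpath_ge_ideal _ _)) => w _; have [_ ->] := hx v w.
- by [].
by exists x.
Qed.
End OneMap.

Lemma is_vmap_id Q : is_vmap (vmap_id Q).
Proof. by split=> // f; exists f; split=> // v []. Qed.

Lemma cpath_map_id Q : is_vquiver Q -> cpath_map (vmap_id Q) = id.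
Proof.
move=> hQ; have hid := is_vmap_id Q; apply: (alg_mor_eq_varr hQ (cpath_PAlg Q)).
- exact: cpath_map_alg.
- exact: alg_mor_id.
- by move=> v; rewrite cpath_map_videm.
- by move=> e f u; rewrite cpath_map_varr.
Qed.

Lemma is_vmap_comp P Q R (s : vmap Q R) (r : vmap P Q) :
  is_vmap s -> is_vmap r -> is_vmap (vmap_comp s r).
Proof.
move=> [s0 sx sl] [r0 rx rl]; split=> [|f|e f a x y] /=; first by rewrite r0 s0.
  have [w [ew hw]] := sx f; have [v [ev hv]] := rx w.
  exists v; split=> [|v']; first by rewrite /= ev.
  case e: (vmap0 r (Some v')) => [w'|]; last by rewrite /= ?e s0.
  by rewrite /= ?e => /hw e'; apply: hv; rewrite e e'.
by rewrite rl sl.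
Qed.

Lemma cpath_map_comp P Q R (s : vmap Q R) (r : vmap P Q) :
  is_vquiver P -> is_vquiver Q -> is_vquiver R -> is_vmap s -> is_vmap r ->
  cpath_map (vmap_comp s r) = cpath_map s \o cpath_map r.
Proof.
move=> hP hQ hR hs hr; have hc := is_vmap_comp hs hr.
apply: (alg_mor_eq_varr hP (cpath_PAlg R)) => [|||e f u] //=.
- exact: cpath_map_alg.
- by apply: alg_mor_comp; exact: cpath_map_alg.
- by move=> v; rewrite !cpath_map_videm.
- by rewrite !cpath_map_varr.
Qed.

Lemma vmap_ext P Q (r s : vmap P Q) : is_vquiver Q ->
  (forall e, vmap0 r e = vmap0 s e) ->
  (forall e f (u : arr (v := P) e f), varr (vmap1 r u) = varr (vmap1 s u)) -> r = s.
Proof.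
move=> hQ; case: r s => r0 r1 [s0 s1] /= /funext e; subst s0 => h; congr VMap.
apply: functional_extensionality_dep => e; apply: functional_extensionality_dep => f.
by apply/funext => u; apply: (varr_inj hQ).
Qed.

End VMaps.

(** * Presentations *)

Section Presentations.
Variable k : fieldType.
Implicit Types P Q : vquiver k.

(** [phi] identifies [A] with the quotient of a path algebra by a relation ideal. *)
Definition presentation Q (A : preTopAlgType k) (phi : cpath Q -> A) : Prop :=
  [/\ alg_mor phi, forall a, exists x, phi x = a & forall x, phi x = 0 -> cpath_ge 2 x].

Section OnePresentation.
Variables (Q : vquiver k) (A : preTopAlgType k) (phi : cpath Q -> A).
Hypotheses (hQ : is_vquiver Q) (hA : PAlg_ob A) (hphi : presentation phi).

Let mphi : alg_mor phi. Proof. by case: hphi. Qed.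
Let sphi a : exists x, phi x = a. Proof. by case: hphi. Qed.
Let ptA : pointed_algebra A. Proof. by case: hA. Qed.

Lemma pres_jac x : jacobson (phi x) -> cpath_ge 1 x.
Proof.
move=> /(jac_lift (cpath_PAlg Q) hA mphi sphi) [y /cpath_jac Jy e].
have hxy : cpath_ge 2 (x - y) by case: hphi => _ _; apply; rewrite (amB mphi) e subrr.
exact: (idl_sub (cpath_ge_ideal Q 1) (cpath_ge_le (isT : 1 <= 2)%N hxy) Jy).
Qed.

Lemma pres_jac2 x : jpow 2 (phi x) -> cpath_ge 2 x.
Proof.
move=> /(jac2_lift (cpath_PAlg Q) hA mphi sphi) [y /cpath_jac2 Jy e].
have hxy : cpath_ge 2 (x - y) by case: hphi => _ _; apply; rewrite (amB mphi) e subrr.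
exact: (idl_sub (cpath_ge_ideal Q 2) hxy Jy).
Qed.

Lemma videm_ge_inj (e f : option (vtx Q)) : cpath_ge 1 (videm e - videm f : cpath Q) -> e = f.
Proof.
move=> /videm_ge1 h; case: e f h => [e|] [f|] // h.
- have := h e; rewrite cpathEB /videm /= eqxx xpair_eqE eqxx andbT.
  by case: eqP => [->//|_] /eqP; rewrite subr0 oner_eq0.
- by have /eqP := h e; rewrite cpathEB /videm /= eqxx subr0 oner_eq0.
- by have /eqP := h f; rewrite cpathEB /videm /= eqxx sub0r oppr_eq0 oner_eq0.
Qed.

Lemma varr_ge_eq e f e' f' (u : arr (v := Q) e f) (u' : arr (v := Q) e' f') :
  cpath_ge 2 (varr u - varr u') -> varr u = varr u'.
Proof.
move=> h; apply/funext => p; apply/eqP; rewrite -subr_eq0; apply/eqP.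
case: (ltnP (qsize p) 2) => [/h //|hp].
have z a b (v : arr (v := Q) a b) : varr v p = 0.
  by case: a b v => [a|] [b|] v //; case: p hp => -[e0 [|[f0 i0] [|c s]]] hp.
by rewrite !z subrr.
Qed.

(** A presentation is injective modulo [J^2], where distinct vertices and arrows
    are still distinct.  This turns every equation between maps of Vquivers into
    one between classes of morphisms. *)
Lemma vmap_faithful P (r s : vmap P Q) : is_vquiver P -> is_vmap r -> is_vmap s ->
  sim1 (phi \o cpath_map r) (phi \o cpath_map s) -> r = s.
Proof.
move=> hP hr hs [h1 h2]; apply: (vmap_ext hQ) => [e|e f u].
  apply: videm_ge_inj; apply: pres_jac; rewrite (amB mphi).
  by have := h1 (videm e); rewrite /= !cpath_map_videm.
apply: varr_ge_eq; apply: pres_jac2; rewrite (amB mphi).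
have := h2 (varr u); rewrite /= !cpath_map_varr //; apply; apply/cpath_jac/varr_ge.
Qed.

Section Existence.
Variables (P : vquiver k) (alpha : cpath P -> A).
Hypotheses (hP : is_vquiver P) (malpha : alg_mor alpha).
Hypothesis (salpha : forall a, exists x, alpha x = a).

Let hJ := jac_ideal ptA.
Let hJ2 := jpow_ideal ptA 2.
Let Jalpha e f (u : arr (v := P) e f) : jacobson (alpha (varr u)).
Proof. by apply: (jac_mor (cpath_PAlg P) hA malpha); apply/cpath_jac/varr_ge. Qed.
Let Jphi e f (u : arr (v := Q) e f) : jacobson (phi (varr u)).
Proof. by apply: (jac_mor (cpath_PAlg Q) hA mphi); apply/cpath_jac/varr_ge. Qed.
Let sphiJ a : jacobson a -> exists2 x, cpath_ge 1 x & phi x = a.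
Proof. by move=> /(jac_lift (cpath_PAlg Q) hA mphi sphi) [x /cpath_jac ? ?]; exists x. Qed.

(** Modulo the radical, [alpha] is a surjection from [k^(vtx P)] onto
    [k^(vtx Q)]: each vertex idempotent of [P] goes to one of [Q] or to [0]. *)
Lemma vmap0_ex : exists r0 : option (vtx P) -> option (vtx Q),
  [/\ r0 None = None, forall f, exists! v, r0 (Some v) = Some f &
      forall e, jacobson (alpha (videm e) - phi (videm (r0 e)))].
Proof.
have [h hh] := choice (fun v => sphi (alpha (videm (Some v)))).
pose c v w := h v (qtriv w).
have [chm _ _] := @cpath_chars k Q.
have hE x y : phi x = phi y -> forall w, x (qtriv w) = y (qtriv w).
  move=> e w; have hxy : cpath_ge 1 (x - y).
    by apply: pres_jac; rewrite (amB mphi) e subrr; exact: idl0 hJ.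
  by have := hxy (qtriv w) (ltnSn _); rewrite cpathEB => /eqP; rewrite subr_eq0 => /eqP.
have cM v v' w : c v w * c v' w = if v == v' then c v w else 0.
  have [_ [_ M]] := chm w; rewrite -M.
  rewrite (hE _ (if v == v' then h v else 0)); first by case: ifP.
  rewrite (amM mphi) !hh -(amM malpha) videm_orth; case: ifP; rewrite ?hh //.
  by rewrite (am0 malpha) (am0 mphi).
have c1 w : \sum_v c v w = 1.
  have := hE (\sum_v h v) 1; rewrite (am_sum mphi) (am1 mphi) (eq_bigr _ (fun v _ => hh v)).
  by rewrite -(am_sum malpha) videm_sum (am1 malpha) => /(_ erefl w); rewrite cpathE_sum.
have c01 v w : c v w != 0 -> c v w = 1.
  by move=> nz; apply: (mulfI nz); rewrite cM eqxx mulr1.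
have cinj v w w' : c v w = 1 -> c v w' = 1 -> w = w'.
  move=> e e'; apply: contrapT => ne; have [x hx] := salpha (phi (videm (Some w))).
  have hx' : jacobson (phi (videm (Some w) * h v - scal (x (qtriv v)) * h v)).
    rewrite (amB mphi) (am_scalM mphi) (amM mphi) hh -hx -(amM malpha) -(am_scalM malpha) -(amB malpha).
    apply: (jac_mor (cpath_PAlg P) hA malpha); apply/cpath_jac/videm_ge1 => z.
    rewrite cpathEB cpathEZ videm_mulr /videm /= xpair_eqE andbT; case: eqP => [->|_].
      by rewrite mulr1 subrr.
    by rewrite mulr0 subrr.
  have hz z : (z == w)%:R * c v z - x (qtriv v) * c v z = 0.
    have [_ [_ M]] := chm z; have := pres_jac hx' (p := qtriv z) (ltnSn _).
    by rewrite cpathEB cpathEZ M /videm /= xpair_eqE andbT.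
  have /eqP := hz w; rewrite eqxx e !mulr1 subr_eq0 => /eqP xv.
  by have /eqP := hz w'; rewrite e' -xv !mulr1; case: (w' =P w) => [/esym//|_];
    rewrite sub0r oppr_eq0 oner_eq0.
pose r0 (e : option (vtx P)) : option (vtx Q) := if e is Some v then [pick w | c v w == 1] else None.
have r0P v w : r0 (Some v) = Some w <-> c v w = 1.
  rewrite /r0; case: pickP => [w' /eqP hw'|none]; split=> //.
  - by case=> <-.
  - by move=> hw; rewrite (cinj v w' w).
  - by move=> /eqP; rewrite none.
exists r0; split=> // [w|[v|]].
- have [v nz] : exists v, c v w != 0.
    apply: contrapT => none; have := c1 w; rewrite big1 => [/esym/eqP|v _]; first by rewrite oner_eq0.
    by apply/eqP/negPn/negP => nz; apply: none; exists v.
  exists v; split=> [|v' /r0P e']; first by apply/r0P/c01.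
  have := cM v v' w; rewrite (c01 _ _ nz) e' mulr1; case: eqP => // _ /eqP.
  by rewrite oner_eq0.
- rewrite -hh -(amB mphi); apply: (jac_mor (cpath_PAlg Q) hA mphi); apply/cpath_jac/videm_ge1 => w.
  rewrite cpathEB -/(c v w); case er: (r0 (Some v)) => [w'|].
    move/r0P: er => hw'; rewrite /videm /= xpair_eqE andbT; case: eqP => [->|ne].
      by rewrite hw' subrr.
    by rewrite subr0; apply/eqP/negPn/negP => /c01 hw; apply: ne; exact: cinj hw hw'.
  rewrite subr0; apply/eqP/negPn/negP => /c01 /r0P; by rewrite er.
- by rewrite (am0 malpha) (am0 mphi) subrr; exact: idl0 hJ.
Qed.

(** On arrows, [r] compares the corners of [J / J^2] cut out by the images of the
    vertices: [alpha u] lies in such a corner, which [phi] identifies with the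
    arrow space of the corresponding vertices of [Q]. *)
Lemma vmap_exists : exists r : vmap P Q,
  [/\ is_vmap r, vmap_surj r & sim1 (phi \o cpath_map r) alpha].
Proof.
have [r0 [r0N r0E r0J]] := vmap0_ex.
have corner e f a b : jacobson a -> jacobson b -> jpow 2 (a - b) ->
    jpow 2 (alpha (videm f) * a * alpha (videm e) - phi (videm (r0 f)) * b * phi (videm (r0 e))).
  move=> Ja Jb hab; rewrite mulrB_split; apply: (idlD hJ2).
    apply: (idlMr hJ2); rewrite mulrB_split; apply: (idlD hJ2); last exact: (idlMl hJ2).
    by apply: mul_setM => //; exact: r0J.
  by apply: mul_setM; [exact: (idlMl hJ)|exact: r0J].
have alphaE e f (u : arr (v := P) e f) : alpha (varr u) = alpha (videm f) * alpha (varr u) * alpha (videm e).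
  by rewrite -!(amM malpha) varr_videm.
have phiE e f (u : arr (v := Q) e f) : phi (varr u) = phi (videm f) * phi (varr u) * phi (videm e).
  by rewrite -!(amM mphi) varr_videm.
pose ok e f (u : arr (v := P) e f) (y : arr (v := Q) (r0 e) (r0 f)) :=
  jpow 2 (alpha (varr u) - phi (varr y)).
pose r1 e f (u : arr (v := P) e f) := some_such 0 (ok e f u).
have okP e f u : ok e f u (r1 e f u).
  rewrite /r1 /some_such; case: pselect => [h|[]]; first exact: projT2 (cid h).
  have [h Nh eh] := sphiJ (Jalpha u); have [y hy] := arrow_part hQ (r0 e) (r0 f) Nh.
  exists y; rewrite /ok alphaE.
  apply: (idl_trans hJ2 (y := phi (videm (r0 f)) * phi h * phi (videm (r0 e)))).
    by apply: corner; rewrite ?eh ?subrr //; exact: idl0 hJ2.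
  rewrite -!(amM mphi) -(amB mphi).
  by apply: (jac2_mor (cpath_PAlg Q) hA mphi); apply/cpath_jac2.
have okU e f u y y' : ok e f u y -> ok e f u y' -> y = y'.
  move=> h h'; apply: (varr_inj hQ); apply: varr_ge_eq; apply: pres_jac2.
  rewrite (amB mphi); apply: (idl_trans hJ2 (y := alpha (varr u))) => //.
  exact: (idl_sym hJ2).
have hr : is_vmap (VMap r1).
  split=> // e f a x y /=; apply: okU (okP _ _ _) _; rewrite /ok !varr_lin //.
  rewrite (amD malpha) (amD mphi) (am_scalM malpha) (am_scalM mphi).
  apply: (idl_addB hJ2); last exact: okP.
  by rewrite -mulrBr; apply: (idlMl hJ2); exact: okP.
exists (VMap r1); split=> //.
- move=> e f y /=; have [x Jx ex] := jac_lift (cpath_PAlg P) hA malpha salpha (Jphi y).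
  have [u hu] := arrow_part hP e f (proj1 (cpath_jac x) Jx).
  exists u; apply: okU (okP _ _ _) _; rewrite /ok phiE.
  apply: (idl_trans hJ2 (y := alpha (videm f) * alpha x * alpha (videm e))).
    rewrite -!(amM malpha) -(amB malpha); apply: (jac2_mor (cpath_PAlg P) hA malpha).
    by apply/cpath_jac2; exact: idl_sym (cpath_ge_ideal P 2) _ _ hu.
  by apply: corner; rewrite ?ex ?subrr //; exact: idl0 hJ2.
- apply: (sim1_varr hP hA) => // [|v|e f u].
  + by apply: alg_mor_comp => //; exact: cpath_map_alg.
  + rewrite -[(phi \o _) _]/(phi (cpath_map (VMap r1) (videm (Some v)))) cpath_map_videm //.
    exact: (idl_sym hJ).
  + rewrite -[(phi \o _) _]/(phi (cpath_map (VMap r1) (varr u))) cpath_map_varr //.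
    by apply: (idl_sym hJ2); exact: okP.
Qed.
End Existence.
End OnePresentation.
End Presentations.

(** * Unipotent automorphisms and classes of relation ideals *)

Section Unipotent.
Variables (k : fieldType) (Q : vquiver k).
Local Notation kQ := (cpath Q).
Local Notation N := (@cpath_ge k Q).
Implicit Types (I : ideal kQ).

Definition unipotent (d : kQ -> kQ) : Prop := PAlg_mor d /\ sim1 d id.

Lemma alg_sim1_unipotent d : alg_mor d -> sim1 d id -> unipotent d.
Proof.
move=> hd ds; split=> //; apply: (sim1_PAlg_mor (cpath_PAlg Q) _ hd (sim1_sym (cpath_PAlg Q) ds)).
by have [] := surj_SPAlg_mor (cpath_PAlg Q) (alg_mor_id kQ) (fun b => ex_intro _ b erefl).
Qed.

Lemma unipotent_id : unipotent id.
Proof. by apply: alg_sim1_unipotent; [exact: alg_mor_id|exact: sim1_refl (cpath_PAlg Q)]. Qed.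

Lemma unipotent_comp d d' : unipotent d -> unipotent d' -> unipotent (d \o d').
Proof.
move=> [[hd _] ds] [[hd' _] ds']; apply: alg_sim1_unipotent; first exact: alg_mor_comp.
have hQ := cpath_PAlg Q.
exact: (sim1_comp hQ hQ hQ (alg_mor_id kQ) hd ds' ds).
Qed.

(** Surjectivity can be checked modulo [J] and [J^2]; an inverse on the right is
    then a lift of the identity, and has one itself. *)
Lemma unipotent_surj d : unipotent d -> forall y, exists x, d x = y.
Proof.
move=> [[hd _] [ds1 ds2]] y; have hQ := cpath_PAlg Q.
have [|||x _ <-] := @generated_surj _ _ _ hQ d hd _ _ 0%N y; last by exists x.
- by move=> a; exists a; exact: idl_sym (jac_ideal (cpath_pointed Q)) _ _ (ds1 a).
- move=> a Ja; exists a; first exact/cpath_jac.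
  exact: idl_sym (jpow_ideal (cpath_pointed Q) 2) _ _ (ds2 a Ja).
- by [].
Qed.

Lemma unipotent_inv d : unipotent d -> exists d', [/\ unipotent d', cancel d d' & cancel d' d].
Proof.
have hQ := cpath_PAlg Q; have hid := alg_mor_id kQ.
have rinv e : unipotent e -> exists2 e', unipotent e' & e \o e' = id.
  move=> ue; have [[he _] es] := ue.
  have [e' [he' es' ee']] := cpath_lift hQ hQ he (unipotent_surj ue) hid hid es.
  by exists e' => //; apply: alg_sim1_unipotent.
move=> ud; have [d' ud' dd'] := rinv d ud; have [d'' ud'' dd''] := rinv d' ud'.
have K' : cancel d' d by move=> x; rewrite -[RHS]/(id x) -dd'.
exists d'; split=> // x.
have e y : d'' y = d y by rewrite -[in RHS](congr1 (fun f => f y) dd'') /= K'.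
by rewrite -e -[LHS]/((d' \o d'') x) dd''.
Qed.

Lemma image_ideal d I : unipotent d ->
  exists I' : ideal kQ, ideal_set I' = d @` ideal_set I.
Proof.
move=> ud; have [[hd _] _] := ud; have hI := idealP I.
suff h : ideal_closed (d @` ideal_set I) by exists (Ideal h).
split.
- by exists 0; [exact: idl0 hI|exact: am0 hd].
- by move=> _ _ [x Ix <-] [y Iy <-]; exists (x - y); [exact: idlB hI _ _ Ix Iy|exact: amB hd x y].
- move=> a _ [x Ix <-]; have [b <-] := unipotent_surj ud a.
  by exists (b * x); [exact: idlMl hI _ _ Ix|exact: amM hd b x].
- move=> _ a [x Ix <-]; have [b <-] := unipotent_surj ud a.
  by exists (x * b); [exact: idlMr hI _ _ Ix|exact: amM hd x b].
Qed.

Lemma ideal_class_self I : ideal_class I I.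
Proof. by exists id; [exact: unipotent_id|rewrite image_id]. Qed.

Lemma ideal_class_move I0 I d : ideal_class I0 I -> unipotent d ->
  exists2 I', ideal_class I0 I' & ideal_set I' = d @` ideal_set I.
Proof.
move=> [d0 ud0 e0] ud; have [I' e'] := image_ideal I ud; exists I' => //.
by exists (d \o d0); [exact: unipotent_comp|rewrite e' e0 image_comp].
Qed.

Lemma ideal_class_link I0 I I' : ideal_class I0 I -> ideal_class I0 I' ->
  exists d d', [/\ unipotent d, unipotent d', cancel d d', cancel d' d &
    ideal_set I' = d @` ideal_set I].
Proof.
move=> [d0 ud0 e0] [d1 ud1 e1]; have [d0' [ud0' K0 K0']] := unipotent_inv ud0.
have ud := unipotent_comp ud1 ud0'; have [d' [ud' K K']] := unipotent_inv ud.
exists (d1 \o d0'), d'; split=> //; rewrite e1 e0 image_comp; congr image.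
by apply/funext => x /=; rewrite K0.
Qed.

Lemma relation_ideal_ge2 I : relation_ideal I -> forall x, ideal_set I x -> N 2 x.
Proof. by move=> [_ h] x /h /cpath_jac2. Qed.

Lemma ideal_class_relation I0 I : relation_ideal I0 -> ideal_class I0 I -> relation_ideal I.
Proof.
move=> [cl sub] [d ud e]; have [[hd _] _] := ud; have [d' [[[hd' _] _] K K']] := unipotent_inv ud.
split; last first.
  by move=> y; rewrite e => -[x /sub hx <-]; exact: (jac2_mor (cpath_PAlg Q) (cpath_PAlg Q) hd).
have stable n x : N n x -> N n (d' x).
  elim: n x => [|n IH] x hx //; rewrite (alg_mor_expand1 hd'); last exact: cpath_ge_le hx.
  apply: (idl_sum (cpath_ge_ideal Q _)) => b _; rewrite -[n.+1]addn1; apply: cpath_geM.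
    by apply: IH; exact: strip_ge.
  by apply/cpath_jac; exact: (alg_mor_barrJ (cpath_PAlg Q) hd').
apply/cpath_closed => x h; rewrite e; exists (d' x) => //.
move/cpath_closed: cl; apply => n; have [y] := h n; rewrite e => -[z Iz <-] hy.
by exists z => //; rewrite -[z]K -(amB hd'); exact: stable.
Qed.
End Unipotent.

(** * Quotients of path algebras *)

Section Quotient.
Variables (k : fieldType) (A : preTopAlgType k) (I : ideal A).
Local Notation proj := (\pi_(aquot I)).

Lemma aquot_eqP (x y : A) : proj x = proj y <-> ideal_set I (x - y).
Proof.
rewrite (rwP eqP) -Quotient.idealrBE; split=> [/asboolP //|h]; exact/asboolP.
Qed.

Lemma aquot_surj (z : aquot I) : exists x : A, proj x = z.
Proof. by exists (repr z); rewrite reprK. Qed.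

Lemma aquot_piM (x y : A) : proj (x * y) = proj x * proj y.
Proof. by rewrite -[RHS]/(aquot_mul _ _) !piE. Qed.

Lemma alg_mor_pi : alg_mor (proj : A -> aquot I).
Proof.
split=> [x y|||]; first by rewrite !piE.
- by split=> [|x y]; [rewrite !piE|exact: aquot_piM].
- by [].
- by apply/continuousP => U oU; exact: oU.
Qed.

Lemma aquot_factor (B : preTopAlgType k) (f : A -> B) : alg_mor f ->
  (forall x, ideal_set I x -> f x = 0) ->
  exists g : aquot I -> B, alg_mor g /\ forall x, g (proj x) = f x.
Proof.
move=> hf fI; pose g (z : aquot I) := f (repr z).
have gE x : g (proj x) = f x.
  apply/eqP; rewrite -subr_eq0 -(amB hf); apply/eqP/fI.
  by apply/aquot_eqP; rewrite reprK.
exists g; split=> //; split.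
- move=> z w; rewrite -[z]reprK -[w]reprK.
  by rewrite -[proj _ - proj _](amB alg_mor_pi) !gE (amB hf).
- split=> [|z w]; first by rewrite -(am1 alg_mor_pi) gE (am1 hf).
  by rewrite -[z]reprK -[w]reprK -aquot_piM !gE (amM hf).
- by move=> a; rewrite -(am_scal alg_mor_pi) gE (am_scal hf).
- apply/continuousP => U oU; rewrite -[open _]/(open (proj @^-1` (g @^-1` U))).
  have -> : proj @^-1` (g @^-1` U) = f @^-1` U.
    by apply/funext => x /=; rewrite gE.
  by have /continuousP := am_cont hf; apply.
Qed.

Lemma aquot_fcodim (S : set A) : finite_codim S -> lin_subspace S ->
  (forall x, ideal_set I x -> S x) -> finite_codim (proj @` S).
Proof.
move=> [n [f [fl fs fk]]] hS IS.
have fB : zmod_morphism f by move=> x y; rewrite addrC -scaleN1r fl scaleN1r addrC.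
pose g (z : lmod_of (aquot I)) := f (repr (z : aquot I)).
have gE x : g (proj x) = f x.
  apply/eqP; rewrite -subr_eq0 -fB; apply/eqP/fk/IS.
  by apply/aquot_eqP; rewrite reprK.
exists n, g; split.
- move=> a z w; have [x hx] := aquot_surj z; have [y hy] := aquot_surj w.
  rewrite -hx -hy !gE -fl -gE; congr g.
  by rewrite -[LHS]/(scal a * proj x + proj y) -(am_scalM alg_mor_pi) -(amD alg_mor_pi).
- by move=> v; have [x hx] := fs v; exists (proj x); rewrite gE.
- move=> z; have [x <-] := aquot_surj z; rewrite gE -fk; split=> [[y Sy /aquot_eqP h]|]; last by exists x.
  rewrite -(subKr y x); case: (hS) => _ SB _; apply: SB => //; exact: IS.
Qed.
End Quotient.

Section CpathQuotient.
Variables (k : fieldType) (Q : vquiver k) (I : ideal (cpath Q)).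
Local Notation kQ := (cpath Q).
Local Notation N := (@cpath_ge k Q).
Local Notation proj := (\pi_(aquot I)).
Hypothesis rI : relation_ideal I.

Let hpi := alg_mor_pi I.
Let hN n := cpath_ge_ideal Q n.

Definition aquot_ge n : set (aquot I) := [set z | exists2 h, N n h & proj h = z].

Lemma aquot_ge_ideal n : ideal_closed (aquot_ge n).
Proof.
split.
- by exists 0; [exact: idl0 (hN n)|exact: am0 hpi].
- by move=> _ _ [x Nx <-] [y Ny <-]; exists (x - y); [exact: idlB (hN n) _ _ Nx Ny|exact: amB hpi x y].
- move=> a _ [x Nx <-]; have [b <-] := aquot_surj a.
  by exists (b * x); [exact: idlMl (hN n) _ _ Nx|exact: amM hpi b x].
- move=> _ a [x Nx <-]; have [b <-] := aquot_surj a.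
  by exists (x * b); [exact: idlMr (hN n) _ _ Nx|exact: amM hpi x b].
Qed.

Lemma aquot_nbhs (z : aquot I) U :
  nbhs z U <-> exists n, forall z', aquot_ge n (z' - z) -> U z'.
Proof.
split=> [|[n hU]].
  rewrite nbhsE => -[O [oO Oz] OU]; have [x hx] := aquot_surj z.
  have : nbhs x (proj @^-1` O).
    by apply: open_nbhs_nbhs; split; [exact: oO|rewrite /= hx].
  move=> /cpath_nbhs [n hn]; exists n => z' [h Nh eh]; apply: OU.
  have -> : z' = proj (x + h) by rewrite (amD hpi) hx eh addrC subrK.
  by apply: hn; rewrite addrAC subrr add0r.
rewrite nbhsE; exists [set z' | aquot_ge n (z' - z)]; last by move=> z'; exact: hU.
split; last by rewrite /= subrr; exact: idl0 (aquot_ge_ideal n).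
rewrite -[open _]/(open (proj @^-1` [set z' | aquot_ge n (z' - z)])) openE => x /= hx.
apply/cpath_nbhs; exists n => y hy /=.
apply: (idl_trans (aquot_ge_ideal n)) hx; exists (y - x) => //; exact: amB hpi y x.
Qed.

Lemma aquot_ge_fcodim n : finite_codim (aquot_ge n).
Proof.
pose S := [set x : kQ | aquot_ge n (proj x)].
have hS : lin_subspace S.
  split=> [|x y hx hy|a x hx]; rewrite /S /= ?(am0 hpi) ?(amB hpi) ?(amM hpi).
  - exact: idl0 (aquot_ge_ideal n).
  - exact: idlB (aquot_ge_ideal n) _ _ hx hy.
  - exact: idlMl (aquot_ge_ideal n) _ _ hx.
have -> : aquot_ge n = proj @` S.
  apply/seteqP; split=> [z hz|_ [x hx <-]] //; have [x ex] := aquot_surj z.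
  by exists x => //; rewrite /S /= ex.
apply: aquot_fcodim => //.
  by apply: (finite_codimS (cpath_fcodim Q n)) => // x Nx; exists x.
move=> x Ix; exists 0; first exact: idl0 (hN n).
by apply/aquot_eqP; rewrite sub0r; exact: idlN (idealP I) _ Ix.
Qed.

Lemma aquot_ge_le m n : (m <= n)%N -> aquot_ge n `<=` aquot_ge m.
Proof. by move=> mn z [x hx <-]; exists x => //; exact: cpath_ge_le hx. Qed.

Lemma aquot_pseudocompact : pseudocompact (aquot I).
Proof.
have hJ n := aquot_ge_ideal n.
apply: (@basis_pseudocompact _ _ (range aquot_ge)).
- by move=> _ [n _ <-]; split; [exact: hJ|exact: aquot_ge_fcodim].
- move=> z U; rewrite aquot_nbhs; split=> [[n h]|[_ [n _ <-] h]]; last by exists n.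
  by exists (aquot_ge n) => //; exists n.
- apply/seteqP; split=> [z hz|_ -> _ [n _ <-]]; last exact: idl0 (hJ n).
  have [x ex] := aquot_surj z; rewrite -ex; apply/eqP; rewrite -(am0 hpi); apply/eqP/aquot_eqP.
  rewrite subr0; have [/cpath_closed cI _] := rI; apply: cI => n.
  have [|h Nh eh] := hz (aquot_ge n); first by exists n.
  exists (x - h); last by rewrite subKr.
  by apply/aquot_eqP; rewrite eh ex.
- move=> u uc; pose v n := u (aquot_ge n).
  have vc m n : (n <= m)%N -> aquot_ge n (v m - v n).
    move=> nm; apply: uc; [by exists m|by exists n|exact: aquot_ge_le].
  pose S n := [set h | aquot_ge n (proj h - v n)].
  have [||h hh] := @linear_compactness k Q (range S).
  + by exists (S 0%N); exists 0%N.
  + split=> [_ _ [m _ <-] [n _ <-]|_ [n _ <-]].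
      have sS a b : (a <= b)%N -> S b `<=` S a.
        move=> ab x hx; apply: (idl_trans (hJ a)) (vc _ _ ab); exact: aquot_ge_le hx.
      exists (S (maxn m n)); first by exists (maxn m n).
      by move=> x hx; split; apply: sS hx; rewrite ?leq_maxl ?leq_maxr.
    split; last by have [x ex] := aquot_surj (v n); exists x; rewrite /S /= ex subrr; exact: idl0 (hJ n).
    move=> x y z c hx hy hz; rewrite /S /= (amD hpi) (am_scalM hpi) (amB hpi) addrAC.
    apply: (idlD (hJ n)) => //; apply: (idlMl (hJ n)); rewrite -(subrBB (v n)).
    exact: (idlB (hJ n)).
  exists (proj h) => _ [n _ <-]; have [|y hy Ny] := hh (S n) _ n; first by exists n.
  by apply: (idl_trans (hJ n) (y := proj y)) hy; exists (h - y) => //; exact: amB hpi h y.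
Qed.

Let I2 := relation_ideal_ge2 rI.

Lemma aquot_chars : let p (z : aquot I) v := (repr z : kQ) (qtriv v) in
  [/\ forall x v, p (proj x) v = x (qtriv v),
      forall v, zmod_morphism (p^~ v) /\ monoid_morphism (p^~ v),
      forall a v, p (scal a) v = a & forall v, open [set z | p z v = 0]].
Proof.
move=> p; have [c1 c2 c3] := @cpath_chars k Q.
have pE x v : p (proj x) v = x (qtriv v).
  have : ideal_set I (repr (proj x) - x) by apply/aquot_eqP; rewrite reprK.
  by move=> /I2 /(_ (qtriv v) isT); rewrite cpathEB => /eqP; rewrite subr_eq0 => /eqP.
split=> // [v|a v|v].
- have [cz [co cM]] := c1 v; split.
    move=> z w; have [x <-] := aquot_surj z; have [y <-] := aquot_surj w.
    by rewrite -(amB hpi) !pE cz.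
  split=> [|z w]; first by rewrite -(am1 hpi) pE co.
  have [x <-] := aquot_surj z; have [y <-] := aquot_surj w.
  by rewrite -(amM hpi) !pE cM.
- by rewrite -(am_scal hpi) pE c2.
- have -> : [set z | p z v = 0] = [set z | [set x : kQ | x (qtriv v) = 0] (repr z)] by [].
  rewrite -[open _]/(open (proj @^-1` [set z | p z v = 0])).
  have -> : proj @^-1` [set z | p z v = 0] = [set x : kQ | x (qtriv v) = 0].
    by apply/seteqP; split=> x /=; rewrite pE.
  exact: c3.
Qed.

Lemma aquot_jac z : jacobson z <-> aquot_ge 1 z.
Proof.
have [c1 c2 c3 c4] := aquot_chars.
have ge1 w : aquot_ge 1 w <-> forall v, (repr w : kQ) (qtriv v) = 0.
  split=> [[x /videm_ge1 hx <-] v|h]; first by rewrite c1.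
  by exists (repr w); [exact/videm_ge1|rewrite reprK].
rewrite ge1; apply: (jacobson_chars c2 c3 c4) => w /ge1 [x Nx <-].
have [u hu] := cpath_quasi_inv Nx; exists (proj u).
by rewrite -(am1 hpi) -(amB hpi) -(amM hpi) hu.
Qed.

Lemma aquot_jac2 z : jpow 2 z <-> aquot_ge 2 z.
Proof.
split.
  move: z; apply: mul_set_ind; [exact: idl0 (aquot_ge_ideal 2)|exact: idlD (aquot_ge_ideal 2)|].
  move=> _ _ /aquot_jac [x Nx <-] /aquot_jac [y Ny <-]; exists (x * y); last exact: (amM hpi).
  exact: (cpath_geM Nx Ny).
move=> [x /cpath_jac2 hx <-]; apply: mul_setS (am_mul_set hpi hx) => _ [y /cpath_jac Ny <-];
  by apply/aquot_jac; exists y.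
Qed.

Lemma aquot_PAlg : PAlg_ob (aquot I).
Proof.
split; first exact: aquot_pseudocompact.
  exists (vtx Q), (fun z v => (repr z : kQ) (qtriv v)); have [c1 c2 c3 c4] := aquot_chars.
  split=> // [y|z].
    by exists (proj (fun p => y (val p).1)); apply/funext => v; rewrite c1.
  rewrite aquot_jac; split=> [[x /videm_ge1 hx <-] v|h]; first by rewrite c1.
  by exists (repr z); [exact/videm_ge1|rewrite reprK].
have [n [f [h1 h2 h3]]] := aquot_ge_fcodim 2; exists n, f; split=> // z.
by rewrite aquot_jac2.
Qed.

Lemma aquot_presentation : presentation (proj : kQ -> aquot I).
Proof.
split; [exact: hpi|exact: aquot_surj|].
move=> x h; apply: I2; rewrite -[x]subr0; apply/aquot_eqP.
by rewrite (am0 hpi).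
Qed.
End CpathQuotient.

(** * Primitive idempotents *)

Section Primitive.
Variables (k : fieldType) (A : preTopAlgType k).
Hypothesis hA : PAlg_ob A.

Let ptA : pointed_algebra A. Proof. by case: hA. Qed.

Definition orthogonal (e f : A) := (e * f == 0) && (f * e == 0).
Definition orthogonal_decomposition (s : seq A) :=
  [&& all (fun e => (e * e == e) && (e != 0)) s, pairwise orthogonal s & \sum_(e <- s) e == 1].

(** Nonzero orthogonal idempotents are linearly independent modulo [J^2]. *)
Lemma orthogonal_size : exists n, forall s, orthogonal_decomposition s -> (size s <= n)%N.
Proof.
case: hA => _ [X [p [pm ps psj pJ]]] [n [f [fl fs fk]]]; exists n => s /and3P [/allP hs /(pairwiseP 0) ho _].
have fB : zmod_morphism f by move=> x y; rewrite addrC -scaleN1r fl scaleN1r addrC.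
have fZ a (x : A) : f ((scal a : A) * x) = a *: f x.
  by rewrite -[LHS]/(f (a *: (x : lmod_of A))) -[_ *: _]addr0 fl (zm0 fB) addr0.
pose M := \matrix_(i < size s) f (nth 0 s i).
suff /eqP <- : row_free M by exact: rank_leq_col.
apply: inj_row_free => c hc; apply/rowP => i; rewrite mxE.
have : f (\sum_(j < size s) scal (c 0 j) * nth 0 s j : A) = 0.
  rewrite (zm_sum fB) -[RHS]hc mulmx_sum_row; apply: eq_bigr => j _.
  by rewrite fZ rowK.
move=> /fk /(jpow_leS ptA (n := 1)) /pJ hx.
have /andP [/eqP ei nz] := hs _ (mem_nth 0 (ltn_ord i)).
have [x px] : exists x, p (nth 0 s i) x <> 0.
  apply: contrapT => h; case/eqP: nz; apply: (jac_idem0 hA) => //; apply/pJ => x.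
  by apply: contrapT => px; apply: h; exists x.
have [pz [po pM]] := pm x.
have := hx x; rewrite (zm_sum pz) (bigD1 i) //= big1 => [|j ji].
  by rewrite addr0 pM ps => /eqP; rewrite mulf_eq0 => /orP [/eqP //|/eqP].
rewrite pM; suff -> : p (nth 0 s j) x = 0 by rewrite mulr0.
have : nth 0 s i * nth 0 s j = 0.
  have ji' : nat_of_ord i != nat_of_ord j by rewrite eq_sym.
  case: (ltngtP i j) ji' => // ij _.
    by have /andP [/eqP] := ho i j (ltn_ord i) (ltn_ord j) ij.
  by have /andP [_ /eqP] := ho j i (ltn_ord j) (ltn_ord i) ij.
by move=> /(congr1 (p^~ x)); rewrite pM (zm0 pz) => /eqP; rewrite mulf_eq0 => /orP [/eqP //|/eqP].
Qed.

(** A decomposition of [1] of maximal size is complete: splitting one of its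
    members would lengthen it. *)
Lemma complete_primitive_ex : exists s : seq A, complete_primitive s.
Proof.
have [n hn] := orthogonal_size.
pose P m := `[< exists2 s, orthogonal_decomposition s & size s = m >].
have exP : exists m, P m.
  case: (eqVneq (1 : A) 0) => [e|ne].
    exists 0%N; apply/asboolP; exists [::] => //; apply/and3P; split=> //.
    by rewrite big_nil eq_sym; apply/eqP.
  exists 1%N; apply/asboolP; exists [:: 1] => //; apply/and3P; split=> //=.
    by rewrite mulr1 eqxx ne.
  by rewrite big_seq1.
have ubP m : P m -> (m <= n)%N by move=> /asboolP [s /hn h <-].
case: (ex_maxnP exP ubP) => m /asboolP [s ds sm] mmax; exists s.
have /and3P [/allP hs ho /eqP h1] := ds.
have orthP e f : e \in s -> f \in s -> e <> f -> e * f = 0.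
  move=> es fs ne; have /(pairwiseP 0) h := ho; have hi := es; have hj := fs.
  rewrite -index_mem in hi; rewrite -index_mem in hj.
  have ij : index e s != index f s.
    by apply/eqP => h'; apply: ne; rewrite -(nth_index 0 es) h' nth_index.
  case: (ltngtP (index e s) (index f s)) ij => // lt _.
    by have := h _ _ hi hj lt; rewrite !nth_index // => /andP [/eqP].
  by have := h _ _ hj hi lt; rewrite !nth_index // => /andP [_ /eqP].
split=> //.
  rewrite uniq_pairwise; apply: (sub_in_pairwise (P := fun e => (e * e == e) && (e != 0))) ho.
    move=> e f /andP [/eqP ee ne] _ /andP [/eqP ef _] /=; apply/eqP => h.
    by case/eqP: ne; rewrite -ee {2}h.
  exact/allP.
move=> e es; have /andP [/eqP ee ne] := hs e es; split=> //; first exact/eqP.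
move=> f g ff gg fg gf efg; apply: contrapT => /not_orP [nf ng].
have fe : f * e = f by rewrite efg mulrDr fg ff addr0.
have ef : e * f = f by rewrite efg mulrDl gf ff addr0.
have ge : g * e = g by rewrite efg mulrDr gf gg add0r.
have eg : e * g = g by rewrite efg mulrDl fg gg add0r.
have so x : orthogonal x e -> orthogonal x f && orthogonal x g.
  rewrite /orthogonal => /andP [/eqP xe /eqP ex].
  by rewrite -{1}ef -{2}fe -{1}eg -{2}ge !mulrA xe -!mulrA ex !mulr0 !mul0r !eqxx.
have symo x y : orthogonal x y = orthogonal y x by rewrite /orthogonal andbC.
case/splitPr: es ds sm h1 {hs ho orthP} => s1 s2 /and3P [].
rewrite all_cat pairwise_cat /= => /and3P [a1 ae a2] /and4P [r1 p1 pe p2] /eqP h1 sm _.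
suff : P m.+1 by move=> /mmax; rewrite ltnn.
apply/asboolP; exists (s1 ++ f :: g :: s2); last by rewrite -sm !size_cat /= !addnS.
apply/and3P; split.
- rewrite all_cat a1 /= a2 ff gg !eqxx /= andbT; apply/andP; split; exact/eqP.
- rewrite pairwise_cat /= p1 p2 !andbT.
  have [pf pg] : all (orthogonal f) s2 /\ all (orthogonal g) s2.
    by split; apply/allP => x /(allP pe); rewrite symo => /so /andP [hf hg]; rewrite symo.
  move: r1; rewrite !allrel_consr => /andP [re ->].
  have [-> ->] : all (orthogonal^~ f) s1 /\ all (orthogonal^~ g) s1.
    by split; apply/allP => x /(allP re) /so /andP [hf hg].
  by rewrite pf pg /orthogonal fg gf /= eqxx.
- by apply/eqP; apply: etrans h1; rewrite !big_cat !big_cons /= efg -[f + g + _]addrA.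
Qed.

Variables (X : Type) (p : A -> X -> k).
Hypotheses (pm : forall x, zmod_morphism (p^~ x) /\ monoid_morphism (p^~ x)).
Hypotheses (psurj : forall y : X -> k, exists a, p a = y).
Hypothesis pJ : forall a, jacobson a <-> forall x, p a x = 0.

(** If a primitive [e] were nonzero at two characters, a lift inside [e * A * e]
    of the indicator of one of them would split it. *)
Lemma primitive_char e : primitive_idempotent e ->
  exists x, p e x = 1 /\ forall y, y <> x -> p e y = 0.
Proof.
move=> [ee ne eprim].
have [x px] : exists x, p e x <> 0.
  apply: contrapT => h; apply: ne; apply: (jac_idem0 hA) => //; apply/pJ => x.
  by apply: contrapT => px; apply: h; exists x.
have pe1 y : p e y <> 0 -> p e y = 1.
  move=> /eqP py; have [_ [_ pM]] := pm y; apply: (mulfI py).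
  by rewrite mulr1 -pM ee.
exists x; split; first exact: pe1.
move=> y yx; apply: contrapT => py.
have [a pa] := psurj (fun z => if pselect (z = x) then 1 else 0).
have pu z : p (e * a * e) z = if pselect (z = x) then 1 else 0.
  have [_ [_ pM]] := pm z; rewrite !pM pa; case: pselect => [zx|nzx]; last by rewrite mulr0 mul0r.
  by rewrite /= zx pe1 // !mulr1.
have [||| f [ff Jfu ef fe]] := @idem_lift _ _ hA e (e * a * e).
- by rewrite !mulrA ee.
- by rewrite -mulrA ee.
- apply/pJ => z; have [pz [_ pM]] := pm z; rewrite pz pM !pu.
  by case: pselect => h; rewrite ?mulr1 ?mulr0 subrr.
have pf z : p f z = if pselect (z = x) then 1 else 0.
  by have [pz _] := pm z; have /pJ /(_ z) := Jfu; rewrite pz pu => /eqP; rewrite subr_eq0 => /eqP.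
have [||||f0|ef0] := eprim f (e - f) ff.
- by rewrite /idempotent_elt mulrBr mulrBl ee fe mulrBl ef ff subrr subr0.
- by rewrite mulrBr fe ff subrr.
- by rewrite mulrBl ef ff subrr.
- by rewrite addrC subrK.
- have := pf x; rewrite f0 (zm0 (pm x).1); case: pselect => //= xx /esym /eqP.
  by rewrite oner_eq0.
- have := pf y; have <- : e = f by apply/eqP; rewrite -subr_eq0 ef0.
  by case: pselect.
Qed.
End Primitive.

(** * The Gabriel quiver *)

Section ModJ2.
Variables (k : fieldType) (A : preTopAlgType k).
Local Notation pi2 x := (\pi_(lquot (jac2_submod A)) (x : lmod_of A)).

Lemma pi2_eq (x y : A) : pi2 x = pi2 y <-> jpow 2 (x - y).
Proof.
rewrite (rwP eqP) -Quotient.idealrBE; split=> [/asboolP //|h]; exact/asboolP.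
Qed.

Lemma pi2B (x y : A) : pi2 (x - y) = pi2 x - pi2 y.
Proof. by rewrite !piE. Qed.

Lemma pi2D (x y : A) : pi2 (x + y) = pi2 x + pi2 y.
Proof. by rewrite [RHS]piE. Qed.

Lemma pi2Z a (x : A) : pi2 (scal a * x) = a *: pi2 x.
Proof. by rewrite -[RHS]/(lquot_scale _ _) piE. Qed.

Lemma pi2_0 (x : A) : pi2 x = 0 <-> jpow 2 x.
Proof. by rewrite -[x in X in _ <-> X]subr0 -pi2_eq piE. Qed.

Lemma modJ2_embed : PAlg_ob A -> exists n (g : modJ2 A -> 'rV[k]_n), linear g /\ injective g.
Proof.
case=> _ _ [n [f [fl fs fk]]].
have fB : zmod_morphism f by move=> x y; rewrite addrC -scaleN1r fl scaleN1r addrC.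
have gE (x : A) : f (repr (pi2 x)) = f x.
  apply/eqP; rewrite -subr_eq0 -fB; apply/eqP/fk.
  by apply/pi2_eq; rewrite reprK.
exists n, (fun z => f (repr z)); split.
  move=> a z w; rewrite -fl -[RHS]gE.
  have e : pi2 ((scal a : A) * (repr z : A) + (repr w : A)) = a *: z + w.
    by rewrite pi2D pi2Z !reprK.
  have h := congr1 (fun t => f (repr t)) (esym e); exact h.
move=> z w h; rewrite -[z]reprK -[w]reprK; apply/pi2_eq/fk.
by rewrite fB h subrr.
Qed.
End ModJ2.

Section Gabriel.
Variables (k : fieldType) (A : preTopAlgType k) (E : seq A).
Hypotheses (hA : PAlg_ob A) (hE : complete_primitive E).
Local Notation pi2 x := (\pi_(lquot (jac2_submod A)) (x : lmod_of A)).
Local Notation eps v := (gq_idem (Some v : option (gq_vtx E))).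
Local Notation Qv := (gq_vtx E).
Local Notation ge := (@gq_idem k A E).

Let psA : pseudocompact A. Proof. by case: hA. Qed.
Let ptA : pointed_algebra A. Proof. by case: hA. Qed.
Let hJ := jac_ideal ptA.
Let hJ2 := jpow_ideal ptA 2.

Let E_idem e : e \in E -> idempotent_elt e. Proof. by case: hE => _ h _ _ /h []. Qed.
Let E_orth e f : e \in E -> f \in E -> e <> f -> e * f = 0. Proof. by case: hE => _ _ h _; apply: h. Qed.

Lemma complete_jac_inj e f : e \in E -> f \in E -> jacobson (e - f) -> e = f.
Proof.
move=> he hf h; apply: contrapT => ne; have [_ ep _ _] := hE; have [ee nz _] := ep e he.
apply: nz; apply: (jac_idem0 hA) => //.
rewrite -[e]subr0 -(E_orth he hf ne) -{1}ee -mulrBr; exact: (idlMl hJ).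
Qed.

Lemma gq_mem (v : Qv) : eps v \in E /\ orbitG (eps v) = val v.
Proof.
have hv : val v \in [seq orbitG e | e <- E] by exact: valP v.
have hi : (index (val v) [seq orbitG e | e <- E] < size E)%N.
  by rewrite -(size_map (@orbitG k A)) index_mem.
by split; [exact: mem_nth|rewrite -(nth_map _ set0) ?nth_index].
Qed.

Lemma gq_idem_inj (v w : Qv) : eps v = eps w -> v = w.
Proof. by move=> h; apply: val_inj; rewrite -(gq_mem v).2 -(gq_mem w).2 h. Qed.

Lemma gq_idem_surj e : e \in E -> exists v : Qv, eps v = e.
Proof.
move=> he; have hv : orbitG e \in [seq orbitG e | e <- E] by apply: map_f.
pose v : Qv := SeqSub hv; exists v; have [h1 h2] := gq_mem v.
apply: complete_jac_inj => //; apply/(orbitG_eq hA); [exact: E_idem|exact: E_idem|].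
by rewrite h2.
Qed.

Lemma eps_idem v : idempotent_elt (eps v). Proof. exact: E_idem (gq_mem v).1. Qed.

Lemma gq_idem_idem v : ge v * ge v = ge v.
Proof. by case: v => [v|]; [exact: eps_idem|rewrite mul0r]. Qed.

Lemma eps_orth v w : eps v * eps w = if v == w then eps v else 0.
Proof.
case: eqP => [->|ne]; first exact: eps_idem.
by apply: E_orth; [exact: (gq_mem v).1|exact: (gq_mem w).1|move=> /gq_idem_inj].
Qed.

Lemma eps_sum : \sum_v eps v = 1.
Proof.
have [uE _ _ <-] := hE; rewrite -(big_map (fun v : Qv => eps v) xpredT id).
apply: perm_big; apply: uniq_perm => //.
  by rewrite map_inj_uniq ?index_enum_uniq // => v w /gq_idem_inj.
move=> e; apply/mapP/idP => [[v _ ->]|/gq_idem_surj [v <-]]; first exact: (gq_mem v).1.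
by exists v; rewrite ?mem_index_enum.
Qed.

Lemma eps_neq0 v : eps v <> 0.
Proof. by have [_ h _ _] := hE; have [] := h _ (gq_mem v).1. Qed.

(** Each vertex gives the character at which its idempotent is [1]; since the
    idempotents sum to [1], there is no other character. *)
Lemma gq_chars : exists c : A -> Qv -> k,
  [/\ forall v, zmod_morphism (c^~ v) /\ monoid_morphism (c^~ v),
      forall a v, c (scal a) v = a, forall w v, c (eps w) v = (v == w)%:R &
      forall a, jacobson a <-> forall v, c a v = 0].
Proof.
have [X [p [pm ps pu pJ]]] := ptA; have [_ hprim _ _] := hE.
have [x hx] := choice (fun v : Qv => primitive_char hA pm pu pJ (hprim _ (gq_mem v).1)).
exists (fun a v => p a (x v)); split=> // [w v|a].
  case: eqP => [->|ne]; first by rewrite (hx w).1.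
  apply/eqP/negPn/negP => nz; have [_ [_ pM]] := pm (x v).
  have := congr1 (p^~ (x v)) (eps_orth w v); rewrite pM (hx v).1 mulr1.
  case: eqP => [e|_]; first by case: ne.
  by move=> h; case/eqP: nz; rewrite h (zm0 (pm _).1).
rewrite pJ; split=> // h y; have [pz [p1 _]] := pm y.
have [v nz] : exists v, p (eps v) y <> 0.
  apply: contrapT => h'; have := p1; rewrite -eps_sum (zm_sum pz) big1 => [/esym /eqP|v _].
    by rewrite oner_eq0.
  by apply: contrapT => nz; apply: h'; exists v.
suff -> : y = x v by [].
by apply: contrapT => /(hx v).2.
Qed.

Lemma gq_valP v w (x : arr (v := GQ E) v w) :
  exists2 j, jacobson j & gq_val x = pi2 (ge w * j * ge v).
Proof. by case: x => z hz; have /asboolP [j Jj e] := hz; exists j. Qed.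

Lemma gq_val_ex v w j : jacobson j ->
  exists x : arr (v := GQ E) v w, gq_val x = pi2 (ge w * j * ge v).
Proof.
move=> Jj; have h : pi2 (ge w * j * ge v) \in sm_pred (arrow_submod (ge v) (ge w)).
  by apply/asboolP; exists j.
by exists (exist (fun z => z \in sm_pred (arrow_submod (ge v) (ge w))) _ h).
Qed.

Lemma gq_val_inj v w : injective (@gq_val k A E v w).
Proof. exact: val_inj. Qed.

Lemma gq_val_lin v w a (x y : arr (v := GQ E) v w) :
  gq_val (a *: x + y) = a *: gq_val x + gq_val y.
Proof. by []. Qed.

Lemma GQ_vquiver : is_vquiver (GQ E).
Proof.
have [n [g [gl gi]]] := modJ2_embed hA.
split=> [e f|e x|e x].
- apply: (@fin_dim_embed _ _ n (fun x => g (gq_val (x : arr (v := GQ E) e f)))).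
    by move=> a x y; rewrite gq_val_lin gl.
  by move=> x y /gi /gq_val_inj.
- apply: gq_val_inj; have [j _ ->] := gq_valP x.
  by rewrite /= mulr0; apply/pi2_0 => //; exact: idl0 hJ2.
- apply: gq_val_inj; have [j _ ->] := gq_valP x.
  by rewrite /= !mul0r; apply/pi2_0 => //; exact: idl0 hJ2.
Qed.

(** * The counit *)

Local Notation kQ := (cpath (GQ E)).
Local Notation vv v := (videm (Some v : option (vtx (GQ E))) : kQ).

(** The class of the counit, described by values modulo [J] and [J^2] instead of
    the splittings. *)
Definition counit_like (phi : kQ -> A) : Prop :=
  [/\ alg_mor phi, forall v : Qv, jacobson (phi (vv v) - eps v) &
      forall v w (x : arr (v := GQ E) v w), jacobson (phi (varr x)) /\ pi2 (phi (varr x)) = gq_val x].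

Lemma gq_val0 v w : gq_val (0 : arr (v := GQ E) v w) = 0.
Proof. by []. Qed.

Lemma counit_like_intro phi : alg_mor phi -> (forall v : Qv, jacobson (phi (vv v) - eps v)) ->
  (forall (v w : Qv) (x : arr (v := GQ E) (Some v) (Some w)), pi2 (phi (varr x)) = gq_val x) ->
  counit_like phi.
Proof.
move=> hphi hv hx; split=> // v w x; split.
  by apply: (jac_mor (cpath_PAlg _) hA hphi); apply/cpath_jac/varr_ge.
have hQ := GQ_vquiver.
case: v w x => [v|] [w|] x //; last 1 first.
- by rewrite (arr_None_l hQ x) gq_val0 varr_None ?(am0 hphi); [apply/pi2_0 => //; exact: idl0 hJ2|left].
- by rewrite (arr_None_r hQ x) gq_val0 varr_None ?(am0 hphi); [apply/pi2_0 => //; exact: idl0 hJ2|right].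
- by rewrite (arr_None_l hQ x) gq_val0 varr_None ?(am0 hphi); [apply/pi2_0 => //; exact: idl0 hJ2|left].
Qed.

Lemma counit_like_sim phi psi : counit_like phi -> alg_mor psi -> sim1 psi phi -> counit_like psi.
Proof.
move=> [hphi hv hx] hpsi [h1 h2]; apply: counit_like_intro => // [v|v w x].
  exact: (idl_trans hJ (h1 _) (hv v)).
have [_ <-] := hx _ _ x; apply/pi2_eq => //; apply: h2; exact/cpath_jac/varr_ge.
Qed.

Lemma gq_parts j : jacobson j -> exists u : forall v w, arr (v := GQ E) v w,
  forall v w, gq_val (u v w) = pi2 (ge w * j * ge v).
Proof.
move=> Jj; exists (fun v w => projT1 (cid (gq_val_ex v w Jj))) => v w.
exact: projT2 (cid (gq_val_ex v w Jj)).
Qed.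

Lemma pi2_sum (I : finType) (F : I -> A) : pi2 (\sum_i F i) = \sum_i pi2 (F i).
Proof. exact: (zm_sum (f := fun x : A => pi2 x) (@pi2B k A)). Qed.

Lemma eps_decomp (j : A) : j = \sum_(v : Qv) \sum_(w : Qv) eps w * j * eps v.
Proof.
rewrite -{1}[j]mulr1 -eps_sum mulr_sumr; apply: eq_bigr => v _.
by rewrite -mulr_suml -mulr_suml eps_sum mul1r.
Qed.

Lemma counit_like_surj phi : counit_like phi -> forall a, exists x, phi x = a.
Proof.
move=> [hphi hv hx] a; have [c [cm cs ce cJ]] := gq_chars.
have [|||x _ <-] := @generated_surj _ _ _ hA phi hphi _ _ 0%N a; last by exists x.
- move=> b; exists (\sum_v scal (c b v) * vv v); rewrite (am_sum hphi).
  have hs : jacobson (b - \sum_v scal (c b v) * eps v).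
    apply/cJ => v; have [cz [_ cM]] := cm v.
    rewrite cz (zm_sum cz) (big_only1 v) // => [|w ne _]; rewrite cM cs ce.
      by rewrite eqxx mulr1 subrr.
    by rewrite eq_sym (negPf ne) mulr0.
  apply: (idl_trans hJ hs); rewrite -sumrB; apply: (idl_sum hJ) => v _.
  by rewrite (am_scalM hphi) -mulrBr; apply: (idlMl hJ); exact: (idl_sym hJ).
- move=> j Jj; have [u hu] := gq_parts Jj.
  exists (\sum_(v : Qv) \sum_(w : Qv) varr (u (Some v) (Some w))).
    apply: (idl_sum (cpath_ge_ideal _ _)) => v _; apply: (idl_sum (cpath_ge_ideal _ _)) => w _.
    exact: varr_ge.
  apply/pi2_eq => //; rewrite {1}[j]eps_decomp (am_sum hphi) !pi2_sum.
  apply: eq_bigr => v _; rewrite (am_sum hphi) !pi2_sum; apply: eq_bigr => w _.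
  by rewrite (hx _ _ _).2 hu.
- by [].
Qed.

(** The arrow spaces of the Gabriel quiver embed in [J / J^2], so a relation has
    no component of length one. *)
Lemma counit_like_presentation phi : counit_like phi -> presentation phi.
Proof.
move=> hc; have [hphi hv hx] := hc; split=> //; first exact: counit_like_surj.
move=> x px0; have [c [cm cs ce cJ]] := gq_chars.
have N1 : cpath_ge 1 x.
  apply/videm_ge1 => v; have [cz [_ cM]] := cm v.
  have hcv w : c (phi (vv w)) v = (v == w)%:R.
    rewrite -ce; apply/eqP; rewrite -subr_eq0 -cz; apply/eqP.
    by move: v {cz cM}; exact/cJ.
  have : c (phi x) v = x (qtriv v).
    rewrite (alg_mor_expand hphi) (zmD cz) !(zm_sum cz) (big_only1 v) // => [|w ne _].
      2: by rewrite cM cs hcv eq_sym (negPf ne) mulr0.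
    rewrite cM cs hcv eqxx mulr1 big1 ?addr0 // => b _; rewrite cM.
    have /cJ -> : jacobson (phi (barr b)) by exact: alg_mor_barrJ.
    by rewrite mulr0.
  by rewrite px0 (zm0 cz) => <-.
rewrite [x]videm_decomp; apply: (idl_sum (cpath_ge_ideal _ _)) => v _.
apply: (idl_sum (cpath_ge_ideal _ _)) => w _.
have [u hu] := arrow_part GQ_vquiver (Some v) (Some w) N1.
suff u0 : u = 0 by move: hu; rewrite u0 (zm0 (varr_zmod GQ_vquiver (e := Some v) (f := Some w))) subr0.
apply: gq_val_inj; have [_ <-] := hx _ _ u; rewrite gq_val0; apply/pi2_0 => //.
have := jac2_mor (cpath_PAlg _) hA hphi (proj2 (cpath_jac2 _) hu).
by rewrite (amB hphi) !(amM hphi) px0 mulr0 mul0r sub0r => /(idlN hJ2); rewrite opprK.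
Qed.

(** The vertices go to their idempotents in [E], the basis arrows to
    representatives in the corners of [J]. *)
Lemma counit_phi_ex : exists phi : kQ -> A,
  [/\ alg_mor phi, forall v : Qv, phi (vv v) = eps v &
      forall (v w : Qv) (x : arr (v := GQ E) (Some v) (Some w)), pi2 (phi (varr x)) = gq_val x].
Proof.
have [u [hu ubasis]] := arr_basis GQ_vquiver.
have [j hj] : exists j : qarr (GQ E) -> A, forall b, jacobson (j b) /\
    gq_val (u b) = pi2 (eps (tgt b) * j b * eps (src b)).
  exists (fun b => projT1 (cid2 (gq_valP (u b)))) => b.
  by case: cid2.
have [|||||phi [hphi hv hb]] := @cpath_univ_ex k (GQ E) A hA
   (fun v => eps v) (fun b => eps (tgt b) * j b * eps (src b)).
- exact: eps_orth.
- exact: eps_sum.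
- by move=> b; apply: (idlMr hJ); apply: (idlMl hJ); case: (hj b).
- by move=> b; rewrite !mulrA eps_idem.
- by move=> b; rewrite -!mulrA eps_idem.
exists phi; split=> // v w x; rewrite varrE (am_sum hphi) pi2_sum {2}(ubasis _ _ x).
have gz : zmod_morphism (@gq_val k A E (Some v) (Some w)) by [].
rewrite (zm_sum gz); apply: eq_bigr => i _.
by rewrite (am_scalM hphi) pi2Z hb -(hj (mkarr i)).2.
Qed.

Local Notation piJ x := (\pi_(lquot (jac_submod A)) (x : lmod_of A)).

Lemma piJ_eq (x y : A) : piJ x = piJ y <-> jacobson (x - y).
Proof. rewrite (rwP eqP) -Quotient.idealrBE; split=> [/asboolP //|h]; exact/asboolP. Qed.

(** The splitting [s] has the span of [E] as image, and [t] is read off from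
    [phi] on the components of an element in the corners of [J / J^2]. *)
Lemma counit_ex : exists phi : kQ -> A, is_counit phi.
Proof.
have [phi [hphi hv hx]] := counit_phi_ex; exists phi.
have [c [cm cs ce cJ]] := gq_chars.
pose s (z : lquot (jac_submod A)) : lmod_of A := \sum_v scal (c (repr z : A) v) * eps v.
have cE (x : A) v : c (repr (piJ x) : A) v = c x v.
  have [cz _] := cm v; apply/eqP; rewrite -subr_eq0 -cz; apply/eqP.
  have : jacobson ((repr (piJ x) : A) - x) by apply/piJ_eq; rewrite reprK.
  by move=> /cJ.
have sE (x : A) : s (piJ x) = \sum_v scal (c x v) * eps v.
  by apply: eq_bigr => v _; rewrite cE.
have cS (a : Qv -> k) v : c (\sum_w scal (a w) * eps w) v = a v.
  have [cz [_ cM]] := cm v; rewrite (zm_sum cz) (big_only1 v) // => [|w ne _].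
    by rewrite cM cs ce eqxx mulr1.
  by rewrite cM cs ce eq_sym (negPf ne) mulr0.
pose ok (z : modJ2 A) v w (x : arr (v := GQ E) v w) := gq_val x = pi2 (ge w * (repr z : A) * ge v).
pose part z v w := some_such 0 (ok z v w).
have partE (j : A) v w : jacobson j -> gq_val (part (pi2 j) v w) = pi2 (ge w * j * ge v).
  move=> Jj; have h2 : jpow 2 ((repr (pi2 j) : A) - j) by apply/pi2_eq => //; rewrite reprK.
  have Jr : jacobson (repr (pi2 j) : A).
    by apply: (idl_sub hJ) Jj; apply: (jpow_leS ptA (n := 1)).
  rewrite /part /some_such; case: pselect => [h|[]]; last exact: gq_val_ex.
  rewrite (projT2 (cid h)); apply/pi2_eq => //.
  by rewrite -mulrBl -mulrBr; apply: (idlMr hJ2); apply: (idlMl hJ2).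
pose t (z : modJ2 A) : A := \sum_(v : Qv) \sum_(w : Qv) phi (varr (part z (Some v) (Some w))).
have hQ := GQ_vquiver.
have t_bimod (sg tau j : A) (a b : Qv -> k) :
    (forall w, eps w * sg = scal (a w) * eps w) -> (forall w, sg * eps w = scal (a w) * eps w) ->
    (forall w, eps w * tau = scal (b w) * eps w) -> (forall w, tau * eps w = scal (b w) * eps w) ->
    jacobson j -> t (pi2 (sg * j * tau)) = sg * t (pi2 j) * tau.
  move=> sgl sgr taul taur Jj.
  have Js : jacobson (sg * j * tau) by apply: (idlMr hJ); apply: (idlMl hJ).
  rewrite /t mulr_sumr mulr_suml; apply: eq_bigr => v _; rewrite mulr_sumr mulr_suml.
  apply: eq_bigr => w _; set u := part (pi2 j) (Some v) (Some w).
  have -> : part (pi2 (sg * j * tau)) (Some v) (Some w) = (a w * b v) *: u.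
    apply: gq_val_inj; rewrite -[RHS]/(_ *: gq_val u) /u !partE // -pi2Z; congr (\pi_(_) _).
    rewrite !mulrA sgl -!mulrA taur rmorphM -!mulrA; congr (_ * _).
    by rewrite [j * (scal _ * _)]mulrA -scal_central -mulrA [LHS]mulrA -scal_central -mulrA.
  rewrite (varrZ hQ) (am_scalM hphi) -(varr_videm u) !(amM hphi) !hv.
  rewrite -!mulrA taul [sg * _]mulrA sgr rmorphM -!mulrA; congr (_ * _).
  by rewrite [phi _ * (scal _ * _)]mulrA -scal_central -mulrA [RHS]mulrA -scal_central -mulrA.
have sl z w : eps w * (s z : A) = scal (c (repr z : A) w) * eps w.
  rewrite /s mulr_sumr (big_only1 w) // => [|i ne _].
    by rewrite mulrA -scal_central -mulrA eps_idem.
  by rewrite mulrA -scal_central -mulrA eps_orth eq_sym (negPf ne) mulr0.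
have sr z w : (s z : A) * eps w = scal (c (repr z : A) w) * eps w.
  rewrite /s mulr_suml (big_only1 w) // => [|i ne _].
    by rewrite -mulrA eps_idem.
  by rewrite -mulrA eps_orth (negPf ne) mulr0.
exists s, t; split=> //.
- split.
  + move=> a z w; have -> : a *: z + w = piJ (scal a * (repr z : A) + (repr w : A)).
      rewrite -[LHS]/(lquot_scale a z + w) -[z in LHS]reprK -[w in LHS]reprK.
      by rewrite -[scal a * _]/(a *: (repr z : lmod_of A)) !piE.
    rewrite sE -[RHS]/((scal a : A) * s z + s w) mulr_sumr -big_split; apply: eq_bigr => v _ /=.
    by have [cz [_ cM]] := cm v; rewrite (zmD cz) cM cs rmorphD rmorphM mulrDl mulrA.
  + rewrite sE -[RHS]eps_sum; apply: eq_bigr => v _; have [_ [c1 _]] := cm v.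
    by rewrite c1 rmorph1 mul1r.
  + move=> x y; rewrite !sE mulr_suml; apply: eq_bigr => v _.
    have [_ [_ cM]] := cm v; rewrite cM mulr_sumr (big_only1 v) // => [|w ne _].
      rewrite -!mulrA [eps v * (_ * _)]mulrA -scal_central -mulrA eps_idem.
      by rewrite rmorphM mulrA.
    rewrite -!mulrA [eps v * (_ * _)]mulrA -scal_central -mulrA eps_orth eq_sym (negPf ne).
    by rewrite !mulr0.
  + move=> z; rewrite -[RHS]reprK; apply/piJ_eq/cJ => v; have [cz _] := cm v.
    by rewrite cz cS subrr.
- split.
  + move=> i j Ji Jj.
    have part_add v w : part (pi2 (i + j)) v w = part (pi2 i) v w + part (pi2 j) v w.
      apply: gq_val_inj; rewrite -[RHS]/(gq_val (part _ _ _) + gq_val (part _ _ _)) !partE //.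
        by rewrite -pi2D mulrDr mulrDl.
      exact: (idlD hJ).
    rewrite /t -big_split; apply: eq_bigr => v _; rewrite -big_split; apply: eq_bigr => w _.
    by rewrite part_add (zmD (@varr_zmod _ _ hQ (Some v) (Some w))) (amD hphi).
  + move=> a j Jj; rewrite /t mulr_sumr; apply: eq_bigr => v _; rewrite mulr_sumr.
    apply: eq_bigr => w _; rewrite -(am_scalM hphi) -(varrZ hQ); congr (phi (varr _)).
    apply: gq_val_inj; rewrite -[RHS]/(a *: gq_val (part _ _ _)) !partE //; last exact: (idlMl hJ).
    by rewrite -pi2Z mulrA -scal_central -!mulrA.
  + move=> _ _ j [z _ <-] [z' _ <-] Jj.
    exact: (t_bimod _ _ _ _ _ (sl z) (sr z) (sl z') (sr z') Jj).
  + move=> j Jj; split.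
      apply: (idl_sum hJ) => v _; apply: (idl_sum hJ) => w _.
      by apply: (jac_mor (cpath_PAlg _) hA hphi); apply/cpath_jac/varr_ge.
    rewrite /t pi2_sum [j in RHS]eps_decomp pi2_sum; apply: eq_bigr => v _.
    by rewrite !pi2_sum; apply: eq_bigr => w _; rewrite hx partE.
- move=> v; rewrite hv; split; first by rewrite -(gq_mem v).2; apply: orbitG_refl hA _ (eps_idem v).
  exists (piJ (eps v)) => //; rewrite sE (big_only1 v) // => [|w ne _].
    by rewrite ce eqxx rmorph1 mul1r.
  by rewrite ce (negPf ne) rmorph0 mul0r.
- move=> v w x; have [j Jj ej] := gq_valP x; rewrite ej.
  have Jc : jacobson (ge (Some w) * j * ge (Some v)) by apply: (idlMr hJ); apply: (idlMl hJ).
  rewrite /t (big_only1 v) // => [|v' ne _]; first rewrite (big_only1 w) // => [|w' ne _].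
  + congr (phi (varr _)); apply: gq_val_inj; rewrite partE // ej.
    by rewrite /= !mulrA eps_idem -!mulrA eps_idem.
  + have -> : part (pi2 (ge (Some w) * j * ge (Some v))) (Some v) (Some w') = 0.
      apply: gq_val_inj; rewrite partE // gq_val0; apply/pi2_0 => //.
      rewrite !mulrA eps_orth (negPf ne) !mul0r; exact: idl0 hJ2.
    by rewrite (zm0 (@varr_zmod _ _ hQ (Some v) (Some w'))) (am0 hphi).
  + rewrite big1 // => w' _; have -> : part (pi2 (ge (Some w) * j * ge (Some v))) (Some v') (Some w') = 0.
      apply: gq_val_inj; rewrite partE // gq_val0; apply/pi2_0 => //.
      rewrite -!mulrA eps_orth eq_sym (negPf ne) !mulr0; exact: idl0 hJ2.
    by rewrite (zm0 (@varr_zmod _ _ hQ (Some v') (Some w'))) (am0 hphi).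
Qed.

Lemma is_counit_like phi : is_counit phi -> counit_like phi.
Proof.
move=> [s [t [_ [_ _ _ ht] hphi hv hx]]]; apply: counit_like_intro => // [v|v w x].
  have [hvv _] := hv v; rewrite -(gq_mem v).2 in hvv.
  by have [_] := proj1 (orbitGP hA _ (eps_idem v)) hvv.
have [j Jj e] := gq_valP x; rewrite hx e.
have Jc : jacobson (ge (Some w) * j * ge (Some v)) by apply: (idlMr hJ); apply: (idlMl hJ).
by have [_ ->] := ht _ Jc.
Qed.

Lemma kernel_ideal (phi : kQ -> A) : alg_mor phi -> ideal_closed [set x | phi x = 0].
Proof.
move=> hphi; split=> [|x y hx hy|a x hx|x a hx] /=; first exact: am0 hphi.
- by rewrite (amB hphi) hx hy subrr.
- by rewrite (amM hphi) hx mulr0.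
- by rewrite (amM hphi) hx mul0r.
Qed.

Lemma counit_like_PAlg_mor phi : counit_like phi -> PAlg_mor phi.
Proof.
move=> hc; have [hphi _ _] := hc.
by have [] := surj_SPAlg_mor hA hphi (counit_like_surj hc).
Qed.

Lemma counit_kernel_ex : exists K : ideal kQ, is_counit_kernel K.
Proof.
have [phi hphi] := counit_ex; have hc := is_counit_like hphi; have [mphi _ _] := hc.
exists (Ideal (kernel_ideal mphi)), phi, phi; split=> //.
  exact: counit_like_PAlg_mor.
exact: sim1_refl.
Qed.

Lemma counit_kernelP (K : ideal kQ) : is_counit_kernel K ->
  exists2 phi, counit_like phi & forall x, ideal_set K x <-> phi x = 0.
Proof.
move=> [phi0 [phi [h0 [hphi _] hs e]]]; exists phi.
  exact: counit_like_sim (is_counit_like h0) hphi hs.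
by move=> x; rewrite e.
Qed.

Lemma kernel_relation (phi : kQ -> A) (K : ideal kQ) : presentation phi ->
  (forall x, ideal_set K x <-> phi x = 0) -> relation_ideal K.
Proof.
move=> [hphi _ hk] hK; split; last by move=> x /hK /hk /cpath_jac2.
apply/cpath_closed => x h; apply/hK; apply: (open_ideal0 psA) => I oI.
have [n hn] := alg_mor_open_ideal hA hphi oI; have [y /hK y0 hy] := h n.
by rewrite -[phi x]subr0 -y0 -(amB hphi); exact: hn.
Qed.
End Gabriel.

(** * The Gabriel quiver of a morphism *)

Section GabrielMorphism.
Variables (k : fieldType) (A B : preTopAlgType k) (EA : seq A) (EB : seq B).
Hypotheses (hA : PAlg_ob A) (hB : PAlg_ob B).
Hypotheses (hEA : complete_primitive EA) (hEB : complete_primitive EB).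
Variables (alpha : A -> B) (phiA : cpath (GQ EA) -> A) (phiB : cpath (GQ EB) -> B).
Hypotheses (halpha : SPAlg_mor alpha) (hphiA : counit_like phiA) (hphiB : counit_like phiB).

Let malpha : alg_mor alpha. Proof. by case: halpha => -[]. Qed.
Let ptA : pointed_algebra A. Proof. by case: hA. Qed.
Let ptB : pointed_algebra B. Proof. by case: hB. Qed.
Let hJ := jac_ideal ptB.
Let hJ2 := jpow_ideal ptB 2.

(** [GQ_map] is the map of Vquivers that corresponds to [alpha \o phiA] under
    the presentation [phiB]. *)
Lemma GQ_map_spec : let r := GQ_map EA EB alpha in
  [/\ is_vmap r, vmap_surj r & sim1 (phiB \o cpath_map r) (alpha \o phiA)].
Proof.
move=> r0; have hQA := GQ_vquiver EA hA; have hQB := GQ_vquiver EB hB.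
have [mA vA xA] := hphiA; have [mB vB xB] := hphiB.
have mcomp := alg_mor_comp malpha mA.
have scomp b : exists x, (alpha \o phiA) x = b.
  case: halpha => _ /(_ b) [a <-]; have [x <-] := counit_like_surj hA hEA hphiA a.
  by exists x.
have [r [hr rs rsim]] :=
  vmap_exists hQB hB (counit_like_presentation hB hEB hphiB) hQA mcomp scomp.
suff -> : r0 = r by [].
have Jv e : jacobson (alpha (gq_idem e) - gq_idem (vmap0 r e)).
  case: e => [v|]; last first.
    have [-> _ _] := hr; rewrite (am0 malpha) subrr; exact: idl0 hJ.
  apply: (idl_trans hJ (y := alpha (phiA (videm (Some v : option (vtx (GQ EA))))))).
    by rewrite -(amB malpha); apply: (jac_mor hA hB malpha); exact: (idl_sym (jac_ideal ptA)).
  apply: (idl_trans hJ (y := phiB (videm (vmap0 r (Some v))))).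
    apply: (idl_sym hJ); have := rsim.1 (videm (Some v : option (vtx (GQ EA)))).
    by rewrite /= cpath_map_videm.
  by case: (vmap0 r (Some v)) => [w|] //=; rewrite (am0 mB) subrr; exact: idl0 hJ.
have idem e : idempotent_elt (alpha (gq_idem (E := EA) e)).
  by rewrite /idempotent_elt -(amM malpha) gq_idem_idem.
have e0 (e : option (gq_vtx EA)) : gq_map0 EB alpha e = vmap0 r e.
  case: e => [v|]; last by have [-> _ _] := hr; rewrite /gq_map0 /= (am0 malpha) eqxx.
  have := Jv (Some v); have := idem (Some v); rewrite /gq_map0.
  case: (vmap0 r (Some v)) => [w|] id_v Jvw.
    case: eqP => [z|_].
      case: (eps_neq0 hEB (v := w)); apply: (jac_idem0 hB); last exact: eps_idem hEB w.
      by move: Jvw; rewrite z sub0r => /(idlN hJ); rewrite opprK.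
    have -> : orbitG (alpha (gq_idem (Some v))) = val w.
      by rewrite -(gq_mem w).2; apply/(orbitG_eq hB) => //; exact: eps_idem hEB w.
    by rewrite valK.
  by case: eqP => // ne; case: ne; apply: (jac_idem0 hB) => //; move: Jvw; rewrite /= subr0.
have Jv' (e : option (gq_vtx EA)) : jacobson (alpha (gq_idem e) - gq_idem (gq_map0 EB alpha e)).
  by rewrite (e0 e); exact: Jv.
apply: (vmap_ext hQB) => [|e f u]; first exact: e0.
apply: varr_ge_eq; apply: (pres_jac2 hB (counit_like_presentation hB hEB hphiB)).
rewrite (amB mB); apply: (idl_trans hJ2 (y := alpha (phiA (varr u)))); last first.
  apply: (idl_sym hJ2); have := rsim.2 (varr u); rewrite /= cpath_map_varr //.
  by apply; apply/cpath_jac/varr_ge.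
apply/pi2_eq => //; rewrite (xB _ _ _).2 /=.
have [j Jj ej] := gq_valP u; have [JA eA] := xA _ _ u.
pose x : A := gq_idem f * (repr (gq_val u) : A) * gq_idem e.
have h2 : jpow 2 ((repr (gq_val u) : A) - phiA (varr u)).
  by apply/pi2_eq => //; rewrite eA reprK.
have Jr : jacobson (repr (gq_val u) : A).
  by apply: (idl_sub (jac_ideal ptA)) JA; apply: (jpow_leS ptA (n := 1)).
have hx : jpow 2 (x - phiA (varr u)).
  apply/pi2_eq => //; rewrite eA ej /x; apply/pi2_eq => //.
  have -> : gq_idem f * j * gq_idem e = gq_idem f * (gq_idem f * j * gq_idem e) * gq_idem e.
    by rewrite !mulrA gq_idem_idem // -!mulrA gq_idem_idem.
  rewrite -mulrBl -mulrBr; apply: (idlMr (jpow_ideal ptA 2)); apply: (idlMl (jpow_ideal ptA 2)).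
  by apply/pi2_eq => //; rewrite -ej reprK.
have ax : alpha (gq_idem f) * alpha (repr (gq_val u) : A) * alpha (gq_idem e) = alpha x.
  by rewrite -!(amM malpha).
have Jax : jacobson (alpha x).
  apply: (jac_mor hA hB malpha); apply: (idlMr (jac_ideal ptA)).
  exact: (idlMl (jac_ideal ptA)).
have -> : gq_val (gq_map1 EB alpha u) = \pi_(lquot (jac2_submod B)) (alpha x : lmod_of B).
  rewrite /gq_map1 /gq_val insubdK ?ax //; apply/asboolP; exists (alpha x) => //.
  apply/pi2_eq => //; have {1}-> : alpha x = alpha (gq_idem f) * alpha x * alpha (gq_idem e).
    by rewrite -!(amM malpha) /x !mulrA gq_idem_idem // -!mulrA gq_idem_idem.
  rewrite mulrB_split; apply: (idlD hJ2); last first.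
    by apply: mul_setM; [exact: (idlMl hJ)|exact: Jv'].
  by apply: (idlMr hJ2); rewrite -mulrBl; apply: mul_setM => //; exact: Jv'.
by apply/pi2_eq => //; rewrite -(amB malpha); exact: (jac2_mor hA hB malpha hx).
Qed.
End GabrielMorphism.

(** * The equivalence *)

Section Factor.
Variables (k : fieldType) (Q : vquiver k) (A C : preTopAlgType k).
Hypotheses (hA : PAlg_ob A) (hC : PAlg_ob C).
Variables (phi : cpath Q -> A) (f : cpath Q -> C).
Hypotheses (hphi : alg_mor phi) (phis : forall a, exists x, phi x = a) (hf : alg_mor f).
Hypothesis ker : forall x, phi x = 0 -> f x = 0.

(** Surjections out of a path algebra are open, hence quotient maps. *)
Lemma surj_factor : exists g : A -> C, alg_mor g /\ forall x, g (phi x) = f x.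
Proof.
have [h hh] := choice phis; pose g a := f (h a).
have gE x : g (phi x) = f x.
  by apply/eqP; rewrite -subr_eq0 -(amB hf) ker // (amB hphi) hh subrr.
exists g; split=> //.
have gB : zmod_morphism g.
  by move=> a b; have [[x <-] [y <-]] := (phis a, phis b); rewrite -(amB hphi) !gE (amB hf).
split=> //.
- split=> [|a b]; first by rewrite -(am1 hphi) gE (am1 hf).
  by have [[x <-] [y <-]] := (phis a, phis b); rewrite -(amM hphi) !gE (amM hf).
- by move=> a; rewrite -(am_scal hphi) gE (am_scal hf).
- have [pA _ _] := hA; have [pC _ _] := hC.
  apply: continuous_ideals => // I oI; have [n hn] := alg_mor_open_ideal hC hf oI.
  have [I' oI' hI'] := image_cpath_ge_open hA hphi phis n; exists I' => // a /hI' [x Nx <-].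
  by rewrite gE; exact: hn.
Qed.
End Factor.

Lemma SPAlg_alg (k : fieldType) (A B : preTopAlgType k) (f : A -> B) : SPAlg_mor f -> alg_mor f.
Proof. by case=> -[]. Qed.

Lemma SPAlg_mor_comp (k : fieldType) (A B C : preTopAlgType k) (g : B -> C) (f : A -> B) :
  PAlg_ob C -> SPAlg_mor g -> SPAlg_mor f -> SPAlg_mor (g \o f).
Proof.
move=> hC hg hf; apply: surj_SPAlg_mor => //; first by apply: alg_mor_comp; exact: SPAlg_alg.
by move=> c; have [b <-] := hg.2 c; have [a <-] := hf.2 b; exists a.
Qed.

Lemma SPAlg1_category (k : fieldType) : is_category (SPAlg1 k).
Proof.
split=> /=.
- by move=> X Y f hX hY _; exact: sim1_refl.
- by move=> X Y f g hX hY _ _; exact: sim1_sym.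
- by move=> X Y f g h hX hY _ _ _; exact: sim1_trans.
- by move=> X hX; apply: surj_SPAlg_mor => //; [exact: alg_mor_id|move=> b; exists b].
- by move=> X Y Z g f hX hY hZ; exact: SPAlg_mor_comp.
- move=> X Y Z g g' f f' hX hY hZ hg hg' hf hf' e e'.
  by apply: sim1_comp => //; exact: SPAlg_alg.
- by move=> X Y f hX hY _; exact: sim1_refl.
- by move=> X Y f hX hY _; exact: sim1_refl.
- by move=> X Y Z W h g f _ _ _ hW _ _ _; exact: sim1_refl.
Qed.

Section Gamma.
Variables (k : fieldType) (Q : vquiver k) (I I' : ideal (cpath Q)).
Hypotheses (rI : relation_ideal I) (rI' : relation_ideal I').
Local Notation pI := (\pi_(aquot I)).
Local Notation pI' := (\pi_(aquot I')).

Lemma gamma_ex d d' : unipotent d -> unipotent d' -> cancel d d' -> cancel d' d ->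
  ideal_set I' = d @` ideal_set I ->
  exists gamma gamma', [/\ @is_gamma k Q I I' gamma gamma', SPAlg_mor gamma & SPAlg_mor gamma'].
Proof.
move=> [[hd _] ds] [[hd' _] ds'] K K' e.
have hQ := cpath_PAlg Q; have hI := aquot_PAlg rI; have hI' := aquot_PAlg rI'.
have [|g [hg gE]] := aquot_factor (I := I) (alg_mor_comp (alg_mor_pi I') hd).
  move=> x Ix /=; rewrite -(am0 (alg_mor_pi I')); apply/aquot_eqP.
  by rewrite subr0 e; exists x.
have [|g' [hg' gE']] := aquot_factor (I := I') (alg_mor_comp (alg_mor_pi I) hd').
  move=> x; rewrite e => -[y Iy <-] /=; rewrite -(am0 (alg_mor_pi I)); apply/aquot_eqP.
  by rewrite subr0 K.
have gK : cancel g g'.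
  by move=> z; have [x <-] := aquot_surj z; rewrite gE /= gE' /= K.
have gK' : cancel g' g.
  by move=> z; have [x <-] := aquot_surj z; rewrite gE' /= gE /= K'.
have sg : SPAlg_mor g by apply: surj_SPAlg_mor => // z; exists (g' z).
have sg' : SPAlg_mor g' by apply: surj_SPAlg_mor => // z; exists (g z).
exists g, g'; split=> //; split.
  split; [by case: sg|by case: sg'| |].
    by have -> : g' \o g = id; [exact/funext|exact: sim1_refl].
  by have -> : g \o g' = id; [exact/funext|exact: sim1_refl].
have -> : g \o pI = pI' \o d by apply/funext => x /=; rewrite gE.
exact: (sim1_compl hQ hI' (alg_mor_pi I') ds).
Qed.

Lemma gamma_inv gamma gamma' : @is_gamma k Q I I' gamma gamma' -> sim1 (gamma' \o pI') pI.
Proof.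
move=> [[[hg _] [hg' _] h1 h2] h3].
have hQ := cpath_PAlg Q; have hI := aquot_PAlg rI; have hI' := aquot_PAlg rI'.
apply: (sim1_trans hI (g := gamma' \o (gamma \o pI))).
  by apply: (sim1_compl hI' hI hg'); apply: sim1_sym.
exact: (sim1_compr hQ hI (alg_mor_pi I) h1).
Qed.
End Gamma.

Section Equivalence.
Variables (k : fieldType) (rep : forall X : svquiver k, ideal (cpath (sv_quiver X))).
Hypothesis repP : forall (X : svquiver k) I, sv_class X I -> sv_class X (rep X).
Local Notation FX X := (aquot (rep X)).
Local Notation pX X := (\pi_(aquot (rep X))).

Lemma rep_class (X : svquiver k) : is_svquiver X -> sv_class X (rep X).
Proof.
move=> [_ [I _ e]]; apply: (@repP X I); rewrite e; exact: ideal_class_self.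
Qed.

Lemma class_relation (X : svquiver k) I : is_svquiver X -> sv_class X I -> relation_ideal I.
Proof. by move=> [_ [I0 r0 e]]; rewrite e; exact: ideal_class_relation r0. Qed.

Lemma rep_relation (X : svquiver k) : is_svquiver X -> relation_ideal (rep X).
Proof. by move=> hX; apply: (class_relation hX); exact: rep_class. Qed.

Lemma FX_PAlg (X : svquiver k) : is_svquiver X -> PAlg_ob (FX X).
Proof. by move=> hX; apply: aquot_PAlg; exact: rep_relation. Qed.

Lemma pX_pres (X : svquiver k) : is_svquiver X -> presentation (pX X).
Proof. by move=> hX; apply: aquot_presentation; exact: rep_relation. Qed.

Lemma pX_kills (X : svquiver k) x : ideal_set (rep X) x -> pX X x = 0.
Proof. by move=> h; rewrite -(am0 (alg_mor_pi (rep X))); apply/aquot_eqP; rewrite subr0. Qed.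

Lemma pX_ker (X : svquiver k) x : pX X x = 0 -> ideal_set (rep X) x.
Proof. by rewrite -(am0 (alg_mor_pi (rep X))) => /aquot_eqP; rewrite subr0. Qed.

(** A map of Vquivers that covers, up to [sim1], a morphism killing a relation
    ideal of the source and presented by one of the target respects the classes:
    lift the second morphism through the first. *)
Lemma svmap_intro (X Y : svquiver k) (r : vmap (sv_quiver X) (sv_quiver Y))
    (B : preTopAlgType k) (alpha : cpath (sv_quiver X) -> B) (phi : cpath (sv_quiver Y) -> B)
    (I : ideal (cpath (sv_quiver X))) (L : ideal (cpath (sv_quiver Y))) :
  is_svquiver X -> is_svquiver Y -> PAlg_ob B -> is_vmap r -> vmap_surj r ->
  alg_mor alpha -> alg_mor phi -> (forall b, exists y, phi y = b) ->
  sim1 (phi \o cpath_map r) alpha ->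
  sv_class X I -> (forall x, ideal_set I x -> alpha x = 0) ->
  sv_class Y L -> (forall y, phi y = 0 -> ideal_set L y) -> is_svmap r.
Proof.
move=> hX hY hB hr rs ha hp ps hs cI aI cL kL.
have [[hQX [I0 rI0 eX]] [hQY _]] := (hX, hY); have hQ := cpath_PAlg (sv_quiver X).
have hm := cpath_map_alg hQX hQY hr; have hpm := alg_mor_comp hp hm.
have [|d [hd ds de]] := cpath_lift hB hQ hpm _ ha (alg_mor_id _) hs.
  by move=> b; have [y <-] := ps b; have [x <-] := cpath_map_surj hQX hQY hr rs y; exists x.
have ud := alg_sim1_unipotent hd ds.
rewrite eX in cI; have [I' cI' eI'] := ideal_class_move cI ud.
split=> //; exists I', L; split=> //; first by rewrite eX.
move=> x; rewrite eI' => -[y Iy <-]; apply: kL.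
by rewrite -[LHS]/((phi \o cpath_map r \o d) y) de aI.
Qed.

Lemma kinf_mor_ex (X Y : svquiver k) (r : vmap (sv_quiver X) (sv_quiver Y)) :
  is_svquiver X -> is_svquiver Y -> is_svmap r -> exists phi, is_kinf_mor (rep := rep) r phi.
Proof.
move=> hX hY [hr rs [I' [K' [cI' cK' hIK]]]].
have [[hQX [I0 rI0 eX]] [hQY [K0 rK0 eY]]] := (hX, hY).
have rI' := class_relation hX cI'; have rK' := class_relation hY cK'.
have cI := rep_class hX; have cK := rep_class hY.
have hm := cpath_map_alg hQX hQY hr.
have gX : exists gamma gamma', [/\ is_gamma (I := rep X) (I' := I') gamma gamma', SPAlg_mor gamma & SPAlg_mor gamma'].
  rewrite eX in cI cI'; have [d [d' [ud ud' K1 K2 e]]] := ideal_class_link cI cI'.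
  exact: (gamma_ex (rep_relation hX) rI' ud ud' K1 K2 e).
have gY : exists gamma gamma', [/\ is_gamma (I := rep Y) (I' := K') gamma gamma', SPAlg_mor gamma & SPAlg_mor gamma'].
  rewrite eY in cK cK'; have [d [d' [ud ud' K1 K2 e]]] := ideal_class_link cK cK'.
  exact: (gamma_ex (rep_relation hY) rK' ud ud' K1 K2 e).
have [gI [gI' [hgI sgI sgI']]] := gX; have [gK [gK' [hgK sgK sgK']]] := gY.
have [|rbar [hrb rbE]] := aquot_factor (I := I') (alg_mor_comp (alg_mor_pi K') hm).
  move=> x Ix /=; rewrite -(am0 (alg_mor_pi K')); apply/aquot_eqP.
  by rewrite subr0; exact: hIK.
have srb : SPAlg_mor rbar.
  apply: surj_SPAlg_mor => //; first exact: aquot_PAlg.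
  move=> z; have [y <-] := aquot_surj z; have [x <-] := cpath_map_surj hQX hQY hr rs y.
  by exists (\pi_(aquot I') x); rewrite rbE.
have hFY := FX_PAlg hY.
exists (gK' \o rbar \o gI), I', K', gI, gI', gK, gK', rbar; split=> //.
split; last exact: sim1_refl.
apply: SPAlg_mor_comp => //; apply: SPAlg_mor_comp => //.
Qed.

(** Compatibility with the projections characterises the class of the image of
    [r]: the isomorphisms [gamma] are compatible with them up to [sim1]. *)
Lemma kinf_spec (X Y : svquiver k) (r : vmap (sv_quiver X) (sv_quiver Y)) (f := fmor (kinf rep) (X := X) (Y := Y) r) :
  is_svquiver X -> is_svquiver Y -> is_svmap r ->
  SPAlg_mor f /\ sim1 (f \o pX X) (pX Y \o cpath_map r).
Proof.
move=> hX hY hr; have : is_kinf_mor (rep := rep) r f.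
  rewrite /f /= /some_such; case: pselect => [h|[]]; last exact: kinf_mor_ex.
  exact: projT2 (cid h).
move=> [I' [K' [gI [gI' [gK [gK' [rbar [[cI' cK' hIK] hgI hgK rbE [hf fs]]]]]]]]].
split=> //; have [[hQX _] [hQY _]] := (hX, hY); have [hvr _ _] := hr.
have hm := cpath_map_alg hQX hQY hvr.
have rI' := class_relation hX cI'; have rK' := class_relation hY cK'.
have [hI' hK'] := (aquot_PAlg rI', aquot_PAlg rK').
have [hFX hFY] := (FX_PAlg hX, FX_PAlg hY).
have [hkX hkY] := (cpath_PAlg (sv_quiver X), cpath_PAlg (sv_quiver Y)).
have mrb : alg_mor rbar.
  have [|g [hg gE]] := aquot_factor (I := I') (alg_mor_comp (alg_mor_pi K') hm).
    move=> x Ix /=; rewrite -(am0 (alg_mor_pi K')); apply/aquot_eqP.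
    by rewrite subr0; exact: hIK.
  suff -> : rbar = g by [].
  by apply/funext => z; have [x <-] := aquot_surj z; rewrite rbE gE.
have [[[mgK _] [mgK' _] _ _] _] := hgK; have [_ sgI] := hgI.
have m1 := alg_mor_comp mgK' mrb.
apply: (sim1_trans hFY (g := (gK' \o rbar \o gI) \o pX X)).
  exact: (sim1_compr hkX hFX (alg_mor_pi _) fs).
apply: (sim1_trans hFY (g := (gK' \o rbar) \o \pi_(aquot I'))).
  exact: (sim1_compl hI' hFY m1 sgI).
have -> : (gK' \o rbar) \o \pi_(aquot I') = (gK' \o \pi_(aquot K')) \o cpath_map r.
  by apply/funext => x /=; rewrite rbE.
exact: (sim1_compr hkX hkY hm (gamma_inv (rep_relation hY) rK' hgK)).
Qed.

Lemma svmap_vmap (X Y : svquiver k) (r : vmap (sv_quiver X) (sv_quiver Y)) : is_svmap r -> is_vmap r.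
Proof. by case. Qed.

Lemma svmap_comp (X Y Z : svquiver k) (s : vmap (sv_quiver Y) (sv_quiver Z)) (r : vmap (sv_quiver X) (sv_quiver Y)) :
  is_svquiver X -> is_svquiver Y -> is_svquiver Z -> is_svmap s -> is_svmap r ->
  [/\ is_svmap (vmap_comp s r : vmap (sv_quiver X) (sv_quiver Z)) &
      sim1 (pX Z \o cpath_map (vmap_comp s r))
           (fmor (kinf rep) (X := Y) (Y := Z) s \o fmor (kinf rep) (X := X) (Y := Y) r \o pX X)].
Proof.
move=> hX hY hZ hs hr.
have [[hQX _] [hQY _] [hQZ _]] := And3 hX hY hZ.
have [Fs Ss] := kinf_spec hY hZ hs; have [Fr Sr] := kinf_spec hX hY hr.
have [vs vr] := (svmap_vmap hs, svmap_vmap hr).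
have [hFX hFY hFZ] := And3 (FX_PAlg hX) (FX_PAlg hY) (FX_PAlg hZ).
have sim : sim1 (pX Z \o cpath_map (vmap_comp s r))
    (fmor (kinf rep) (X := Y) (Y := Z) s \o fmor (kinf rep) (X := X) (Y := Y) r \o pX X).
  rewrite cpath_map_comp //; apply: (sim1_sym hFZ).
  apply: (sim1_trans hFZ (g := fmor (kinf rep) (X := Y) (Y := Z) s \o (pX Y \o cpath_map r))).
    exact: (sim1_compl hFY hFZ (SPAlg_alg Fs) Sr).
  exact: (sim1_compr (cpath_PAlg _) (cpath_PAlg _) (cpath_map_alg hQX hQY vr) Ss).
split=> //; have [pm ps _] := pX_pres hZ.
apply: (svmap_intro hX hZ hFZ _ _ _ pm ps sim (rep_class hX) _ (rep_class hZ)).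
- exact: is_vmap_comp.
- move=> e f y; have [_ ss _] := hs; have [_ rs _] := hr.
  by have [z <-] := ss _ _ y; have [x <-] := rs _ _ z; exists x.
- by apply: alg_mor_comp (alg_mor_pi _); apply: alg_mor_comp; exact: SPAlg_alg.
- move=> x /pX_kills h; rewrite -[LHS]/(fmor (kinf rep) (X := Y) (Y := Z) s
    (fmor (kinf rep) (X := X) (Y := Y) r (pX X x))) h.
  by rewrite (am0 (SPAlg_alg Fr)) (am0 (SPAlg_alg Fs)).
- exact: pX_ker.
Qed.

Lemma svmap_id (X : svquiver k) : is_svquiver X ->
  is_svmap (vmap_id (sv_quiver X) : vmap (sv_quiver X) (sv_quiver X)).
Proof.
move=> hX; have [hQ _] := hX; split.
- exact: is_vmap_id.
- by move=> e f y; exists y.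
- by exists (rep X), (rep X); split; rewrite ?cpath_map_id //; exact: rep_class.
Qed.

Lemma SVQuiv_category : is_category (SVQuiv k).
Proof.
split=> //=.
- by move=> X Y f g h _ _ _ _ _ -> ->.
- by move=> X hX; exact: svmap_id.
- by move=> X Y Z g f hX hY hZ hg hf; have [] := svmap_comp hX hY hZ hg hf.
- by move=> X Y Z g g' f f' _ _ _ _ _ _ _ -> ->.
- by move=> X Y [].
- by move=> X Y [].
Qed.

Lemma kinf_functor : is_functor (kinf rep).
Proof.
split=> /=.
- by move=> X hX; exact: FX_PAlg.
- by move=> X Y f hX hY hf; have [] := kinf_spec hX hY hf.
- by move=> X Y f g hX hY hf hg ->; exact: sim1_refl (FX_PAlg hY).
- move=> X hX; have [hQ _] := hX; have [_ h] := kinf_spec hX hX (svmap_id hX).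
  have [pm ps _] := pX_pres hX.
  apply: (sim1_cancel (cpath_PAlg _) (FX_PAlg hX) pm ps).
  by rewrite cpath_map_id in h.
- move=> X Y Z g f hX hY hZ hg hf; have [hc sc] := svmap_comp hX hY hZ hg hf.
  have [_ h] := kinf_spec hX hZ hc; have [pm ps _] := pX_pres hX.
  apply: (sim1_cancel (cpath_PAlg _) (FX_PAlg hX) pm ps).
  exact: (sim1_trans (FX_PAlg hZ) h sc).
Qed.
End Equivalence.

Section GabrielFunctor.
Variables (k : fieldType) (E : forall A : preTopAlgType k, seq A).
Hypothesis EP : forall (A : preTopAlgType k) (s : seq A),
  complete_primitive s -> complete_primitive (E A).
Variable K : forall A : preTopAlgType k, ideal (cpath (GQ (E A))).
Hypothesis KP : forall (A : preTopAlgType k) (I : ideal (cpath (GQ (E A)))),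
  is_counit_kernel I -> is_counit_kernel (K A).
Local Notation G := (GQinf K).
Implicit Types A B C : preTopAlgType k.

Lemma E_complete A : PAlg_ob A -> complete_primitive (E A).
Proof. by move=> hA; have [s hs] := complete_primitive_ex hA; exact: EP hs. Qed.

(** Chosen so that its kernel is [K A] itself, not just in the class of [K A]. *)
Definition counit_rep A : cpath (GQ (E A)) -> A :=
  some_such (fun=> 0) (fun phi => counit_like phi /\ forall x, ideal_set (K A) x <-> phi x = 0).
Local Notation phi A := (@counit_rep A).

Lemma counit_repP A : PAlg_ob A ->
  counit_like (phi A) /\ forall x, ideal_set (K A) x <-> phi A x = 0.
Proof.
move=> hA; rewrite /counit_rep /some_such; case: pselect => [h|[]].
  exact: projT2 (cid h).
have hE := E_complete hA; have [I hI] := counit_kernel_ex hA hE.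
by have [f h1 h2] := counit_kernelP hA hE (KP hI); exists f.
Qed.

Lemma counit_rep_pres A : PAlg_ob A -> presentation (phi A).
Proof.
by move=> hA; apply: (counit_like_presentation hA (E_complete hA)); case: (counit_repP hA).
Qed.

Lemma G_svquiver A : PAlg_ob A -> is_svquiver (G A).
Proof.
move=> hA; split; first exact: GQ_vquiver.
exists (K A) => //; apply: (kernel_relation hA (counit_rep_pres hA)).
by case: (counit_repP hA).
Qed.

Lemma G_mor A B (f : A -> B) : PAlg_ob A -> PAlg_ob B -> SPAlg_mor f ->
  @is_svmap k (G A) (G B) (GQ_map (E A) (E B) f) /\
  sim1 (phi B \o cpath_map (GQ_map (E A) (E B) f)) (f \o phi A).
Proof.
move=> hA hB hf; have [[cA kA] [cB kB]] := (counit_repP hA, counit_repP hB).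
have [hr rs sim] := GQ_map_spec hA hB (E_complete hA) (E_complete hB) hf cA cB.
have [[mA _ _] [mB sB _]] := (counit_rep_pres hA, counit_rep_pres hB).
split=> //; apply: (svmap_intro (G_svquiver hA) (G_svquiver hB) hB hr rs _ mB sB sim
  (ideal_class_self (K A)) _ (ideal_class_self (K B))).
- by apply: alg_mor_comp mA; exact: SPAlg_alg.
- by move=> x /kA h /=; rewrite h (am0 (SPAlg_alg hf)).
- by move=> y /kB.
Qed.

Lemma G_faithful (P : vquiver k) A (r s : vmap P (GQ (E A))) : PAlg_ob A -> is_vquiver P ->
  is_vmap r -> is_vmap s -> sim1 (phi A \o cpath_map r) (phi A \o cpath_map s) -> r = s.
Proof. by move=> hA; apply: (vmap_faithful (GQ_vquiver _ hA) hA (counit_rep_pres hA)). Qed.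

Lemma GQinf_functor : is_functor G.
Proof.
split=> /=.
- by move=> A hA; exact: G_svquiver.
- by move=> A B f hA hB hf; have [] := G_mor hA hB hf.
- move=> A B f g hA hB hf hg fg; have [[hr _ _] sf] := G_mor hA hB hf.
  have [[hs _ _] sg] := G_mor hA hB hg; have [mA _ _] := counit_rep_pres hA.
  apply: (G_faithful hB (GQ_vquiver _ hA) hr hs); apply: (sim1_trans hB sf).
  apply: (sim1_trans hB (g := g \o phi A)); last exact: sim1_sym.
  exact: (sim1_compr (cpath_PAlg _) hA mA fg).
- move=> A hA; have hQ := GQ_vquiver (E A) hA.
  have hid : SPAlg_mor (id : A -> A).
    by apply: surj_SPAlg_mor => //; [exact: alg_mor_id|move=> b; exists b].
  have [[hr _ _] sf] := G_mor hA hA hid.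
  apply: (G_faithful hA hQ hr); first exact: is_vmap_id.
  by rewrite cpath_map_id.
- move=> A B C g f hA hB hC hg hf; have hgf := SPAlg_mor_comp hC hg hf.
  have [[hr _ _] s1] := G_mor hA hB hf; have [[hs _ _] s2] := G_mor hB hC hg.
  have [[ht _ _] s3] := G_mor hA hC hgf.
  have [qA qB qC] := And3 (GQ_vquiver (E A) hA) (GQ_vquiver (E B) hB) (GQ_vquiver (E C) hC).
  apply: (G_faithful hC qA ht (is_vmap_comp hs hr)); apply: (sim1_trans hC s3).
  rewrite cpath_map_comp //; apply: (sim1_sym hC).
  apply: (sim1_trans hC (g := g \o (phi B \o cpath_map (GQ_map (E A) (E B) f)))).
    exact: (sim1_compr (cpath_PAlg _) (cpath_PAlg _) (cpath_map_alg qA qB hr) s2).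
  exact: (sim1_compl hB hC (SPAlg_alg hg) s1).
Qed.

Variable rep : forall X : svquiver k, ideal (cpath (sv_quiver X)).
Hypothesis repP : forall (X : svquiver k) I, sv_class X I -> sv_class X (rep X).
Local Notation F := (kinf rep).
Local Notation pX X := (\pi_(aquot (rep X))).

Definition is_unit_at (X : svquiver k) (e : vmap (sv_quiver X) (GQ (E (F X)))) : Prop :=
  @is_iso (SVQuiv k) X (G (F X)) e /\ sim1 (phi (F X) \o cpath_map e) (pX X).

Definition is_counit_at A (e : F (G A) -> A) : Prop :=
  @is_iso (SPAlg1 k) (F (G A)) A e /\ sim1 (e \o pX (G A)) (phi A).

(** Both the projection from [k[[X]]] and the counit present [F X]; comparing
    the two presentations in both directions gives inverse maps of Vquivers. *)
Lemma unit_ex X : is_svquiver X -> exists e, @is_unit_at X e.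
Proof.
move=> hX; have hF := FX_PAlg repP hX; have hG := G_svquiver hF.
have [hQ _] := hX; have hQG := GQ_vquiver (E (F X)) hF.
have hp := pX_pres repP hX; have hc := counit_rep_pres hF.
have [[pm ps _] [cm cs _]] := (hp, hc); have [_ kc] := counit_repP hF.
have [e [he es esim]] := vmap_exists hQG hF hc hQ pm ps.
have [g [hg gs gsim]] := vmap_exists hQ hF hp hQG cm cs.
have me : @is_svmap k X (G (F X)) e.
  apply: (svmap_intro hX hG hF he es pm cm cs esim (rep_class repP hX) _ (ideal_class_self _)).
    exact: pX_kills.
  by move=> y /kc.
have mg : @is_svmap k (G (F X)) X g.
  apply: (svmap_intro hG hX hF hg gs cm pm ps gsim (ideal_class_self _) _ (rep_class repP hX)).
    by move=> x /kc.
  exact: pX_ker.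
exists e; split=> //; split=> //; exists g; split=> //=.
- apply: (vmap_faithful hQ hF hp hQ (is_vmap_comp hg he)).
    exact: is_vmap_id.
  rewrite cpath_map_comp // cpath_map_id //.
  apply: (sim1_trans hF (g := phi (F X) \o cpath_map e)) => //.
  exact: (sim1_compr (cpath_PAlg _) (cpath_PAlg _) (cpath_map_alg hQ hQG he) gsim).
- apply: (vmap_faithful hQG hF hc hQG (is_vmap_comp he hg)).
    exact: is_vmap_id.
  rewrite cpath_map_comp // cpath_map_id //.
  apply: (sim1_trans hF (g := pX X \o cpath_map g)) => //.
  exact: (sim1_compr (cpath_PAlg _) (cpath_PAlg _) (cpath_map_alg hQG hQ hg) esim).
Qed.

(** [rep (G A)] is the image of [K A] under a unipotent automorphism [d]; the
    counit precomposed with the inverse of [d] induces the isomorphism. *)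
Lemma counit_at_ex A : PAlg_ob A -> exists e, @is_counit_at A e.
Proof.
move=> hA; have hG := G_svquiver hA; have hF := FX_PAlg repP hG.
have hc := counit_rep_pres hA; have [cm cs _] := hc; have [_ kc] := counit_repP hA.
have [d [d' [[[md _] ds] [[md' _] ds'] K1 K2 e]]] :=
  ideal_class_link (ideal_class_self (K A)) (rep_class repP hG).
have hk := cpath_PAlg (GQ (E A)).
have [|eps [meps epsE]] := aquot_factor (I := rep (G A)) (alg_mor_comp cm md').
  by move=> x; rewrite e => -[y /kc ky <-] /=; rewrite K1.
have mpd := alg_mor_comp (alg_mor_pi (rep (G A))) md.
have [|g [mg gE]] := surj_factor hA hF cm cs mpd.
  move=> x /kc kx; have h : ideal_set (rep (G A)) (d x) by rewrite e; exists x.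
  exact: (pX_kills h).
have K3 : cancel eps g.
  by move=> z; have [x <-] := aquot_surj z; rewrite epsE /= gE /= K2.
have K4 : cancel g eps.
  by move=> a; have [x <-] := cs a; rewrite gE /= epsE /= K1.
exists eps; split.
  split; first by apply: surj_SPAlg_mor => // a; exists (g a).
  exists g; split=> /=; first by apply: surj_SPAlg_mor => // z; exists (eps z).
    by have -> : g \o eps = id; [exact/funext|exact: sim1_refl].
  by have -> : eps \o g = id; [exact/funext|exact: sim1_refl].
have -> : eps \o pX (G A) = phi A \o d' by apply/funext => x; exact: epsE.
exact: (sim1_compl hk hA cm ds').
Qed.

Lemma adjoint_equivalence_kinf_GQinf : adjoint_equivalence F G.
Proof.
pose vmap0 (P Q : vquiver k) : vmap P Q := VMap (fun _ _ (_ : arr _ _) => 0 : arr None None).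
pose eta (X : svquiver k) := some_such (vmap0 (sv_quiver X) (GQ (E (F X)))) (@is_unit_at X).
pose eps A := some_such (fun=> 0) (@is_counit_at A).
have etaP X : is_svquiver X -> is_unit_at (eta X).
  rewrite /eta /some_such => /unit_ex h; case: pselect => // h'; exact: projT2 (cid h').
have epsP A : PAlg_ob A -> is_counit_at (eps A).
  rewrite /eps /some_such => /counit_at_ex h; case: pselect => // h'; exact: projT2 (cid h').
exists eta, eps; split.
- by split=> [X /etaP []|A /epsP []].
- move=> X Y f /= hX hY hf; have [hFX hFY] := (FX_PAlg repP hX, FX_PAlg repP hY).
  have [[[eX _] sX] [[eY _] sY]] := (etaP X hX, etaP Y hY).
  have [hFf sFf] := kinf_spec repP hX hY hf.
  have [hGf sGf] := G_mor hFX hFY hFf.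
  have [[vX vY] [vf vG]] := ((svmap_vmap eX, svmap_vmap eY), (svmap_vmap hf, svmap_vmap hGf)).
  have [[qX _] [qY _]] := (hX, hY).
  have [gX gY] := (GQ_vquiver (E (F X)) hFX, GQ_vquiver (E (F Y)) hFY).
  apply: (G_faithful hFY qX (is_vmap_comp vY vf) (is_vmap_comp vG vX)).
  rewrite !cpath_map_comp //.
  apply: (sim1_trans hFY (g := pX Y \o cpath_map f)).
    exact: (sim1_compr (cpath_PAlg _) (cpath_PAlg _) (cpath_map_alg qX qY vf) sY).
  apply: (sim1_sym hFY); apply: (sim1_trans hFY (g := fmor F f \o (phi (F X) \o cpath_map (eta X)))).
    exact: (sim1_compr (cpath_PAlg _) (cpath_PAlg _) (cpath_map_alg qX gX vX) sGf).
  apply: (sim1_trans hFY (g := fmor F f \o pX X)) => //.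
  exact: (sim1_compl hFX hFY (SPAlg_alg hFf) sX).
- move=> A B f /= hA hB hf; have [hGf sGf] := G_mor hA hB hf.
  have [gA gB] := (G_svquiver hA, G_svquiver hB).
  have [hFA hFB] := (FX_PAlg repP gA, FX_PAlg repP gB).
  have [[[eA _] sA] [[eB _] sB]] := (epsP A hA, epsP B hB).
  have [hF sF] := kinf_spec repP gA gB hGf; have vG := svmap_vmap hGf.
  have [pm ps _] := pX_pres repP gA.
  have qm := cpath_map_alg (GQ_vquiver (E A) hA) (GQ_vquiver (E B) hB) vG.
  apply: (sim1_cancel (cpath_PAlg _) hFA pm ps).
  apply: (sim1_trans hB (g := eps B \o (pX (G B) \o cpath_map (GQ_map (E A) (E B) f)))).
    exact: (sim1_compl hFB hB (SPAlg_alg eB) sF).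
  apply: (sim1_trans hB (g := phi B \o cpath_map (GQ_map (E A) (E B) f))).
    exact: (sim1_compr (cpath_PAlg _) (cpath_PAlg _) qm sB).
  apply: (sim1_trans hB sGf); apply: (sim1_sym hB).
  exact: (sim1_compl hA hB (SPAlg_alg hf) sA).
- move=> X /= hX; have hFX := FX_PAlg repP hX; have gX := G_svquiver hFX.
  have [[eX _] sX] := etaP X hX; have [[eF _] sF] := epsP _ hFX.
  have hFGX := FX_PAlg repP gX.
  have [hFe sFe] := kinf_spec repP hX gX eX; have [pm ps _] := pX_pres repP hX.
  have [qX _] := hX.
  apply: (sim1_cancel (cpath_PAlg _) hFX pm ps).
  apply: (sim1_trans hFX (g := eps (F X) \o (pX (G (F X)) \o cpath_map (eta X)))).
    exact: (sim1_compl hFGX hFX (SPAlg_alg eF) sFe).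
  apply: (sim1_trans hFX (g := phi (F X) \o cpath_map (eta X))) => //.
  have qm := cpath_map_alg qX (GQ_vquiver (E (F X)) hFX) (svmap_vmap eX).
  exact: (sim1_compr (cpath_PAlg _) (cpath_PAlg _) qm sF).
- move=> A /= hA; have gA := G_svquiver hA; have hFA := FX_PAlg repP gA.
  have gFA := G_svquiver hFA.
  have [[eG _] sG] := etaP _ gA; have [[eA _] sA] := epsP A hA.
  have [hGe sGe] := G_mor hFA hA eA.
  have [qA qFA] := (GQ_vquiver (E A) hA, GQ_vquiver (E (F (G A))) hFA).
  have [v1 v2] := (svmap_vmap hGe, svmap_vmap eG).
  apply: (G_faithful hA qA (is_vmap_comp v1 v2)).
    exact: is_vmap_id.
  rewrite cpath_map_comp // cpath_map_id //.
  apply: (sim1_trans hA (g := eps A \o (phi (F (G A)) \o cpath_map (eta (G A))))).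
    exact: (sim1_compr (cpath_PAlg _) (cpath_PAlg _) (cpath_map_alg qA qFA v2) sGe).
  apply: (sim1_trans hA (g := eps A \o pX (G A))) => //.
  exact: (sim1_compl hFA hA (SPAlg_alg eA) sG).
Qed.
End GabrielFunctor.

Theorem theorem7p8 (k : fieldType) (k_perfect : perfect_field k)
    (rep : forall X : svquiver k, ideal (cpath (sv_quiver X)))
    (repP : forall (X : svquiver k) I, sv_class X I -> sv_class X (rep X))
    (E : forall A : preTopAlgType k, seq A)
    (EP : forall (A : preTopAlgType k) (s : seq A),
        complete_primitive s -> complete_primitive (E A))
    (K : forall A : preTopAlgType k, ideal (cpath (GQ (E A))))
    (KP : forall (A : preTopAlgType k) (I : ideal (cpath (GQ (E A)))),
        is_counit_kernel I -> is_counit_kernel (K A)) :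
  [/\ is_category (SVQuiv k), is_category (SPAlg1 k),
      is_functor (kinf rep), is_functor (GQinf K) &
      adjoint_equivalence (kinf rep) (GQinf K)].
Proof.
split.
- exact: SVQuiv_category repP.
- exact: SPAlg1_category.
- exact: kinf_functor repP.
- exact: GQinf_functor EP K KP.
- exact: adjoint_equivalence_kinf_GQinf EP K KP rep repP.
Qed.
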